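(* Let $(\overline M,\bar g)$ be a Riemannian manifold of dimension $m+n$ with a parallel calibration $\Omega$ of rank $m\ge2$. Let $F:M\to\overline M$ be an immersed oriented connected $m$-dimensional submanifold with parallel mean curvature $H$, induced metric $g$, and $\Omega$-angle $\theta$ satisfying $\cos\theta>0$. Then on every compact domain $D$ of $M$, $$\|H\|\le\frac1m\left(\frac{\sup_{\partial D}\sin\theta}{\inf_D\cos\theta}\right)\frac{A(\partial D,g)}{V(D,g)}.$$ In particular: (1) If $\cos\theta\ge\tau>0$ where $\tau$ is a constant, then $\|H\|\le\frac1m\,\frac{\sqrt{1-\tau^2}}{\tau}\,\mathfrak h(M,g)$. In this case, if $M$ has zero Cheeger constant, then $M$ is a minimal submanifold. (2) If $\cos\theta=1$ on $\partial D$ for some compact domain $D$, then $F$ is a minimal immersion.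
   Context: A calibration of rank $m$ on $(\overline M,\bar g)$ is a closed $m$-form $\Omega$ with comass one: at each $p$, $|\Omega(X_1,\dots,X_m)|\le1$ for all orthonormal systems, with equality for some system; it is parallel if $\overline\nabla\Omega=0$. $M$ carries the metric $g=F^*\bar g$. $H=\frac1m\mathrm{trace}_gB$ ($B$ the second fundamental form) is the mean curvature vector; it is parallel if $\nabla^{\bot}H=0$ for the normal connection; $F$ is minimal if $H=0$. The $\Omega$-angle $\theta:M\to[0,\pi]$ is given by $\cos\theta=\Omega(X_1,\dots,X_m)$ for a direct orthonormal frame $X_i$ of $T_pM$. A compact domain $D$ is an open submanifold of $M$ with compact closure and smooth boundary; $A(\partial D,g)$ and $V(D,g)$ are the area of $\partial D$ and volume of $D$. The Cheeger constant is $\mathfrak h(M,g)=\inf_D A(\partial D,g)/V(D,g)$ over all compact domains $D$ (if $M$ is closed, $D=M$ with empty boundary is allowed, so the constant is $0$). *)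

(* Defs.v *)
From HB Require Import structures.
From mathcomp Require Import all_boot all_order all_algebra.
From mathcomp Require Import all_classical all_reals all_analysis.

Set Implicit Arguments.
Unset Strict Implicit.
Unset Printing Implicit Defensive.

Import Order.TTheory GRing.Theory Num.Theory.
Import numFieldNormedType.Exports.

Local Open Scope classical_set_scope.
Local Open Scope ring_scope.

(* Tensors are handled by their components in every chart of a maximal       *)
(* smooth atlas. Coordinates and tangent vectors are row vectors: the        *)
(* differential of f at x sends v to v *m 'J f x.                            *)

(* All maps are only relevant on the open set U. *)
Fixpoint Ck_on (R : realType) (k : nat) (W : normedModType R) (j : nat)
    (U : set 'rV[R]_k) (f : 'rV[R]_k -> W) : Prop :=
  match j with
  | 0%N => forall x, U x -> {for x, continuous f}
  | j'.+1 => (forall x, U x -> differentiable f x) /\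
             (forall v, Ck_on j' U (fun x => 'D_v f x))
  end.

Definition smooth_on (R : realType) (k : nat) (W : normedModType R)
    (U : set 'rV[R]_k) (f : 'rV[R]_k -> W) : Prop :=
  forall j, Ck_on j U f.

(* cmap and cinv are total functions; their values outside cdom, resp.       *)
(* outside the image of cdom, are irrelevant.                                *)
Record chart (R : realType) (T : topologicalType) (k : nat) := Chart {
  cdom : set T;
  cmap : T -> 'rV[R]_k;
  cinv : 'rV[R]_k -> T;
  cdom_open : open cdom;
  cimg_open : open (cmap @` cdom);
  cmapK : forall p, cdom p -> cinv (cmap p) = p;
  cmap_continuous : forall p, cdom p -> {for p, continuous cmap};
  cinv_continuous : forall x, (cmap @` cdom) x -> {for x, continuous cinv}
}.

Definition change (R : realType) (T : topologicalType) (k : nat)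
    (phi psi : chart R T k) : 'rV[R]_k -> 'rV[R]_k :=
  cmap psi \o cinv phi.

Definition compatible (R : realType) (T : topologicalType) (k : nat)
    (phi psi : chart R T k) : Prop :=
  smooth_on (cmap phi @` (cdom phi `&` cdom psi)) (change phi psi) /\
  smooth_on (cmap psi @` (cdom phi `&` cdom psi)) (change psi phi).

Record manifold (R : realType) (k : nat) := Manifold {
  carrier :> ptopologicalType;
  atlas : set (chart R carrier k);
  manifold_hausdorff : hausdorff_space carrier;
  manifold_second_countable : @second_countable carrier;
  atlas_cover : forall p : carrier, exists phi, atlas phi /\ cdom phi p;
  atlas_compatible : forall phi psi, atlas phi -> atlas psi ->
    compatible phi psi;
  atlas_maximal : forall phi,
    (forall psi, atlas psi -> compatible phi psi) -> atlas phi
}.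

Definition chart_around (R : realType) (k : nat) (M : manifold R k)
    (phi : chart R M k) (p : M) : Prop :=
  atlas phi /\ cdom phi p.

Record orientation (R : realType) (k : nat) (M : manifold R k) := Orientation {
  direct :> set (chart R M k);
  direct_atlas : direct `<=` @atlas R k M;
  direct_cover : forall p : M, exists phi, direct phi /\ cdom phi p;
  direct_det : forall phi psi p, direct phi -> direct psi ->
    cdom phi p -> cdom psi p ->
    0 < \det ('J (change phi psi) (cmap phi p))
}.

Definition ip (R : realType) (k : nat) (G : 'M[R]_k) (v w : 'rV[R]_k) : R :=
  (v *m G *m w^T) 0 0.

Record metric (R : realType) (k : nat) (M : manifold R k) := Metric {
  gmx :> chart R M k -> 'rV[R]_k -> 'M[R]_k;
  gmx_smooth : forall phi, atlas phi -> smooth_on (cmap phi @` cdom phi) (gmx phi);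
  gmx_sym : forall phi p, chart_around phi p ->
    (gmx phi (cmap phi p))^T = gmx phi (cmap phi p);
  gmx_pos : forall phi p (v : 'rV[R]_k), chart_around phi p -> v != 0 ->
    0 < ip (gmx phi (cmap phi p)) v v;
  gmx_change : forall phi psi p, chart_around phi p -> chart_around psi p ->
    let J := 'J (change phi psi) (cmap phi p) in
    gmx phi (cmap phi p) = J *m gmx psi (cmap psi p) *m J^T
}.

(* Differential forms of degree r: the r arguments are the rows of a matrix. *)
Record dform (R : realType) (k : nat) (M : manifold R k) (r : nat) := DForm {
  fval :> chart R M k -> 'rV[R]_k -> 'M[R]_(r, k) -> R;
  fval_smooth : forall phi (V : 'M[R]_(r, k)), atlas phi ->
    smooth_on (cmap phi @` cdom phi) (fun x => fval phi x V : R^o);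
  fval_multilinear : forall phi p (A B C : 'M[R]_(r, k)) i b c,
    chart_around phi p ->
    row i A = b *: row i B + c *: row i C ->
    row' i B = row' i A -> row' i C = row' i A ->
    fval phi (cmap phi p) A =
      b * fval phi (cmap phi p) B + c * fval phi (cmap phi p) C;
  fval_alternating : forall phi p (A : 'M[R]_(r, k)) i j,
    chart_around phi p -> i != j -> row i A = row j A ->
    fval phi (cmap phi p) A = 0;
  fval_change : forall phi psi p (V : 'M[R]_(r, k)),
    chart_around phi p -> chart_around psi p ->
    fval phi (cmap phi p) V =
      fval psi (cmap psi p) (V *m 'J (change phi psi) (cmap phi p))
}.

Section LeviCivita.
Context {R : realType} {k : nat} {M : manifold R k}.
Variable g : metric M.

(* Levi-Civita connection: christoffel phi x v w is nabla_v w at x, for v    *)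
(* and w constant in the chart phi (Koszul formula; the coordinate vector    *)
(* fields commute).                                                          *)
Definition christoffel (phi : chart R M k) (x v w : 'rV[R]_k) : 'rV[R]_k :=
  (\row_(s < k) (2^-1 *
     ('D_v (fun y => ip (g phi y) w (delta_mx 0 s) : R^o) x
    + 'D_w (fun y => ip (g phi y) v (delta_mx 0 s) : R^o) x
    - 'D_(delta_mx 0 s) (fun y => ip (g phi y) v w : R^o) x)))
  *m invmx (g phi x).

(* Covariant derivative, in the direction v, of the vector field W along the *)
(* map f with values in the coordinate domain of phi.                        *)
Definition nabla_along (a : nat) (phi : chart R M k)
    (f W : 'rV[R]_a -> 'rV[R]_k) (v x : 'rV[R]_a) : 'rV[R]_k :=
  'D_v W x + christoffel phi (f x) ('D_v f x) (W x).

Definition orthonormal (r : nat) (G : 'M[R]_k) (V : 'M[R]_(r, k)) : Prop :=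
  V *m G *m V^T = 1%:M.

Variable r : nat.

Definition closed_form (Om : dform M r) : Prop :=
  forall phi p (V : 'M[R]_(r.+1, k)), chart_around phi p ->
    \sum_(i < r.+1) (-1) ^+ i *
      'D_(row i V) (fun y => Om phi y (row' i V) : R^o) (cmap phi p) = 0.

Definition set_row (V : 'M[R]_(r, k)) (i : 'I_r) (w : 'rV[R]_k) : 'M[R]_(r, k) :=
  \matrix_(a, b) (if a == i then w 0 b else V a b).

Definition parallel_form (Om : dform M r) : Prop :=
  forall phi p (v : 'rV[R]_k) (V : 'M[R]_(r, k)), chart_around phi p ->
    let x := cmap phi p in
    'D_v (fun y => Om phi y V : R^o) x
    - \sum_(i < r) Om phi x (set_row V i (christoffel phi x v (row i V))) = 0.

Definition comass_one (Om : dform M r) : Prop :=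
  forall phi p, chart_around phi p ->
    let x := cmap phi p in
    (forall V, orthonormal (g phi x) V -> `|Om phi x V| <= 1) /\
    (exists V, orthonormal (g phi x) V /\ `|Om phi x V| = 1).

Definition calibration (Om : dform M r) : Prop :=
  closed_form Om /\ comass_one Om.

End LeviCivita.

Section Immersion.
Context {R : realType} {m k : nat} {M : manifold R m} {N : manifold R k}.
Variable F : M -> N.

Definition local_rep (phi : chart R M m) (psi : chart R N k) :
  'rV[R]_m -> 'rV[R]_k := cmap psi \o F \o cinv phi.

Definition smooth_map : Prop :=
  continuous F /\
  forall phi psi, atlas phi -> atlas psi ->
    smooth_on (cmap phi @` (cdom phi `&` F @^-1` cdom psi)) (local_rep phi psi).

Definition charts_at (phi : chart R M m) (psi : chart R N k) (p : M) : Prop :=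
  chart_around phi p /\ chart_around psi (F p).

Definition immersion : Prop :=
  smooth_map /\
  forall phi psi p, charts_at phi psi p ->
    row_free ('J (local_rep phi psi) (cmap phi p)).

Definition induced_metric (g : metric M) (gN : metric N) : Prop :=
  forall phi psi p, charts_at phi psi p ->
    let J := 'J (local_rep phi psi) (cmap phi p) in
    g phi (cmap phi p) = J *m gN psi (cmap psi (F p)) *m J^T.

Variables (g : metric M) (gN : metric N).

Section Charts.
Variables (phi : chart R M m) (psi : chart R N k).
Let f := local_rep phi psi.

(* Component of w orthogonal to dF(T_pM), where x = cmap phi p. *)
Definition normal_part (x : 'rV[R]_m) (w : 'rV[R]_k) : 'rV[R]_k :=
  let J := 'J f x in
  let G := gN psi (f x) in
  w - w *m G *m J^T *m invmx (J *m G *m J^T) *m J.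

Definition second_fund (x v w : 'rV[R]_m) : 'rV[R]_k :=
  normal_part x (nabla_along gN psi f (fun y => 'D_w f y) v x).

Definition mean_curv (x : 'rV[R]_m) : 'rV[R]_k :=
  m%:R^-1 *: \sum_(i < m) \sum_(j < m)
    invmx (g phi x) i j *: second_fund x (delta_mx 0 i) (delta_mx 0 j).

Definition normal_nabla_H (x v : 'rV[R]_m) : 'rV[R]_k :=
  normal_part x (nabla_along gN psi f mean_curv v x).

Definition mean_curv_norm (p : M) : R :=
  let x := cmap phi p in
  Num.sqrt (ip (gN psi (f x)) (mean_curv x) (mean_curv x)).

End Charts.

Definition parallel_mean_curv : Prop :=
  forall phi psi p (v : 'rV[R]_m), charts_at phi psi p ->
    normal_nabla_H phi psi (cmap phi p) v = 0.

Definition minimal : Prop :=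
  forall phi psi p, charts_at phi psi p -> mean_curv phi psi (cmap phi p) = 0.

Definition omega_angle (O : orientation M) (Om : dform N m) (theta : M -> R) :
    Prop :=
  forall p, 0 <= theta p <= pi /\
    forall phi psi (X : 'M[R]_m), direct O phi -> charts_at phi psi p ->
      orthonormal (g phi (cmap phi p)) X -> 0 < \det X ->
      cos (theta p) =
        Om psi (cmap psi (F p)) (X *m 'J (local_rep phi psi) (cmap phi p)).

End Immersion.

(* Lebesgue integral over R^k of a nonnegative Borel function, as an         *)
(* iterated integral (Tonelli).                                              *)
Fixpoint integral_rV (R : realType) (k : nat) :
    ('rV[R]_k -> \bar R) -> \bar R :=
  match k with
  | 0%N => fun f => f 0
  | k'.+1 => fun f =>
      (\int[@lebesgue_measure R]_t
         integral_rV (fun y : 'rV[R]_k' =>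
           f (row_mx (const_mx t : 'rV[R]_1) y)))%E
  end.

Definition borel (T : ptopologicalType) := g_sigma_algebraType (@open T).

Section Volume.
Context {R : realType} {m : nat} {M : manifold R m}.
Variable g : metric M.

(* mu is the Riemannian measure of g: this determines mu uniquely, and mu D  *)
(* is the volume V(D, g).                                                    *)
Definition riemannian_measure (mu : {measure set (borel M) -> \bar R}) : Prop :=
  forall phi (A : set (borel M)), atlas phi -> measurable A ->
    A `<=` cdom phi ->
    mu A = integral_rV (fun x =>
      (\1_(cmap phi @` A) x * Num.sqrt (\det (g phi x)))%:E).

Definition bd (D : set M) : set M := closure D `\` D.

(* phi flattens the boundary of D to the hyperplane x_i = 0. *)
Definition boundary_chart (D : set M) (phi : chart R M m) (i : 'I_m) : Prop :=
  atlas phi /\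
  cmap phi @` (cdom phi `&` D) =
    [set x | (cmap phi @` cdom phi) x /\ x 0 i < 0].

Definition compact_domain (D : set M) : Prop :=
  [/\ open D, D !=set0, compact (closure D) &
    forall p, bd D p -> exists phi i, cdom phi p /\ boundary_chart D phi i].

Definition insert0 (i : 'I_m) (y : 'rV[R]_m.-1) : 'rV[R]_m :=
  \row_j (if unlift i j is Some j' then y 0 j' else 0).

(* sigma is the Riemannian measure of the boundary of D for the metric       *)
(* induced by g, extended by 0 to M: sigma (bd D) is the area of bd D.       *)
Definition boundary_measure (D : set M)
    (sigma : {measure set (borel M) -> \bar R}) : Prop :=
  sigma (~` bd D) = 0%E /\
  forall phi i (A : set (borel M)), boundary_chart D phi i -> measurable A ->
    A `<=` cdom phi `&` bd D ->
    sigma A = integral_rV (fun y : 'rV[R]_m.-1 =>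
      (\1_(cmap phi @` A) (insert0 i y) *
       Num.sqrt (\det (row' i (col' i (g phi (insert0 i y))))))%:E).

(* Areas and volumes are finite here: the closure of D is compact. *)
Definition cheeger (mu : {measure set (borel M) -> \bar R}) : \bar R :=
  ereal_inf [set r | exists D (sigma : {measure set (borel M) -> \bar R}),
    [/\ compact_domain D, boundary_measure D sigma &
        r = (fine (sigma (bd D)) / fine (mu D))%:E]].

End Volume.

(* Main.v *)
(** Let J be the differential of the immersion in charts and H the mean
    curvature vector.  The flux of H through Omega is the vector density with
    components u_i = Omega(J_1, .., H, .., J_m), with H in the i-th slot.
    Since Omega and H are parallel, its divergence is -m |H|^2 Omega(J), where
    |Omega(J)| = cos theta sqrt(det g); since Omega has comass one (first
    cousin principle), |u_i| <= |H| sin theta sqrt(det g_i), where g_i is the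
    metric induced on the i-th coordinate hyperplanes.  Integrating the
    divergence over D gives m |H|^2 inf(cos theta) V(D) <= |H| sup(sin theta)
    A(bd D), and |H| is constant because H is parallel.  The divergence theorem
    on D is obtained from Fubini in boxes of boundary charts, with cut-offs
    chi_a of sum 1 near the closure of D: the terms in d(chi_a) cancel because
    sum_i (d_i chi) u_i / Omega(J) does not depend on the chart and is linear
    in d(chi). *)
Require Import Defs.
From HB Require Import structures.
From mathcomp Require Import all_boot all_order all_algebra all_fingroup.
From mathcomp Require Import all_classical all_reals all_analysis.
From mathcomp Require Import measurable_realfun.
From mathcomp Require Import ring lra.

Set Implicit Arguments.
Unset Strict Implicit.
Unset Printing Implicit Defensive.

Import Order.TTheory GRing.Theory Num.Theory.
Import numFieldNormedType.Exports.

Local Open Scope classical_set_scope.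
Local Open Scope ring_scope.

(** * Continuously differentiable functions *)

(** The density u is the form F^*(iota_H Omega) in coordinates, and the estimate is the Stokes
    formula for it. Densities keep the Levi-Civita connection of M out of the proof: only coordinate
    divergences occur there, and the connection of the target enters through Omega and H. No
    consistent orientation of the boundary is required, because the boundary terms are bounded in
    absolute value and every box carries its own sign; likewise cos theta is recovered as |Omega(J)|
    / sqrt(det g) in every chart, direct or not. Class C^1 suffices for all integrations, so the
    cut-offs are made of squares of positive parts. The area of the boundary is produced as a finite
    sum of face integrals, hence as a number that exists even when no boundary measure is at hand,
    as in (2). For tau = 1 the coefficient of the Cheeger constant is 0 and cannot be divided out;
    then sin theta = 0 everywhere, the flux vanishes identically, and its divergence gives H = 0
    directly. *)

Section NearEq.
Context {R : realType} {V W : normedModType R}.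
Implicit Types (h k : V -> W) (x v : V).

Lemma near_eq_continuous (T T' : topologicalType) (h k : T -> T') (x : T) :
  (\forall y \near x, h y = k y) ->
  {for x, continuous k} -> {for x, continuous h}.
Proof.
move=> hk ck; rewrite /prop_for /continuous_at (nbhs_singleton hk).
by apply: cvg_trans ck; apply: near_eq_cvg; near do apply/esym.
Unshelve. all: by end_near. Qed.

(** Chart expressions are total functions with arbitrary values off an open set, so identities
    between them hold only near a point; regularity has to pass along such local identities. *)
Lemma near_eq_differentiable h k x : (\forall y \near x, h y = k y) ->
  differentiable k x -> differentiable h x.
Proof.
move=> hk /diff_locallyP [ck dk].
have e : h \o shift x = cst (h x) + 'd k x +o_ (0 : V) id.
  apply/eqaddoP => e e0; move/eqaddoP : dk => /(_ e e0) dk.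
  have hk0 : \forall y \near (0 : V), h (y + x) = k (y + x).
    by move: hk; rewrite (near_shift 0 x) /=; apply: filterS => y; rewrite subr0.
  rewrite (nbhs_singleton hk) /=.
  near=> y; rewrite /= fctE /= (near hk0 y)//.
  by near: y.
have de := diff_unique ck e.
by apply/diff_locallyP; rewrite de.
Unshelve. all: by end_near. Qed.

End NearEq.

Section C1.
Context {R : realType} {a : nat}.
Implicit Types (U V : set 'rV[R]_a) (h k : 'rV[R]_a -> R) (x v : 'rV[R]_a).

(** Differentiability and continuity are those of the ambient space at points of [U], which is
    harmless for open [U]. Directions [v] are fixed vectors. *)
Definition C1_on U h : Prop :=
  (forall x, U x -> differentiable h x) /\
  (forall v x, U x -> {for x, continuous (fun y => 'D_v h y)}).

Lemma C1_onS U V h : U `<=` V -> C1_on V h -> C1_on U h.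
Proof. by move=> UV [d c]; split=> [x /UV/d|v x /UV/c]. Qed.

Lemma C1_on_derivable U h x v : C1_on U h -> U x -> derivable h x v.
Proof. by move=> [d _] /d; exact: diff_derivable. Qed.

Lemma C1_on_continuous U h x : C1_on U h -> U x -> {for x, continuous h}.
Proof. by move=> [d _] /d/differentiable_continuous. Qed.

Lemma near_open U x (P : 'rV[R]_a -> Prop) : open U -> U x ->
  (forall y, U y -> P y) -> \forall y \near x, P y.
Proof. by move=> oU Ux UP; apply: filterS UP _; exact: open_nbhs_nbhs. Qed.

(** Gluing: the local model [k] may change from point to point, as for a cut-off that is a bump in
    one chart and zero elsewhere. *)
Lemma C1_on_near U h : open U ->
  (forall x, U x -> exists k V, [/\ open V, V x, C1_on V k &
     \forall y \near x, h y = k y]) -> C1_on U h.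
Proof.
move=> oU H; split=> [x /H|v x /H] [k [V [oV Vx [dk ck] /[dup] hk]]].
  by move/near_eq_differentiable; apply; exact: dk.
move=> /nbhs_interior hk2; apply: near_eq_continuous (ck v _ Vx).
by near=> y; apply: near_eq_derive; near: y.
Unshelve. all: by end_near. Qed.

Lemma C1_on_eq U h k : open U -> {in U, h =1 k} -> C1_on U k -> C1_on U h.
Proof.
move=> oU hk Ck; apply: C1_on_near => // x Ux; exists k, U; split=> //.
by apply: near_open Ux _ => // y Uy; apply: hk; rewrite inE.
Qed.

Lemma C1_on_cst U (c : R) : C1_on U (fun=> c).
Proof.
split=> [x _|v x _]; first exact: differentiable_cst.
apply: (@near_eq_continuous _ _ _ (cst 0)); last exact: cst_continuous.
by apply: near_open (openT) I _ => y _; exact: derive_cst.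
Qed.

Lemma C1_onD U h k : open U -> C1_on U h -> C1_on U k ->
  C1_on U (fun x => h x + k x).
Proof.
move=> oU Ch Ck; split=> [x Ux|v x Ux].
  by apply: differentiableD; [apply Ch|apply Ck].
apply: (@near_eq_continuous _ _ _ (fun y => 'D_v h y + 'D_v k y)).
  by apply: near_open Ux _ => // y Uy; rewrite deriveD//; exact: C1_on_derivable Uy.
by apply: continuousD; [apply Ch|apply Ck].
Qed.

Lemma C1_onM U h k : open U -> C1_on U h -> C1_on U k ->
  C1_on U (fun x => h x * k x).
Proof.
move=> oU Ch Ck; split=> [x Ux|v x Ux].
  by apply: differentiableM; [apply Ch|apply Ck].
apply: (@near_eq_continuous _ _ _ (fun y => h y * 'D_v k y + k y * 'D_v h y)).
  by apply: near_open Ux _ => // y Uy; rewrite deriveM//; exact: C1_on_derivable Uy.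
have := C1_on_continuous Ch Ux; have := C1_on_continuous Ck Ux => ck ch.
by apply: continuousD; apply: continuousM => //; [apply Ck|apply Ch].
Qed.

Lemma C1_onN U h : open U -> C1_on U h -> C1_on U (fun x => - h x).
Proof.
move=> oU Ch; split=> [x Ux|v x Ux]; first by apply: differentiableN; apply Ch.
apply: (@near_eq_continuous _ _ _ (fun y => - 'D_v h y)).
  by apply: near_open Ux _ => // y Uy; rewrite deriveN//; exact: C1_on_derivable Uy.
by apply: continuousN; apply Ch.
Qed.

Lemma C1_onB U h k : open U -> C1_on U h -> C1_on U k ->
  C1_on U (fun x => h x - k x).
Proof. by move=> oU Ch Ck; exact: (C1_onD oU Ch (C1_onN oU Ck)). Qed.

Lemma C1_onV U h : open U -> (forall x, U x -> h x != 0) -> C1_on U h ->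
  C1_on U (fun x => (h x)^-1).
Proof.
move=> oU h0 Ch; split=> [x Ux|v x Ux].
  by apply: differentiableV; [apply Ch|apply h0].
apply: (@near_eq_continuous _ _ _ (fun y => - (((h y)^-1 * (h y)^-1) * 'D_v h y))).
  apply: near_open Ux _ => // y Uy.
  rewrite deriveV//; [|exact: h0|exact: C1_on_derivable Uy].
  by rewrite -expr2 exprVn -mulNr; congr (_ * _).
have ch := C1_on_continuous Ch Ux.
apply: continuousN; apply: continuousM; last by apply Ch.
by apply: continuousM; apply: continuousV => //; exact: h0.
Qed.

Lemma C1_on_sum U (I : Type) (r : seq I) (P : pred I) (h : I -> 'rV[R]_a -> R) :
  open U -> (forall i, P i -> C1_on U (h i)) ->
  C1_on U (fun x => \sum_(i <- r | P i) h i x).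
Proof.
move=> oU Ch; elim: r => [|i r IH].
  rewrite (_ : (fun _ => _) = (fun=> 0)); first exact: C1_on_cst.
  by apply/funext => x; rewrite big_nil.
case Pi : (P i); last by under eq_fun do rewrite big_cons Pi.
by under eq_fun do rewrite big_cons Pi; exact: (C1_onD oU (Ch _ Pi) IH).
Qed.

Lemma C1_on_prod U (I : Type) (r : seq I) (P : pred I) (h : I -> 'rV[R]_a -> R) :
  open U -> (forall i, P i -> C1_on U (h i)) ->
  C1_on U (fun x => \prod_(i <- r | P i) h i x).
Proof.
move=> oU Ch; elim: r => [|i r IH].
  rewrite (_ : (fun _ => _) = (fun=> 1)); first exact: C1_on_cst.
  by apply/funext => x; rewrite big_nil.
case Pi : (P i); last by under eq_fun do rewrite big_cons Pi.
by under eq_fun do rewrite big_cons Pi; exact: (C1_onM oU (Ch _ Pi) IH).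
Qed.

Lemma C1_on_det U n (A : 'rV[R]_a -> 'M[R]_n) : open U ->
  (forall i j, C1_on U (fun x => A x i j)) -> C1_on U (fun x => \det (A x)).
Proof.
move=> oU CA; apply: C1_on_sum => // s _; apply: C1_onM => //.
  exact: C1_on_cst.
by apply: C1_on_prod => // i _; exact: CA.
Qed.

Lemma C1_on_invmx U n (A : 'rV[R]_a -> 'M[R]_n) : open U ->
  (forall x, U x -> A x \in unitmx) ->
  (forall i j, C1_on U (fun x => A x i j)) ->
  forall i j, C1_on U (fun x => invmx (A x) i j).
Proof.
move=> oU uA CA i j.
(* Cramer's rule: an entry of the inverse is a cofactor over the determinant, with the indices
   transposed. *)
apply: (@C1_on_eq _ _ (fun x => (\det (A x))^-1 *
   ((-1) ^+ (j + i) * \det (row' j (col' i (A x)))))) => //.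
  by move=> x; rewrite inE => /uA ux; rewrite /invmx ux !mxE.
apply: C1_onM => //.
  apply: C1_onV => //; last exact: C1_on_det.
  by move=> x /uA; rewrite unitmxE unitfE.
apply: C1_onM => //; first exact: C1_on_cst.
apply: C1_on_det => // i' j'.
by under eq_fun do rewrite !mxE; exact: CA.
Qed.

Lemma C1_on_mulmx U p q r (A : 'rV[R]_a -> 'M[R]_(p, q))
    (B : 'rV[R]_a -> 'M[R]_(q, r)) : open U ->
  (forall i j, C1_on U (fun x => A x i j)) ->
  (forall i j, C1_on U (fun x => B x i j)) ->
  forall i j, C1_on U (fun x => (A x *m B x) i j).
Proof.
move=> oU CA CB i j; under eq_fun do rewrite mxE.
by apply: C1_on_sum => // l _; apply: C1_onM.
Qed.

Lemma derive_sum_seq (I : Type) (r : seq I) (P : pred I) (h : I -> 'rV[R]_a -> R) x v :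
  (forall i, P i -> derivable (h i) x v) ->
  derivable (fun y => \sum_(i <- r | P i) h i y) x v /\
  'D_v (fun y => \sum_(i <- r | P i) h i y) x = \sum_(i <- r | P i) 'D_v (h i) x.
Proof.
move=> dh; elim: r => [|i r [IH1 IH2]].
  rewrite big_nil (_ : (fun y => _) = cst 0); last first.
    by apply/funext => y; rewrite big_nil.
  by split; [exact: derivable_cst|exact: derive_cst].
rewrite big_cons; case: ifPn => Pi; last first.
  by under eq_fun do rewrite big_cons (negbTE Pi).
under eq_fun do rewrite big_cons Pi.
by split; [exact: (derivableD (dh _ Pi) IH1)|rewrite (deriveD (dh _ Pi) IH1) IH2].
Qed.

Lemma derive_prod2 h k x v : derivable h x v -> derivable k x v ->
  'D_v (fun y => h y * k y) x = 'D_v h x * k x + h x * 'D_v k x.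
Proof.
by move=> dh dk; rewrite (deriveM dh dk) addrC; congr (_ + _); exact: mulrC.
Qed.

Lemma derive_linear_dir n h x (c : 'I_n -> R) (w : 'I_n -> 'rV[R]_a) :
  differentiable h x ->
  'D_(\sum_i c i *: w i) h x = \sum_i c i * 'D_(w i) h x.
Proof.
move=> dh; rewrite deriveE// linear_sum; apply: eq_bigr => i _.
by rewrite linearZ /= deriveE.
Qed.

Lemma derive_basis h x v : differentiable h x ->
  'D_v h x = \sum_j v 0 j * 'D_(delta_mx 0 j) h x.
Proof. by move=> dh; rewrite {1}(row_sum_delta v) derive_linear_dir. Qed.

End C1.

Lemma continuous_sumr (R : realType) (T : topologicalType) (I : Type) (r : seq I)
    (P : pred I) (h : I -> T -> R) (x : T) :
  (forall i, P i -> {for x, continuous (h i)}) ->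
  {for x, continuous (fun y => \sum_(i <- r | P i) h i y)}.
Proof.
move=> ch; rewrite /prop_for /continuous_at; elim: r => [|i r IH].
  by under eq_fun do rewrite big_nil; rewrite big_nil; exact: cvg_cst.
under eq_fun do rewrite big_cons; rewrite big_cons; case: ifPn => Pi //.
by apply: cvgD => //; exact: ch.
Qed.

Section Matrix_valued.
Context {R : realType} {V : normedModType R} {p q : nat}.
Implicit Types (F : V -> 'M[R]_(p, q)) (x v : V).

Lemma differentiable_entry F x i j : differentiable F x ->
  differentiable (fun y => F y i j) x.
Proof.
move=> dF; apply: (@differentiable_comp _ _ _ _ F (fun A : 'M[R]_(p, q) => A i j)) => //.
exact: differentiable_coord.
Qed.

Lemma derive_entry F x v i j : derivable F x v ->
  'D_v F x i j = 'D_v (fun y => F y i j) x.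
Proof. by move=> dF; rewrite derive_mx// mxE. Qed.

Lemma continuous_entry (T : topologicalType) (F : T -> 'M[R]_(p, q)) (x : T) i j :
  {for x, continuous F} -> {for x, continuous (fun y => F y i j)}.
Proof.
move=> cF; apply: (@continuous_comp _ _ _ F (fun A : 'M[R]_(p, q) => A i j)) => //.
exact: coord_continuous.
Qed.

Lemma entry_continuous (T : topologicalType) (F : T -> 'M[R]_(p, q)) (x : T) :
  (forall i j, {for x, continuous (fun y => F y i j)}) -> {for x, continuous F}.
Proof.
move=> cF A [P PA sPA]; rewrite /fmap /=.
apply: filterS sPA _; apply: filter_forall => i; apply: filter_forall => j.
exact: (cF i j _ (PA i j)).
Qed.

Lemma entry_differentiable F x :
  (forall i j, differentiable (fun y => F y i j) x) -> differentiable F x.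
Proof.
move=> dF; have -> : F = fun y => \sum_i \sum_j F y i j *: delta_mx i j.
  by apply/funext => y; rewrite {1}(matrix_sum_delta (F y)).
rewrite (_ : (fun y => _) = \sum_(i < p) (fun y => \sum_j F y i j *: delta_mx i j)); last first.
  by apply/funext => y; rewrite fct_sumE.
apply: differentiable_sum => i.
rewrite (_ : (fun y => _) = \sum_(j < q) (fun y => F y i j *: delta_mx i j)); last first.
  by apply/funext => y; rewrite fct_sumE.
by apply: differentiable_sum => j; exact: differentiableZl.
Qed.

End Matrix_valued.

Section Chain.
Context {R : realType} {a b : nat}.

Lemma derive_comp (W : normedModType R) (f : 'rV[R]_a -> 'rV[R]_b) (h : 'rV[R]_b -> W) x v :
  differentiable f x -> differentiable h (f x) ->
  'D_v (h \o f) x = 'D_('D_v f x) h (f x).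
Proof.
move=> df dh; rewrite deriveE; last exact: differentiable_comp.
by rewrite diff_comp//= [in RHS]deriveE// [in RHS]deriveE.
Qed.

Lemma C1_on_comp (U : set 'rV[R]_a) (V : set 'rV[R]_b) (f : 'rV[R]_a -> 'rV[R]_b)
    (h : 'rV[R]_b -> R) : open U -> (forall x, U x -> V (f x)) ->
  (forall j, C1_on U (fun x => f x 0 j)) -> C1_on V h -> C1_on U (fun x => h (f x)).
Proof.
move=> oU UV Cf Ch.
have df x : U x -> differentiable f x.
  by move=> Ux; apply: entry_differentiable => i j; rewrite (ord1 i); apply Cf.
split=> [x Ux|v x Ux].
  by apply: (@differentiable_comp _ _ _ _ f h); [exact: df|apply Ch; exact: UV].
(* The chain rule differentiates [h] in a direction that depends on [y]; expanding it in the basis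
   leaves fixed directions, the only ones that [C1_on] controls. *)
apply: (@near_eq_continuous _ _ _
   (fun y => \sum_j 'D_v (fun z => f z 0 j) y * 'D_(delta_mx 0 j) h (f y))).
  apply: near_open Ux _ => // y Uy.
  rewrite (derive_comp _ (df _ Uy)); last by apply Ch; exact: UV.
  rewrite derive_basis; last by apply Ch; exact: UV.
  apply: eq_bigr => j _; rewrite derive_entry//; exact: diff_derivable (df _ Uy).
apply: continuous_sumr => j _; apply: continuousM; first exact: (Cf j).2.
apply: (@continuous_comp _ _ _ f ('D_(delta_mx 0 j) h)); first exact: differentiable_continuous (df _ Ux).
exact: Ch.2 (UV _ Ux).
Qed.

End Chain.

(** * Symmetry of second derivatives *)

Section Schwarz.
Context {R : realType} {a : nat}.
Implicit Types (h : 'rV[R]_a -> R) (x v w c : 'rV[R]_a).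

Lemma is_derive_line h c v (s : R) : derivable h (c + s *: v) v ->
  is_derive s 1 (fun s : R => h (c + s *: v)) ('D_v h (c + s *: v)).
Proof.
have e : (fun r : R => r^-1 *: (h (r *: v + (c + s *: v)) - h (c + s *: v))) =
  (fun r : R => r^-1 *: (h (c + (r *: (1 : R) + s) *: v) - h (c + s *: v))).
  apply/funext => r; congr (_ *: (h _ - _)).
  by rewrite addrCA [r *: 1]mulr1 scalerDl.
by move=> dh; apply: DeriveDef; [move: dh; rewrite /derivable e|rewrite /derive e].
Qed.

Lemma nbhs_plane x v w (A : set 'rV[R]_a) : nbhs x A ->
  exists2 t : R, 0 < t &
    forall s r : R, 0 <= s <= t -> 0 <= r <= t -> A (x + s *: v + r *: w).
Proof.
(* The summand 1 keeps [K] positive when both directions are 0; with step [e / 2 / K] the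
   displacement is at most [e / 2]. *)
move=> /nbhs_ballP [e /= e0 eA]; pose K := `|v| + `|w| + 1.
have K0 : 0 < K by rewrite /K ltr_wpDl// addr_ge0.
have t0 : 0 < e / 2 / K by rewrite !divr_gt0.
exists (e / 2 / K) => // s r /andP[s0 s1] /andP[r0 r1]; apply: eA.
rewrite -ball_normE /ball_ /= -addrA opprD addrA subrr sub0r normrN.
apply: (@le_lt_trans _ _ (e / 2)); last by rewrite ltr_pdivrMr// ltr_pMr// ltr1n.
apply: le_trans (ler_normD _ _) _; rewrite !normrZ !ger0_norm//.
apply: (@le_trans _ _ (e / 2 / K * `|v| + e / 2 / K * `|w|)).
  by rewrite lerD// ler_wpM2r.
rewrite -mulrDr -[leRHS](divfK (lt0r_neq0 K0)) ler_pM2l//.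
by rewrite /K lerDl.
Qed.

(** The mean value theorem twice: in [s] for the increment of [h] under the shift by [t *: w], then
    in [r] for ['D_v h]. *)
Lemma second_difference (U : set 'rV[R]_a) h x v w (t : R) : 0 < t ->
  (forall s r : R, 0 <= s <= t -> 0 <= r <= t -> U (x + s *: v + r *: w)) ->
  (forall y, U y -> differentiable h y) ->
  (forall y, U y -> differentiable ('D_v h) y) ->
  exists s r : R, [/\ 0 <= s <= t, 0 <= r <= t &
   h (x + t *: v + t *: w) - h (x + t *: v) - h (x + t *: w) + h x =
   t ^+ 2 * 'D_w ('D_v h) (x + s *: v + r *: w)].
Proof.
move=> t0 Ut dh ddh.
have Ut0 (s : R) : 0 <= s <= t -> U (x + s *: v).
  by move=> st; have := Ut s 0 st; rewrite scale0r addr0; apply; rewrite lexx ltW.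
have tt : 0 <= t <= t by rewrite lexx ltW.
have Uts (s : R) : 0 <= s <= t -> U (x + t *: w + s *: v).
  by move=> st; rewrite addrAC; exact: Ut.
pose phi (s : R) := h (x + t *: w + s *: v) - h (x + s *: v).
pose dphi (s : R) := 'D_v h (x + t *: w + s *: v) - 'D_v h (x + s *: v).
have dphiE (s : R) : 0 <= s <= t -> is_derive s 1 phi (dphi s).
  move=> st; have d1 := is_derive_line (@diff_derivable _ _ _ _ _ v (dh _ (Uts s st))).
  have d2 := is_derive_line (@diff_derivable _ _ _ _ _ v (dh _ (Ut0 s st))).
  exact: is_deriveB.
have itv (s : R) : s \in `]0, t[ -> 0 <= s <= t.
  by rewrite in_itv /= => /andP[? ?]; rewrite !ltW.
have cphi : {within `[0, t], continuous phi}.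
  apply: derivable_within_continuous => s; rewrite in_itv /= => st.
  by have [] := dphiE s st.
have [s sI es] := MVT t0 (fun s si => dphiE s (itv s si)) cphi.
have sI' := itv s sI.
pose psi (r : R) := 'D_v h (x + s *: v + r *: w).
have dpsi (r : R) : 0 <= r <= t ->
    is_derive r 1 psi ('D_w ('D_v h) (x + s *: v + r *: w)).
  move=> rt; apply: is_derive_line; apply: diff_derivable.
  by apply: ddh; exact: Ut.
have cpsi : {within `[0, t], continuous psi}.
  apply: derivable_within_continuous => r; rewrite in_itv /= => rt.
  by have [] := dpsi r rt.
have [r rI er] := MVT t0 (fun r ri => dpsi r (itv r ri)) cpsi.
exists s, r; split; [exact: itv|exact: itv|].
move: es er; rewrite /phi /psi /dphi !scale0r !addr0 subr0.
rewrite (addrAC x (t *: w) (t *: v)) (addrAC x (t *: w) (s *: v)) => es er.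
rewrite er in es.
have -> : t ^+ 2 * 'D_w ('D_v h) (x + s *: v + r *: w) =
  'D_w ('D_v h) (x + s *: v + r *: w) * t * t by ring.
by rewrite -es; ring.
Qed.

(** The second difference is symmetric in [v] and [w], so the two mixed derivatives share a value at
    points of an arbitrarily small parallelogram; continuity carries this to [x]. *)
Lemma derive_comm (U : set 'rV[R]_a) h x v w : open U -> U x ->
  (forall y, U y -> differentiable h y) ->
  C1_on U ('D_v h) -> C1_on U ('D_w h) ->
  'D_w ('D_v h) x = 'D_v ('D_w h) x.
Proof.
move=> oU Ux dh Cv Cw; apply/eqP; rewrite -subr_eq0 -normr_le0.
apply/ler_addgt0Pl => e e0; rewrite addr0.
have c1 := Cv.2 w x Ux; have c2 := Cw.2 v x Ux.
have e2 : 0 < e / 2 by rewrite divr_gt0.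
move: c1 c2 => /cvgrPdist_lt /(_ _ e2) n1 /cvgrPdist_lt /(_ _ e2) n2.
have n3 : nbhs x U by exact: open_nbhs_nbhs.
have [t t0 Ht] := nbhs_plane v w (filterI n3 (filterI n1 n2)).
have HU (s r : R) : 0 <= s <= t -> 0 <= r <= t -> U (x + s *: v + r *: w).
  by move=> hs hr; have [] := Ht s r hs hr.
have HU' (s r : R) : 0 <= s <= t -> 0 <= r <= t -> U (x + s *: w + r *: v).
  by move=> hs hr; rewrite addrAC; exact: HU.
have [s [r [hs hr E1]]] := second_difference t0 HU dh Cv.1.
have [s' [r' [hs' hr' E2]]] := second_difference t0 HU' dh Cw.1.
have E : 'D_w ('D_v h) (x + s *: v + r *: w) = 'D_v ('D_w h) (x + s' *: w + r' *: v).
  apply: (@mulfI _ (t ^+ 2)); first by rewrite expf_neq0// lt0r_neq0.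
  rewrite (addrAC x (t *: w)) in E2.
  apply: etrans (esym E1) _; apply: etrans _ E2.
  by ring.
have [_ [/= b1 _]] := Ht s r hs hr.
have [_ [_ /= b2]] := Ht r' s' hr' hs'.
rewrite (addrAC x) -E in b2; rewrite distrC in b2.
have := ltrD b1 b2; rewrite -splitr => b.
apply: ltW; apply: le_lt_trans b.
by apply: le_trans (ler_normD _ _); rewrite addrA subrK.
Qed.

Lemma cst_on_ball h x (e : R) : (forall y, ball x e y -> differentiable h y) ->
  (forall y v, ball x e y -> 'D_v h y = 0) -> forall y, ball x e y -> h y = h x.
Proof.
move=> dh h0 y xy; pose v := y - x.
have B (s : R) : 0 <= s <= 1 -> ball x e (x + s *: v).
  move=> /andP[s0 s1]; move: xy; rewrite -ball_normE /ball_ /=.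
  rewrite opprD addrA subrr sub0r normrN normrZ ger0_norm// distrC -/v.
  by apply: le_lt_trans; rewrite ler_piMl.
have dd (s : R) : 0 <= s <= 1 -> is_derive s 1 (fun s : R => h (x + s *: v)) 0.
  move=> s01; rewrite -(h0 (x + s *: v) v (B s s01)).
  by apply: is_derive_line; apply: diff_derivable; apply: dh; exact: B.
have itv (s : R) : s \in `]0, 1[ -> 0 <= s <= 1.
  by rewrite in_itv /= => /andP[? ?]; rewrite !ltW.
have cphi : {within `[0, 1], continuous (fun s : R => h (x + s *: v))}.
  apply: derivable_within_continuous => s; rewrite in_itv /= => st.
  by have [] := dd s st.
have [s sI] := MVT ltr01 (fun s si => dd s (itv s si)) cphi.
by rewrite scale1r scale0r addr0 /v subrKC mul0r => /eqP; rewrite subr_eq0 => /eqP.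
Qed.

End Schwarz.

(** * Cut-off functions of class C^1 on row vectors *)

Section Bump.
Context {R : realType}.

(** The square is the lowest integer power of the positive part whose derivative is continuous. *)
Definition pos2 (t : R) : R := Num.max t 0 ^+ 2.

Lemma pos2_ge0 t : 0 <= pos2 t. Proof. exact: sqr_ge0. Qed.

Lemma pos2_le0 t : t <= 0 -> pos2 t = 0.
Proof. by move=> t0; rewrite /pos2 max_r// expr0n. Qed.

Lemma pos2_gt0 t : 0 < t -> 0 < pos2 t.
Proof. by move=> t0; rewrite /pos2 max_l ?ltW// exprn_gt0. Qed.

Lemma is_derive_pos2 (t : R) : is_derive t 1 pos2 (2 * Num.max t 0).
Proof.
have [t0|t0|->] := ltgtP t 0.
- rewrite mulr0; have d0 : is_derive t 1 (cst 0 : R -> R) 0.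
    by apply: DeriveDef; [exact: derivable_cst|exact: derive_cst].
  apply: near_eq_is_derive d0.
  near=> s; rewrite pos2_le0//; apply: ltW; near: s; exact: lt_nbhsl.
- have d2 : is_derive t 1 (fun s : R => s ^+ 2) (2 * t).
    apply: DeriveDef; first exact: exprn_derivable.
    by rewrite exp_derive /GRing.scale /= mulr1 expr1.
  apply: near_eq_is_derive d2.
  near=> s; rewrite /pos2 max_l// ltW//; near: s; exact: lt_nbhsr.
- rewrite mulr0.
  have H : h^-1 *: (pos2 (h *: (1 : R) + 0) - pos2 0) @[h --> 0^'] --> (0 : R).
    apply/cvgrPdist_le => /= e e0; near=> h.
    have he : `|h| <= e by near: h; exact: dnbhs0_le.
    rewrite sub0r normrN addr0 [h *: 1]mulr1 [pos2 0]pos2_le0// subr0.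
    have [h0|h0] := leP h 0; first by rewrite pos2_le0// scaler0 normr0 ltW.
    by rewrite /pos2 (max_l (ltW h0)) expr2 /GRing.scale /= mulKf ?gt_eqF//.
  by apply: DeriveDef; [apply/cvg_ex; exists 0|exact: cvg_lim].
Unshelve. all: by end_near. Qed.

Lemma C1_on_pos2 a (U : set 'rV[R]_a) h : open U -> C1_on U h ->
  C1_on U (fun x => pos2 (h x)).
Proof.
move=> oU Ch.
have dp t : differentiable pos2 t by apply/derivable1_diffP; case: (is_derive_pos2 t).
split=> [x Ux|v x Ux].
  by apply: (@differentiable_comp _ _ _ _ h pos2); [apply Ch|].
apply: (@near_eq_continuous _ _ _ (fun y => 2 * Num.max (h y) 0 * 'D_v h y)).
  apply: near_open Ux _ => // y Uy.
  have dh := Ch.1 y Uy.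
  rewrite deriveE; last exact: differentiable_comp.
  rewrite (diff_comp dh (dp _)) /= -(deriveE v dh).
  rewrite -[X in 'd _ _ X]mulr1 [LHS]linearZ /= -deriveE//.
  by have [_ ->] := is_derive_pos2 (h y); rewrite /GRing.scale /= mulrC.
apply: continuousM; last exact: Ch.2.
apply: continuousM; first exact: cst_continuous.
by apply: continuous_max; [exact: C1_on_continuous Ux|exact: cst_continuous].
Qed.

Lemma pos2_den_gt0 t : 0 < pos2 t + pos2 (1 - t).
Proof.
have [t0|t0] := ltP 0 t; first by rewrite ltr_pwDl ?pos2_gt0 ?pos2_ge0.
by rewrite ltr_wpDl ?pos2_ge0// pos2_gt0// subr_gt0 (le_lt_trans t0).
Qed.

(** A C^1 transition from 0 to 1; the denominator never vanishes, since [t] and [1 - t] are not both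
    nonpositive. *)
Definition step (t : R) : R := pos2 t / (pos2 t + pos2 (1 - t)).

Lemma step_ge0 t : 0 <= step t.
Proof. by rewrite divr_ge0 ?pos2_ge0// ltW ?pos2_den_gt0. Qed.

Lemma step_le1 t : step t <= 1.
Proof. by rewrite ler_pdivrMr ?pos2_den_gt0// mul1r lerDl pos2_ge0. Qed.

Lemma step_eq0 t : t <= 0 -> step t = 0.
Proof. by move=> t0; rewrite /step pos2_le0// mul0r. Qed.

Lemma step_eq1 t : 1 <= t -> step t = 1.
Proof.
move=> t1; rewrite /step [pos2 (1 - t)]pos2_le0 ?subr_le0// addr0 divff//.
by rewrite gt_eqF// pos2_gt0// (lt_le_trans ltr01).
Qed.

Lemma C1_on_step a (U : set 'rV[R]_a) h : open U -> C1_on U h ->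
  C1_on U (fun x => step (h x)).
Proof.
move=> oU Ch.
have C2 : C1_on U (fun x => 1 - h x) := C1_onB oU (C1_on_cst U 1) Ch.
have den0 x : U x -> pos2 (h x) + pos2 (1 - h x) != 0.
  by move=> _; rewrite gt_eqF// pos2_den_gt0.
have CD := C1_onD oU (C1_on_pos2 oU Ch) (C1_on_pos2 oU C2).
exact: (C1_onM oU (C1_on_pos2 oU Ch) (C1_onV oU den0 CD)).
Qed.

Lemma C1_on_coord a (U : set 'rV[R]_a) j : open U -> C1_on U (fun x => x 0 j).
Proof.
move=> oU; split=> [x _|v x Ux]; first exact: differentiable_coord.
apply: (@near_eq_continuous _ _ _ (cst (v 0 j))); last exact: cst_continuous.
apply: near_open Ux _ => // y _.
by rewrite -(@derive_entry _ _ _ _ id)//= derive_id.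
Qed.

(** A product over the coordinates fits the norm of row vectors, which is the maximum norm: the
    value is 1 within distance [e] of [x0] and 0 from distance [2 * e] on. The two factors treat the
    two sides of each coordinate. *)
Definition box_bump a (x0 : 'rV[R]_a) (e : R) (x : 'rV[R]_a) : R :=
  \prod_j (step (2 - e^-1 * (x 0 j - x0 0 j)) * step (2 + e^-1 * (x 0 j - x0 0 j))).

Lemma C1_on_bump a (U : set 'rV[R]_a) x0 e : open U -> C1_on U (box_bump x0 e).
Proof.
move=> oU; apply: C1_on_prod => // j _.
have C : C1_on U (fun x => e^-1 * (x 0 j - x0 0 j)).
  exact: (C1_onM oU (C1_on_cst U _) (C1_onB oU (C1_on_coord j oU) (C1_on_cst U _))).
have Cm := C1_on_step oU (C1_onB oU (C1_on_cst U 2) C).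
have Cp := C1_on_step oU (C1_onD oU (C1_on_cst U 2) C).
exact: (C1_onM oU Cm Cp).
Qed.

Lemma bump_ge0 a (x0 : 'rV[R]_a) e x : 0 <= box_bump x0 e x.
Proof. by apply: prodr_ge0 => j _; rewrite mulr_ge0 ?step_ge0. Qed.

Lemma bump_le1 a (x0 : 'rV[R]_a) e x : box_bump x0 e x <= 1.
Proof.
apply: prodr_ile1 => j _; rewrite mulr_ge0 ?step_ge0//=.
by rewrite mulr_ile1 ?step_ge0 ?step_le1.
Qed.

Lemma row_normE a (x : 'rV[R]_a) (e : R) : 0 <= e ->
  (`|x| <= e) = [forall j, `|x 0 j| <= e].
Proof.
move=> e0; rewrite [`|x|]mx_normrE; apply/idP/forallP => [H j|H].
  by apply: le_trans H; apply: (le_bigmax _ _ (ord0, j)).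
by apply: bigmax_le => // -[i j] _; rewrite (ord1 i); exact: H.
Qed.

Lemma bump_eq1 a (x0 : 'rV[R]_a) e x : 0 < e -> `|x - x0| <= e -> box_bump x0 e x = 1.
Proof.
move=> e0; rewrite row_normE ?ltW// => /forallP H; rewrite /box_bump big1// => j _.
have := H j; rewrite !mxE => Hj; set z := e^-1 * _.
have : `|z| <= 1 by rewrite /z normrM gtr0_norm ?invr_gt0// mulrC ler_pdivrMr// mul1r.
by rewrite ler_norml => /andP[z1 z2]; rewrite !step_eq1 ?mulr1//; lra.
Qed.

Lemma bump_eq0 a (x0 : 'rV[R]_a) e x : 0 < e -> 2 * e <= `|x - x0| -> box_bump x0 e x = 0.
Proof.
move=> e0 H; have [j Hj] : exists j, 2 * e <= `|x 0 j - x0 0 j|.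
  have [/existsP//|] := boolP [exists j, 2 * e <= `|x 0 j - x0 0 j|].
  rewrite negb_exists => /forallP H'; exfalso; move: H; apply/negP; rewrite -ltNge.
  rewrite [`|_|]mx_normrE; apply: bigmax_lt; first by rewrite mulr_gt0.
  by move=> -[i j] _; rewrite (ord1 i) !mxE ltNge.
rewrite /box_bump (bigD1 j)//= [X in X * _](_ : _ = 0) ?mul0r//.
move: Hj; rewrite ler_normr => /orP[Hj|Hj].
  rewrite step_eq0 ?mul0r// subr_le0 mulrC ler_pdivlMr//.
rewrite [X in _ * X]step_eq0 ?mulr0//.
by rewrite -lerBrDl sub0r mulrC ler_pdivrMr//; lra.
Qed.

End Bump.

(** * Alternating forms and Gram matrices *)

Section SetRow.
Context {R : realType} {r k : nat}.
Implicit Types (V : 'M[R]_(r, k)) (w : 'rV[R]_k).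

Lemma row_set_row V i w : row i (set_row V i w) = w.
Proof. by apply/rowP => j; rewrite !mxE eqxx. Qed.

Lemma row_set_row_neq V i j w : j != i -> row j (set_row V i w) = row j V.
Proof. by move=> ji; apply/rowP => l; rewrite !mxE (negbTE ji). Qed.

Lemma set_row_id V i : set_row V i (row i V) = V.
Proof. by apply/matrixP => a b; rewrite !mxE; case: eqP => // ->. Qed.

Lemma set_row_set V i w w' : set_row (set_row V i w) i w' = set_row V i w'.
Proof. by apply/matrixP => a b; rewrite !mxE; case: eqP. Qed.

Lemma set_rowC V i j w w' : i != j ->
  set_row (set_row V i w) j w' = set_row (set_row V j w') i w.
Proof.
move=> ij; apply/matrixP => a b; rewrite !mxE.
by case: (eqVneq a j) => // ->; rewrite eq_sym (negbTE ij).
Qed.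

Lemma row'_set_row V i w : row' i (set_row V i w) = row' i V.
Proof. by apply/matrixP => a b; rewrite !mxE eq_sym (negbTE (neq_lift _ _)). Qed.

Lemma set_row_mul l (A : 'M[R]_(r, l)) (W : 'M[R]_(l, k)) i (u : 'rV[R]_l) :
  set_row (A *m W) i (u *m W) = set_row A i u *m W.
Proof.
apply/matrixP => a b; rewrite !mxE; case: eqP => ai; last first.
  by apply: eq_bigr => c _; rewrite mxE; case: eqP.
by apply: eq_bigr => c _; rewrite mxE ai eqxx.
Qed.

End SetRow.

Lemma set_row_mulr {R : realType} {r k l : nat} (V : 'M[R]_(r, k)) i (w : 'rV[R]_k)
  (T : 'M[R]_(k, l)) : set_row V i w *m T = set_row (V *m T) i (w *m T).
Proof.
apply/matrixP => a b; rewrite !mxE; case: eqP => ai.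
  by apply: eq_bigr => c _; rewrite mxE ai eqxx.
by apply: eq_bigr => c _; rewrite mxE; case: eqP.
Qed.

Section Alternating.
Context {R : realType} {r k : nat}.
Implicit Types (psi : 'M[R]_(r, k) -> R) (V W : 'M[R]_(r, k)) (w : 'rV[R]_k).

Definition multilinear_rows psi := forall V i (b c : R) (w w' : 'rV[R]_k),
  psi (set_row V i (b *: w + c *: w')) = b * psi (set_row V i w) + c * psi (set_row V i w').

Definition alternating_rows psi := forall V i j, i != j -> row i V = row j V -> psi V = 0.

Section Multilinear.
Variables (psi : 'M[R]_(r, k) -> R) (lin : multilinear_rows psi).

Lemma multilinearD V i w w' :
  psi (set_row V i (w + w')) = psi (set_row V i w) + psi (set_row V i w').
Proof. by have := lin V i 1 1 w w'; rewrite !scale1r !mul1r. Qed.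

Lemma multilinear0 V i : psi (set_row V i 0) = 0.
Proof. by have := lin V i 0 0 0 0; rewrite !scale0r addr0 !mul0r addr0. Qed.

Lemma multilinearZ V i c w : psi (set_row V i (c *: w)) = c * psi (set_row V i w).
Proof. by have := lin V i c 0 w w; rewrite scale0r addr0 mul0r addr0. Qed.

Lemma multilinear_sum V i n (c : 'I_n -> R) (w : 'I_n -> 'rV[R]_k) :
  psi (set_row V i (\sum_j c j *: w j)) = \sum_j c j * psi (set_row V i (w j)).
Proof.
elim: n c w => [|n IH] c w; first by rewrite !big_ord0 multilinear0.
by rewrite !big_ord_recl multilinearD IH multilinearZ.
Qed.

Lemma multilinear_basis V i w :
  psi (set_row V i w) = \sum_j w 0 j * psi (set_row V i (delta_mx 0 j)).
Proof. by rewrite {1}(row_sum_delta w) multilinear_sum. Qed.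

Lemma multilinear_mul (V : 'M[R]_(r, k)) i n (u : 'rV[R]_n) (W : 'M[R]_(n, k)) :
  psi (set_row V i (u *m W)) = \sum_j u 0 j * psi (set_row V i (row j W)).
Proof. by rewrite mulmx_sum_row multilinear_sum. Qed.

End Multilinear.

Lemma multilinear_ext psi psi' : multilinear_rows psi -> multilinear_rows psi' ->
  (forall s : 'I_r -> 'I_k, psi (\matrix_i delta_mx 0 (s i)) = psi' (\matrix_i delta_mx 0 (s i))) ->
  psi =1 psi'.
Proof.
move=> lin lin' H.
(* [n] counts the leading rows that are still arbitrary; the others are already basis vectors. *)
have K n V : (n <= r)%N -> (forall i : 'I_r, (n <= i)%N -> exists j, row i V = delta_mx 0 j) ->
   psi V = psi' V.
  elim: n V => [|n IH] V nr HV.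
    have [s Hs] := choice (fun i => HV i (leq0n i)).
    by have := H s; rewrite (_ : \matrix_i _ = V)//; apply/row_matrixP => i; rewrite rowK Hs.
  pose i := Ordinal nr.
  rewrite -(set_row_id V i) (multilinear_basis lin) (multilinear_basis lin').
  apply: eq_bigr => j _; congr (_ * _); apply: IH; first exact: ltnW.
  move=> l nl; have [->|li] := eqVneq l i; first by exists j; rewrite row_set_row.
  rewrite row_set_row_neq//; apply: HV; rewrite ltn_neqAle nl andbT.
  by apply: contra li => /eqP e; apply/eqP/val_inj.
by move=> V; apply: (K r) => // i; rewrite leqNgt ltn_ord.
Qed.

(** Polarisation: expand the value 0 taken with [w + w'] in both slots. *)
Lemma alternating_swap psi V i j w w' : multilinear_rows psi -> alternating_rows psi -> i != j ->
  psi (set_row (set_row V i w) j w') = - psi (set_row (set_row V i w') j w).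
Proof.
move=> lin alt ij; apply/eqP; rewrite -addr_eq0; apply/eqP.
have A u : psi (set_row (set_row V i u) j u) = 0.
  by apply: (alt _ i j ij); rewrite row_set_row row_set_row_neq// row_set_row.
have := A (w + w'); rewrite (multilinearD lin) !(set_rowC _ _ _ ij).
by rewrite !(multilinearD lin) -!(set_rowC _ _ _ ij) !A add0r addr0 addrC.
Qed.

End Alternating.

Section Det.
Context {R : realType} {r : nat}.

(** The factor [c] lets one statement serve for the determinant, with [c = 1], and for its multiple
    in [alternating_det]. *)
Lemma det_multilinear (c : R) : multilinear_rows (fun A : 'M[R]_r => \det A * c).
Proof.
move=> V i b d w w'; rewrite (determinant_multilinear (i0 := i)
  (B := set_row V i w) (C := set_row V i w') (b := b) (c := d)) ?row_set_row//.
- by rewrite mulrDl !mulrA.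
- by rewrite !row'_set_row.
- by rewrite !row'_set_row.
Qed.

Lemma alternating_row_perm (psi : 'M[R]_r -> R) : multilinear_rows psi -> alternating_rows psi ->
  forall s V, psi (row_perm s V) = (-1) ^+ s * psi V.
Proof.
move=> lin alt s; case: (prod_tpermP s) => ts -> {s}.
elim: ts => [|[i j] ts IH] /=.
  by move=> _ V; rewrite big_nil row_perm1 odd_perm1 mul1r.
move=> /andP[/= ij dts] V; rewrite big_cons row_permM.
rewrite odd_mul_tperm ij signr_addb expr1 -mulrA -IH// mulN1r; set W := row_perm _ V.
have e : set_row (set_row W i (row i W)) j (row j W) = W by rewrite !set_row_id.
rewrite -[in RHS]e (alternating_swap _ _ _ lin alt ij) opprK.
congr psi; apply/matrixP => a b; rewrite !mxE.
case: tpermP => [->|->|/eqP ai /eqP aj].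
- by rewrite (negbTE ij) eqxx.
- by rewrite eqxx.
- by rewrite (negbTE ai) (negbTE aj).
Qed.

(** Both sides are multilinear, so they are compared on matrices of basis rows: a repeated row kills
    both, and otherwise the matrix is a row permutation of the identity. *)
Lemma alternating_det (psi : 'M[R]_r -> R) : multilinear_rows psi -> alternating_rows psi ->
  forall A, psi A = \det A * psi 1%:M.
Proof.
move=> lin alt; apply: multilinear_ext => //; first exact: det_multilinear.
move=> s; have [inj|] := boolP (injectiveb s); last first.
  move=> /injectivePn [i [j ij sij]].
  have e : row i (\matrix_i delta_mx 0 (s i) : 'M[R]_r) = row j (\matrix_i delta_mx 0 (s i)).
    by rewrite !rowK sij.
  rewrite (alt _ i j ij e) (determinant_alternate ij) ?mul0r// => l.
  by have := congr1 (fun v : 'rV[R]_r => v 0 l) e; rewrite !mxE.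
have /injectiveP inj' := inj.
have -> : (\matrix_i delta_mx 0 (s i) : 'M[R]_r) = row_perm (perm inj') 1%:M.
  by apply/matrixP => a b; rewrite !mxE permE eqxx /= eq_sym.
by rewrite alternating_row_perm// row_permE mulmx1 det_perm.
Qed.

End Det.

Section Alternating_mul.
Context {R : realType} {r k : nat}.
Variables (psi : 'M[R]_(r, k) -> R) (lin : multilinear_rows psi) (alt : alternating_rows psi).

(** As a function of [A], the left-hand side is an alternating form on square matrices. *)
Lemma alternating_mulmx (A : 'M[R]_r) V : psi (A *m V) = \det A * psi V.
Proof.
have := @alternating_det R r (fun A => psi (A *m V)); rewrite mul1mx; apply.
- by move=> B i b c w w'; rewrite !set_row_mulr mulmxDl -!scalemxAl lin.
- move=> B i j ij e; apply: (alt (i := i) (j := j)) => //.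
  by rewrite !row_mul e.
Qed.

(* So u_i = psi (set_row V i w) is a vector density under a change of chart. *)
Lemma alternating_density (A : 'M[R]_r) V w (u : 'cV[R]_r) :
  \sum_i (A *m u) i 0 * psi (set_row (A *m V) i w) =
  \det A * \sum_i u i 0 * psi (set_row V i w).
Proof.
have := @alternating_det R r (fun A => \sum_i (A *m u) i 0 * psi (set_row (A *m V) i w)).
rewrite !mul1mx; apply.
- move=> B i b c v v'; rewrite !mulr_sumr -big_split /=; apply: eq_bigr => j _.
  have row_i z : (set_row B i z *m u) i 0 = (z *m u) 0 0.
    by rewrite !mxE; apply: eq_bigr => l _; rewrite mxE eqxx.
  have [->|ji] := eqVneq j i.
    rewrite !row_i mulmxDl -!scalemxAl !mxE.
    by rewrite !set_row_mulr !set_row_set mulrDl !mulrA.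
  have row_j z : (set_row B i z *m u) j 0 = (B *m u) j 0.
    by rewrite !mxE; apply: eq_bigr => l _; rewrite mxE (negbTE ji).
  rewrite !row_j !set_row_mulr !(@set_rowC _ _ _ _ i j) 1?eq_sym// mulmxDl -!scalemxAl lin.
  by ring.
- move=> B i j ij e.
  have Bu : (B *m u) i 0 = (B *m u) j 0.
    by have := congr1 (fun v => (v *m u) 0 0) e; rewrite -!row_mul !mxE.
  have BV : row i (B *m V) = row j (B *m V) by rewrite !row_mul e.
  rewrite (bigD1 i)//= (bigD1 j) 1?eq_sym//= big1 ?addr0 => [|l /andP[li lj]].
    have E : psi (set_row (B *m V) i w) = - psi (set_row (B *m V) j w).
      rewrite -{1}(set_row_id (B *m V) j) set_rowC 1?eq_sym// -BV.
      rewrite (alternating_swap _ _ _ lin alt ij).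
      by rewrite set_row_id.
    by rewrite E Bu mulrN addNr.
  rewrite (alt (i := i) (j := j) ij) ?mulr0//.
  by rewrite !row_set_row_neq 1?eq_sym.
Qed.

End Alternating_mul.

(** * Positive definite Gram matrices, comass and first cousins *)

Section Gram.
Context {R : realType}.

Definition posdef (k : nat) (G : 'M[R]_k) :=
  G^T = G /\ forall v : 'rV[R]_k, v != 0 -> 0 < ip G v v.

Lemma ipC (k : nat) (G : 'M[R]_k) v w : G^T = G -> ip G v w = ip G w v.
Proof.
move=> GT; rewrite /ip; have -> : w *m G *m v^T = (v *m G *m w^T)^T.
  by rewrite !trmx_mul trmxK GT mulmxA.
by rewrite [RHS]mxE.
Qed.

Lemma ip0l (k : nat) (G : 'M[R]_k) w : ip G 0 w = 0.
Proof. by rewrite /ip !mul0mx mxE. Qed.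

Lemma ipDl (k : nat) (G : 'M[R]_k) v v' w : ip G (v + v') w = ip G v w + ip G v' w.
Proof. by rewrite /ip !mulmxDl mxE. Qed.

Lemma ipDr (k : nat) (G : 'M[R]_k) v w w' : ip G v (w + w') = ip G v w + ip G v w'.
Proof. by rewrite /ip linearD mulmxDr mxE. Qed.

Lemma ipZl (k : nat) (G : 'M[R]_k) c v w : ip G (c *: v) w = c * ip G v w.
Proof. by rewrite /ip -!scalemxAl mxE. Qed.

Lemma ipNl (k : nat) (G : 'M[R]_k) v w : ip G (- v) w = - ip G v w.
Proof. by rewrite -scaleN1r ipZl mulN1r. Qed.

Lemma ip_suml (k : nat) (G : 'M[R]_k) (I : Type) (s : seq I) (P : pred I) (v : I -> 'rV[R]_k) w :
  ip G (\sum_(i <- s | P i) v i) w = \sum_(i <- s | P i) ip G (v i) w.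
Proof. by rewrite /ip !mulmx_suml summxE. Qed.

Lemma ip_rowr (r k : nat) (G : 'M[R]_k) v (J : 'M[R]_(r, k)) i :
  ip G v (row i J) = (v *m G *m J^T) 0 i.
Proof. by rewrite /ip !mxE; apply: eq_bigr => l _; rewrite !mxE. Qed.

Lemma ip_delta (k : nat) (G : 'M[R]_k) i j : ip G (delta_mx 0 i) (delta_mx 0 j) = G i j.
Proof. by rewrite /ip -rowE trmx_delta -colE !mxE. Qed.

Lemma ip_mul (k l : nat) (G : 'M[R]_k) (T : 'M[R]_(l, k)) v w :
  ip (T *m G *m T^T) v w = ip G (v *m T) (w *m T).
Proof. by rewrite /ip trmx_mul !mulmxA. Qed.

Lemma ip_ge0 (k : nat) (G : 'M[R]_k) v : posdef G -> 0 <= ip G v v.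
Proof.
by move=> [_ pG]; have [->|v0] := eqVneq v 0; [rewrite ip0l|rewrite ltW// pG].
Qed.

Lemma ip_eq0 (k : nat) (G : 'M[R]_k) v : posdef G -> ip G v v = 0 -> v = 0.
Proof.
by move=> [_ pG] e; apply/eqP; apply: contra_eqT e => /pG; rewrite lt0r => /andP[].
Qed.

Lemma posdef_unit (k : nat) (G : 'M[R]_k) : posdef G -> G \in unitmx.
Proof.
move=> [_ pG]; rewrite -row_free_unit; apply/row_freeP.
suff : row_free G by move=> /row_freeP.
rewrite -kermx_eq0; apply/eqP/row_matrixP => i; rewrite row0; apply/eqP.
apply: contraT => /pG; rewrite /ip.
have : row i (kermx G) *m G = 0 by apply: sub_kermxP; exact: row_sub.
by move=> ->; rewrite mul0mx mxE ltxx.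
Qed.

Lemma posdef_gram (r k : nat) (G : 'M[R]_k) (J : 'M[R]_(r, k)) :
  posdef G -> row_free J -> posdef (J *m G *m J^T).
Proof.
move=> [GT pG] fJ; split; first by rewrite !trmx_mul trmxK GT mulmxA.
move=> v v0; rewrite ip_mul; apply: pG; apply: contra v0 => /eqP vJ.
by apply/eqP; apply: (row_free_inj fJ); rewrite vJ mul0mx.
Qed.

(** Only the factorisation matters below, so [L] is not recorded as triangular. The induction splits
    off the first row and continues with the Schur complement [C - a^-1 *: (b^T *m b)]. *)
Lemma cholesky (k : nat) (S : 'M[R]_k) : posdef S ->
  exists L : 'M[R]_k, S = L *m L^T.
Proof.
elim: k S => [|k IH] S pS; first by exists 1%:M; rewrite [LHS]flatmx0 [RHS]flatmx0.
have [ST Sp] := pS; rewrite -[k.+1]/(1 + k)%N in S ST Sp pS *.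
pose b := ursubmx S; pose C := drsubmx S.
have eS : S = block_mx (ulsubmx S) b b^T C.
  by rewrite -{1}(submxK S) /b trmx_ursub ST.
pose a := S 0 0.
have ea : ulsubmx S = a%:M.
  by rewrite [LHS]mx11_scalar !mxE; congr (S _ _)%:M; apply/val_inj.
have a0 : 0 < a.
  have := Sp (delta_mx 0 0); rewrite ip_delta.
  apply; apply/eqP => /rowP /(_ 0); rewrite !mxE !eqxx /= => /eqP.
  by rewrite oner_eq0.
have CT : C^T = C by rewrite /C trmx_drsub ST.
have pC : posdef (C - a^-1 *: (b^T *m b)).
  split; first by rewrite linearB linearZ /= trmx_mul trmxK CT.
  (* This [t] minimises the form in its first coordinate; what remains is the Schur complement at
     [v]. *)
  move=> v v0; pose t := - a^-1 *: (v *m b^T).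
  have := Sp (row_mx t v).
  have -> : ip S (row_mx t v) (row_mx t v) = ip (C - a^-1 *: (b^T *m b)) v v.
    rewrite /ip eS mul_row_block tr_row_mx mul_row_col ea mul_mx_scalar.
    rewrite /t scalerA mulrN divff ?gt_eqF// scaleN1r addNr mul0mx add0r.
    congr ((_ *m _) 0 0).
    by rewrite [LHS]addrC mulmxBr scaleNr mulNmx -scalemxAl -scalemxAr mulmxA.
  apply; apply: contra v0 => /eqP e.
  by rewrite -(row_mxKr t v) e linear0.
have [L eL] := IH _ pC.
exists (block_mx (Num.sqrt a)%:M 0 ((Num.sqrt a)^-1 *: b^T) L).
have s0 : Num.sqrt a != 0 by rewrite gt_eqF// sqrtr_gt0.
have ss : Num.sqrt a * Num.sqrt a = a by rewrite -expr2 sqr_sqrtr// ltW.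
rewrite eS tr_block_mx mulmx_block !trmx0 mulmx0 mul0mx !addr0 tr_scalar_mx ea.
rewrite linearZ /= trmxK -scalar_mxM ss mul_scalar_mx scalerA divff// scale1r.
rewrite mul_mx_scalar scalerA divff// scale1r -scalemxAl -scalemxAr scalerA.
by rewrite -invfM ss -eL mulmx0 addr0 subrKC.
Qed.

Lemma posdef_det_gt0 (k : nat) (S : 'M[R]_k) : posdef S -> 0 < \det S.
Proof.
move=> pS; have [L eL] := cholesky pS.
have := posdef_unit pS; rewrite unitmxE unitfE eL det_mulmx det_tr => d0.
by rewrite lt0r d0 -expr2 sqr_ge0.
Qed.

Lemma posdef_row' (k : nat) (S : 'M[R]_k.+1) i : posdef S -> posdef (row' i (col' i S)).
Proof.
move=> [ST pS]; split; first by rewrite tr_row' tr_col' ST; apply/matrixP => a b; rewrite !mxE.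
move=> v v0; pose w : 'rV[R]_k.+1 := \row_j (if unlift i j is Some j' then v 0 j' else 0).
have wE j : w 0 (lift i j) = v 0 j by rewrite mxE liftK.
have wi : w 0 i = 0 by rewrite mxE unlift_none.
have -> : ip (row' i (col' i S)) v v = ip S w w.
  rewrite /ip !mxE (bigD1_ord i)//= !mxE unlift_none mulr0 add0r.
  apply: eq_bigr => j _; rewrite !mxE liftK; congr (_ * _).
  rewrite (bigD1_ord i)//= wi mul0r add0r; apply: eq_bigr => l _.
  by rewrite !mxE liftK.
apply: pS; apply: contra v0 => /eqP e; apply/eqP/rowP => j.
by rewrite -wE e !mxE.
Qed.

End Gram.

Section Comass.
Context {R : realType} {r k : nat}.
Variables (G : 'M[R]_k) (psi : 'M[R]_(r, k) -> R).
Hypotheses (pG : posdef G) (lin : multilinear_rows psi) (alt : alternating_rows psi).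
Hypothesis comass : forall V, V *m G *m V^T = 1%:M -> `|psi V| <= 1.

(** If the Gram matrix is [L *m L^T], the rows of [invmx L *m V] are orthonormal, and passing to
    them divides [psi] by [\det L]. *)
Lemma comass_gram V : posdef (V *m G *m V^T) -> psi V ^+ 2 <= \det (V *m G *m V^T).
Proof.
move=> pV; have [L eL] := cholesky pV.
have uL : L \in unitmx.
  have := posdef_unit pV; rewrite eL !unitmxE det_mulmx det_tr.
  by rewrite unitrM => /andP[].
have on : (invmx L *m V) *m G *m (invmx L *m V)^T = 1%:M.
  rewrite trmx_mul !mulmxA -(mulmxA (invmx L)) -(mulmxA (invmx L)).
  by rewrite eL mulmxA mulVmx// mul1mx -trmx_mul mulVmx// trmx1.
have := comass on; rewrite (alternating_mulmx lin alt) det_inv.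
rewrite eL det_mulmx det_tr => H.
have d0 : \det L != 0 by move: uL; rewrite unitmxE unitfE.
move: H; rewrite normrM normfV ler_pdivrMl ?normr_gt0// mulr1 => H.
by rewrite -expr2 -(real_normK (num_real (psi V))) -(real_normK (num_real (\det L))) ler_sqr ?nnegrE.
Qed.

End Comass.

Section FirstCousin.
Context {R : realType} {r k : nat}.
Variables (G : 'M[R]_k) (J : 'M[R]_(r.+1, k)) (H : 'rV[R]_k) (i : 'I_r.+1).
Hypotheses (pG : posdef G) (pg : posdef (J *m G *m J^T)).
Hypothesis HJ : H *m G *m J^T = 0.
Let g := J *m G *m J^T.
Let D (c : R) : 'M[R]_r.+1 := set_row 1%:M i (c *: delta_mx 0 i).

Let detD c : \det (D c) = c.
Proof.
have := @multilinearZ _ _ _ _ (@det_multilinear R r.+1 1) 1%:M i c (delta_mx 0 i).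
rewrite !mulr1 /D => ->; rewrite (_ : set_row _ _ _ = 1%:M) ?det1 ?mulr1//.
by apply/matrixP => a b; rewrite !mxE eqxx; case: eqP => // ->; rewrite eq_sym.
Qed.

Let rowD c l (X : 'M[R]_(r.+1, l)) : D c *m X = set_row X i (c *: row i X).
Proof. by rewrite /D -set_row_mul mul1mx -scalemxAl -rowE. Qed.

(** [H] is orthogonal to the rows of [J], so mixing it into row [i] adds only its squared length, at
    the diagonal entry [(i, i)]. *)
Let gram_cousin c s : let V := set_row J i (c *: row i J + s *: H) in
  V *m G *m V^T = D c *m g *m (D c)^T + (s ^+ 2 * ip G H H) *: delta_mx i i.
Proof.
move=> V; have -> : V = D c *m J + delta_mx i 0 *m (s *: H).
  rewrite rowD /V; apply/matrixP => a b; rewrite !mxE big_ord1 !mxE eqxx andbT.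
  by case: eqP => _; rewrite ?mul1r// mul0r addr0.
have JH : J *m G *m H^T = 0.
  apply: trmx_inj; rewrite !trmx_mul trmxK trmx0.
  by case: pG => -> _; rewrite mulmxA.
rewrite linearD /= !mulmxDl !mulmxDr !trmx_mul !linearZ /=.
rewrite !(=^~ scalemxAl, =^~ scalemxAr) !mulmxA.
have -> : D c *m J *m G *m H^T = 0 by rewrite -!mulmxA (mulmxA J) JH mulmx0.
rewrite mul0mx scaler0 addr0.
have -> : delta_mx i 0 *m H *m G *m J^T = 0 :> 'M[R]_r.+1.
  by rewrite -!mulmxA (mulmxA H) HJ mulmx0.
rewrite mul0mx scaler0 add0r; congr (_ + _).
rewrite !scalerA -expr2 -scalerA; congr (_ *: _).
have -> : delta_mx i 0 *m H *m G *m H^T = ip G H H *: (delta_mx i 0 : 'cV_r.+1).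
  by rewrite -2!mulmxA (mulmxA H) [H *m G *m H^T]mx11_scalar mul_mx_scalar.
by rewrite -scalemxAl trmx_delta mul_delta_mx.
Qed.

Let det_cousin c s : let V := set_row J i (c *: row i J + s *: H) in
  \det (V *m G *m V^T) = c ^+ 2 * \det g + s ^+ 2 * (ip G H H * \det (row' i (col' i g))).
Proof.
move=> V; rewrite gram_cousin; set S0 := D c *m g *m (D c)^T; set t := s ^+ 2 * _.
have -> : S0 + t *: delta_mx i i = set_row S0 i (row i S0 + t *: delta_mx 0 i).
  by apply/matrixP => a b; rewrite !mxE; case: eqP => [->|_] //=; rewrite mulr0 addr0.
have := @multilinearD _ _ _ _ (@det_multilinear R r.+1 1) S0 i (row i S0) (t *: delta_mx 0 i).
rewrite (multilinearZ (@det_multilinear R r.+1 1)) !mulr1 => ->.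
rewrite set_row_id !det_mulmx det_tr detD; congr (_ + _); first by ring.
rewrite mulrA -/t; congr (_ * _); rewrite (expand_det_row _ i).
rewrite (bigD1 i)//= big1 ?addr0 => [|j ji]; last first.
  by rewrite !mxE eqxx (negbTE ji) mul0r.
rewrite !mxE !eqxx mul1r /cofactor addnn -mul2n exprM sqrrN !expr1n mul1r.
congr (\det _); have -> : S0 = (D c *m (D c *m g)^T)^T by rewrite trmx_mul trmxK.
by apply/matrixP => a b; rewrite !rowD !mxE !(eq_sym _ i) !(negbTE (neq_lift _ _)).
Qed.

(** A quantitative first cousin principle: tilting row [i] of [J] towards the normal vector [H]
    cannot lift [psi] above the volume of the tilted frame, and the best tilt yields the bound. *)
Lemma first_cousin psi : multilinear_rows psi -> alternating_rows psi ->
  (forall V, V *m G *m V^T = 1%:M -> `|psi V| <= 1) -> psi J != 0 ->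
  psi (set_row J i H) ^+ 2 <=
    ip G H H * \det (row' i (col' i g)) * (1 - psi J ^+ 2 / \det g).
Proof.
move=> lin alt com A0; set A := psi J in A0 *; set B := psi (set_row J i H).
have [H0|H0] := eqVneq H 0; first by rewrite /B H0 (multilinear0 lin) expr0n /= ip0l !mul0r.
have h0 : 0 < ip G H H by apply pG.
have d0 : 0 < \det (row' i (col' i g)) by apply: posdef_det_gt0; exact: posdef_row'.
have g0 : 0 < \det g by exact: posdef_det_gt0.
have hd := mulr_gt0 h0 d0; set h := ip G H H * _ in hd *.
(* The equality case of Cauchy-Schwarz: [psi] of the tilted frame and its Gram determinant both
   become [K = A ^+ 2 / \det g + B ^+ 2 / h], so the comass bound reads [K ^+ 2 <= K]. *)
pose c := A / \det g; pose s := B / h.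
pose V := set_row J i (c *: row i J + s *: H).
(* Keeps the rows of [V] independent, hence its Gram matrix positive definite. *)
have c0 : c != 0 by rewrite mulf_neq0// invr_neq0// gt_eqF.
have pV : posdef (V *m G *m V^T).
  split; first by rewrite !trmx_mul trmxK; case: pG => -> _; rewrite mulmxA.
  move=> v v0; rewrite gram_cousin.
  have -> : ip (D c *m g *m (D c)^T + (s ^+ 2 * ip G H H) *: delta_mx i i) v v =
     ip (D c *m g *m (D c)^T) v v + s ^+ 2 * ip G H H * (v 0 i) ^+ 2.
    rewrite /ip mulmxDr mulmxDl mxE; congr (_ + _).
    rewrite -scalemxAr -scalemxAl mxE; congr (_ * _).
    by rewrite -(mul_delta_mx (0 : 'I_1)) mulmxA -colE -mulmxA mxE big_ord1 -rowE !mxE.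
  apply: ltr_pwDl; last by rewrite mulr_ge0 ?sqr_ge0// mulr_ge0 ?sqr_ge0// ltW.
  rewrite ip_mul; apply pg; apply: contra v0 => /eqP e.
  have uD : D c \in unitmx by rewrite unitmxE detD unitfE.
  by rewrite -(mulmxK uD v) e mul0mx.
have := comass_gram lin alt com pV; rewrite det_cousin lin set_row_id -/A -/B -/h.
have -> : c * A + s * B = A ^+ 2 / \det g + B ^+ 2 / h by rewrite /c /s; ring.
have -> : c ^+ 2 * \det g + s ^+ 2 * h = A ^+ 2 / \det g + B ^+ 2 / h.
  by rewrite /c /s; field; rewrite !gt_eqF.
set K := _ + _ => HK.
have K0 : 0 < K.
  by rewrite /K ltr_pwDl// ?divr_gt0 ?exprn_even_gt0// divr_ge0 ?sqr_ge0// ltW.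
have : K <= 1 by move: HK; rewrite expr2 ger_pMr.
by rewrite /K addrC -lerBrDr ler_pdivrMr// mulrC.
Qed.

End FirstCousin.

(** * The Levi-Civita connection *)

Section Smooth.
Context {R : realType} {a : nat}.

Lemma smooth_on_derive (W : normedModType R) (U : set 'rV[R]_a) (f : 'rV[R]_a -> W) v :
  smooth_on U f -> smooth_on U ('D_v f).
Proof. by move=> sf j; have [_] := sf j.+1; exact. Qed.

Lemma smooth_on_differentiable (W : normedModType R) (U : set 'rV[R]_a)
  (f : 'rV[R]_a -> W) x : smooth_on U f -> U x -> differentiable f x.
Proof. by move=> sf Ux; have [df _] := sf 1%N; exact: df. Qed.

Lemma smooth_on_continuous (W : normedModType R) (U : set 'rV[R]_a)
  (f : 'rV[R]_a -> W) x : smooth_on U f -> U x -> {for x, continuous f}.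
Proof. by move=> sf Ux; exact: (sf 0%N). Qed.

Lemma smooth_on_C1 (U : set 'rV[R]_a) (h : 'rV[R]_a -> R) :
  smooth_on U (h : _ -> R^o) -> C1_on U h.
Proof. by move=> sh; have [dh ch] := sh 1%N; split => // v x Ux; exact: ch. Qed.

Lemma smooth_on_entry p q (U : set 'rV[R]_a) (f : 'rV[R]_a -> 'M[R]_(p, q)) i j :
  open U -> smooth_on U f -> C1_on U (fun x => f x i j).
Proof.
move=> oU sf; split=> [x Ux|v x Ux].
  by apply: differentiable_entry; exact: smooth_on_differentiable sf Ux.
apply: (@near_eq_continuous _ _ _ (fun y => 'D_v f y i j)).
  apply: near_open Ux _ => // y Uy; rewrite derive_entry//.
  by apply: diff_derivable; exact: smooth_on_differentiable sf Uy.
apply: continuous_entry; exact: smooth_on_continuous (smooth_on_derive v sf) Ux.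
Qed.

End Smooth.

Section DeriveMx.
Context {R : realType} {V : normedModType R}.

Lemma derivable_entry p q (F : V -> 'M[R]_(p, q)) x v i j :
  derivable F x v -> derivable (fun y => F y i j) x v.
Proof. by move=> /derivable_mxP. Qed.

Lemma derive_sum_fin (I : Type) (r : seq I) (P : pred I) (h : I -> V -> R) x v :
  (forall i, P i -> derivable (h i) x v) ->
  derivable (fun y => \sum_(i <- r | P i) h i y) x v /\
  'D_v (fun y => \sum_(i <- r | P i) h i y) x = \sum_(i <- r | P i) 'D_v (h i) x.
Proof.
move=> dh; elim: r => [|i r [IH1 IH2]].
  rewrite big_nil (_ : (fun y => _) = cst 0); last first.
    by apply/funext => y; rewrite big_nil.
  by split; [exact: derivable_cst|exact: derive_cst].
rewrite big_cons; case: ifPn => Pi; last first.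
  by under eq_fun do rewrite big_cons (negbTE Pi).
under eq_fun do rewrite big_cons Pi.
by split; [exact: (derivableD (dh _ Pi) IH1)|rewrite (deriveD (dh _ Pi) IH1) IH2].
Qed.

Lemma derive_prodr (h k : V -> R) x v : derivable h x v -> derivable k x v ->
  'D_v (fun y => h y * k y) x = 'D_v h x * k x + h x * 'D_v k x.
Proof.
by move=> dh dk; rewrite (deriveM dh dk) addrC; congr (_ + _); exact: mulrC.
Qed.

Lemma derive_mulmx p q r (A : V -> 'M[R]_(p, q)) (B : V -> 'M[R]_(q, r)) x v :
  derivable A x v -> derivable B x v ->
  derivable (fun y => A y *m B y) x v /\
  'D_v (fun y => A y *m B y) x = 'D_v A x *m B x + A x *m 'D_v B x.
Proof.
move=> dA dB.
have E i j : derivable (fun y => (A y *m B y) i j) x v /\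
   'D_v (fun y => (A y *m B y) i j) x = ('D_v A x *m B x + A x *m 'D_v B x) i j.
  have dl l : derivable (fun y => A y i l * B y l j) x v.
    by apply: derivableM; exact: derivable_entry.
  have [d1 d2] := derive_sum_fin (index_enum 'I_q) (fun l (_ : xpredT l) => dl l).
  under eq_fun do rewrite mxE; split => //; rewrite d2 !mxE -big_split /=.
  apply: eq_bigr => l _; rewrite derive_prodr; [|exact: derivable_entry..].
  by rewrite !derive_entry.
have dAB : derivable (fun y => A y *m B y) x v.
  by apply/derivable_mxP => i j; exact: (E i j).1.
by split=> //; apply/matrixP => i j; rewrite derive_entry// (E i j).2.
Qed.

Lemma derive_trmx p q (A : V -> 'M[R]_(p, q)) x v : derivable A x v ->
  derivable (fun y => (A y)^T) x v /\ 'D_v (fun y => (A y)^T) x = ('D_v A x)^T.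
Proof.
move=> dA; have dT : derivable (fun y => (A y)^T) x v.
  by apply/derivable_mxP => i j; under eq_fun do rewrite mxE; exact: derivable_entry.
split=> //; apply/matrixP => i j; rewrite mxE !derive_entry//.
by congr ('D_v _ x); apply/funext => y; rewrite mxE.
Qed.

Lemma derive_ip k (G : V -> 'M[R]_k) (X Y : V -> 'rV[R]_k) x v :
  derivable G x v -> derivable X x v -> derivable Y x v ->
  derivable (fun y => ip (G y) (X y) (Y y)) x v /\
  'D_v (fun y => ip (G y) (X y) (Y y)) x =
  ip ('D_v G x) (X x) (Y x) + ip (G x) ('D_v X x) (Y x) + ip (G x) (X x) ('D_v Y x).
Proof.
move=> dG dX dY; have [d1 e1] := derive_mulmx dX dG.
have [dT eT] := derive_trmx dY; have [d2 e2] := derive_mulmx d1 dT.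
split; first exact: (@derivable_entry _ _ (fun y => X y *m G y *m (Y y)^T) x v (0 : 'I_1) (0 : 'I_1) d2).
rewrite -(@derive_entry _ _ _ _ (fun y => X y *m G y *m (Y y)^T)) // e2 e1 eT.
by rewrite mulmxDl [LHS]mxE [X in X + _ = _]mxE [X in X + _ = _]addrC.
Qed.

Lemma derive_ip_cst k (G : V -> 'M[R]_k) (w z : 'rV[R]_k) x v : derivable G x v ->
  'D_v (fun y => ip (G y) w z) x = ip ('D_v G x) w z.
Proof.
move=> dG; have [_ ->] := derive_ip dG (derivable_cst w x v) (derivable_cst z x v).
by rewrite !derive_cst ip0l /ip trmx0 mulmx0 [in X in _ + X]mxE !addr0.
Qed.

End DeriveMx.

Opaque derive.

Section LeviCivitaTheory.
Context {R : realType} {k : nat}.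
Implicit Types (G : 'rV[R]_k -> 'M[R]_k) (x y v w z : 'rV[R]_k).

(* The Christoffel symbols of Defs, for a matrix field not tied to a chart. *)
Definition chr G x v w : 'rV[R]_k :=
  (\row_(s < k) (2^-1 *
     ('D_v (fun y => ip (G y) w (delta_mx 0 s) : R^o) x
    + 'D_w (fun y => ip (G y) v (delta_mx 0 s) : R^o) x
    - 'D_(delta_mx 0 s) (fun y => ip (G y) v w : R^o) x)))
  *m invmx (G x).

Section Fixed.
Variables (G : 'rV[R]_k -> 'M[R]_k) (V : set 'rV[R]_k) (y : 'rV[R]_k).
Hypotheses (oV : open V) (Vy : V y).
Hypotheses (dG : differentiable G y) (pG : forall y, V y -> posdef (G y)).

Lemma derive_sym v : ('D_v G y)^T = 'D_v G y.
Proof.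
have dv := diff_derivable dG (v := v).
have [_ <-] := derive_trmx dv; apply: near_eq_derive.
by apply: near_open Vy _ => // z /pG [].
Qed.

Lemma derive_dir_sum n (c : 'I_n -> R) (u : 'I_n -> 'rV[R]_k) :
  'D_(\sum_i c i *: u i) G y = \sum_i c i *: 'D_(u i) G y.
Proof.
rewrite deriveE// linear_sum; apply: eq_bigr => i _.
by rewrite linearZ /= deriveE.
Qed.

(** The row vector inside [chr] is this formula at the coordinate vectors; pairing with [G y] undoes
    the inverse, and linearity in [z] does the rest. *)
Lemma koszul v w z : ip (G y) (chr G y v w) z =
  2^-1 * (ip ('D_v G y) w z + ip ('D_w G y) v z - ip ('D_z G y) v w).
Proof.
have uG := posdef_unit (pG Vy).
rewrite {1}/ip /chr mulmxKV// mxE.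
transitivity (\sum_s 2^-1 * (z 0 s * ip ('D_v G y) w (delta_mx 0 s) +
   z 0 s * ip ('D_w G y) v (delta_mx 0 s) - z 0 s * ip ('D_(delta_mx 0 s) G y) v w)).
  apply: eq_bigr => s _; rewrite !mxE.
  have D u w1 w2 : 'D_u (fun y => ip (G y) w1 w2 : R^o) y = ip ('D_u G y) w1 w2.
    by apply: derive_ip_cst; exact: diff_derivable.
  transitivity (2^-1 * (ip ('D_v G y) w (delta_mx 0 s) + ip ('D_w G y) v (delta_mx 0 s)
    - ip ('D_(delta_mx 0 s) G y) v w) * z 0 s); first by rewrite !D.
  by rewrite -mulrA; congr (_ * _); rewrite mulrC mulrBr mulrDr.
rewrite -mulr_sumr; congr (_ * _); rewrite !big_split /=.
have ip_basis A u : ip A u z = \sum_s z 0 s * ip A u (delta_mx 0 s).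
  by rewrite {1}(row_sum_delta z) /ip linear_sum /= mulmx_sumr summxE; apply: eq_bigr => s _;
     rewrite linearZ /= -scalemxAr mxE.
congr (_ + _ + _); [by rewrite ip_basis|by rewrite ip_basis|].
rewrite sumrN; congr (- _).
rewrite {2}(row_sum_delta z) derive_dir_sum /ip mulmx_sumr mulmx_suml summxE.
by apply: eq_bigr => s _; rewrite -scalemxAr -scalemxAl [RHS]mxE.
Qed.

Lemma ip_inj u u' : (forall z, ip (G y) u z = ip (G y) u' z) -> u = u'.
Proof.
move=> e; apply/eqP; rewrite -subr_eq0; apply/eqP; apply: (ip_eq0 (pG Vy)).
by rewrite ipDl ipNl e subrr.
Qed.

Lemma chr_sym v w : chr G y v w = chr G y w v.
Proof.
apply: ip_inj => z; move: (koszul v w z) (koszul w v z) => -> ->.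
move: (derive_sym z); set A := 'D_v G y; set B := 'D_w G y; set C := 'D_z G y.
clearbody A B C => sC; rewrite (ipC v w sC).
by congr (_ * (_ - _)); exact: addrC.
Qed.

Lemma chr_compat v w z : ip ('D_v G y) w z =
  ip (G y) (chr G y v w) z + ip (G y) w (chr G y v z).
Proof.
have [GT _] := pG Vy; rewrite [X in _ + X](ipC _ _ GT).
move: (koszul v w z) (koszul v z w) => -> ->.
move: (derive_sym v); set A := 'D_v G y; set B := 'D_w G y; set C := 'D_z G y.
clearbody A B C => sA; rewrite (ipC z w sA) -mulrDr.
move: (ip _ _ _) (ip B _ _) (ip C _ _) => a b c.
have -> : a + b - c + (a + c - b) = 2 * a by ring.
by rewrite mulKf ?pnatr_eq0.
Qed.

(** Koszul's argument for any symmetric and metric family [Gam]. It yields the transformation law of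
    the symbols in [chr_change] without computing with inverse metrics. *)
Lemma chr_unique (Gam : 'rV[R]_k -> 'rV[R]_k -> 'rV[R]_k) :
  (forall v w, Gam v w = Gam w v) ->
  (forall v w z, ip ('D_v G y) w z = ip (G y) (Gam v w) z + ip (G y) w (Gam v z)) ->
  forall v w, Gam v w = chr G y v w.
Proof.
move=> sym com v w; apply: ip_inj => z; rewrite koszul !com.
have [GT _] := pG Vy.
rewrite (ipC w (Gam v z) GT) (ipC v (Gam w z) GT) (ipC v (Gam z w) GT).
rewrite (sym w v) (sym z v) (sym z w).
by field.
Qed.

End Fixed.

End LeviCivitaTheory.

Section MultilinearLeibniz.
Context {R : realType} {a r k : nat}.
Variables (U : set 'rV[R]_a) (P : 'rV[R]_a -> 'M[R]_(r, k) -> R).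
Hypotheses (oU : open U) (linP : forall x, U x -> multilinear_rows (P x)).
Hypothesis CP : forall V, C1_on U (fun x => P x V).

Let leibniz (V : 'rV[R]_a -> 'M[R]_(r, k)) :=
  C1_on U (fun x => P x (V x)) /\ forall v x, U x ->
  'D_v (fun y => P y (V y)) x = 'D_v (fun y => P y (V x)) x +
     \sum_i P x (set_row (V x) i (row i ('D_v V x))).

Lemma set_row_derivable (V : 'rV[R]_a -> 'M[R]_(r, k)) i w x v : derivable V x v ->
  derivable (fun y => set_row (V y) i w) x v /\
  'D_v (fun y => set_row (V y) i w) x = set_row ('D_v V x) i 0.
Proof.
move=> dV; have E p q : derivable (fun y => set_row (V y) i w p q) x v /\
    'D_v (fun y => set_row (V y) i w p q) x = set_row ('D_v V x) i 0 p q.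
  case: (eqVneq p i) => [pi|pi].
    have e : (fun y => set_row (V y) i w p q) = cst (w 0 q).
      by apply/funext => y; rewrite mxE pi eqxx.
    by rewrite e mxE pi eqxx mxE; split; [exact: derivable_cst|exact: derive_cst].
  have e : (fun y => set_row (V y) i w p q) = (fun y => V y p q).
    by apply/funext => y; rewrite mxE (negbTE pi).
  by rewrite e mxE (negbTE pi) derive_entry//; split => //; exact: derivable_entry.
have dS : derivable (fun y => set_row (V y) i w) x v.
  by apply/derivable_mxP => p q; exact: (E p q).1.
by split => //; apply/matrixP => p q; rewrite derive_entry// (E p q).2.
Qed.

(** The components of a form are known to be C^1 at constant arguments only; expansion in the basis,
    one row at a time, extends this to arguments that vary with the point. *)
Lemma multilinear_leibniz (V : 'rV[R]_a -> 'M[R]_(r, k)) : (forall i j, C1_on U (fun x => V x i j)) -> leibniz V.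
Proof.
move=> CV.
have dV (W : 'rV[R]_a -> 'M[R]_(r, k)) x : (forall i j, C1_on U (fun x => W x i j)) -> U x -> differentiable W x.
  by move=> CW Ux; apply: entry_differentiable => i j; apply: (CW i j).1.
(* [n] counts the leading rows allowed to vary; the others are constant on [U]. *)
suff K n : forall V : 'rV[R]_a -> 'M[R]_(r, k), (n <= r)%N -> (forall i j, C1_on U (fun x => V x i j)) ->
    (forall i : 'I_r, (n <= i)%N -> exists c, forall x, U x -> row i (V x) = c) -> leibniz V.
  by apply: (K r) => // i; rewrite leqNgt ltn_ord.
elim: n => [|n IH] {CV}V nr CV HV.
  have [c Hc] := choice (fun i => HV i (leq0n i)).
  pose W : 'M[R]_(r, k) := \matrix_i c i.
  have VW x : U x -> V x = W.
    by move=> Ux; apply/row_matrixP => i; rewrite rowK Hc.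
  split; first by apply: C1_on_eq (CP W) => // x; rewrite inE => /VW ->.
  move=> v x Ux; rewrite big1 ?addr0 => [|i _].
    have VWx := VW x Ux; apply: near_eq_derive; apply: near_open Ux _ => // y Uy.
    by rewrite (VW y Uy) VWx.
  have -> : 'D_v V x = 0.
    rewrite -(derive_cst W x v); apply: near_eq_derive.
    by apply: near_open Ux _ => // y Uy; rewrite VW.
  by rewrite row0 multilinear0//; exact: linP.
pose i := Ordinal nr.
pose Vj j x := set_row (V x) i (delta_mx 0 j).
have CVj j p q : C1_on U (fun x => Vj j x p q).
  case: (eqVneq p i) => [pi|pi].
    apply: (C1_on_eq oU _ (C1_on_cst U ((delta_mx 0 j : 'rV[R]_k) 0 q))) => x _.
    by rewrite mxE pi eqxx.
  by apply: (C1_on_eq oU _ (CV p q)) => x _; rewrite mxE (negbTE pi).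
have IHj j : leibniz (Vj j).
  apply: IH => [||l nl]; [exact: ltnW|exact: CVj|].
  have [->|li] := eqVneq l i.
    by exists (delta_mx 0 j) => x _; rewrite row_set_row.
  have [|c Hc] := HV l.
    rewrite ltn_neqAle nl andbT.
    by apply: contra li => /eqP e; apply/eqP/val_inj.
  by exists c => x Ux; rewrite row_set_row_neq// Hc.
have E x W : U x -> P x W = \sum_j W i j * P x (set_row W i (delta_mx 0 j)).
  move=> Ux; rewrite -{1}(set_row_id W i) (multilinear_basis (linP Ux)).
  by apply: eq_bigr => j _; rewrite mxE.
have CT j : C1_on U (fun x => V x i j * P x (Vj j x)) := C1_onM oU (CV i j) (IHj j).1.
have CS : C1_on U (fun x => \sum_j V x i j * P x (Vj j x)).
  exact: (C1_on_sum _ oU (fun j (_ : xpredT j) => CT j)).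
split.
  by apply: C1_on_eq CS => // x; rewrite inE => Ux; rewrite E.
move=> v x Ux.
have dVx : derivable V x v by apply: diff_derivable; exact: dV.
transitivity ('D_v (fun y => \sum_j V y i j * P y (Vj j y)) x).
  by apply: near_eq_derive; apply: near_open Ux _ => // y Uy; rewrite E.
have [_ ->] := derive_sum_fin (index_enum 'I_k)
  (fun j (_ : xpredT j) => C1_on_derivable (v := v) (CT j) Ux).
transitivity (\sum_j ('D_v V x i j * P x (Vj j x) + (V x i j *
    'D_v (fun y => P y (Vj j x)) x + \sum_l V x i j *
     (if l == i then 0 else P x (set_row (Vj j x) l (row l ('D_v V x))))))).
  apply: eq_bigr => j _; rewrite derive_prodr.
  - rewrite derive_entry//; congr (_ + _).
    rewrite (IHj j).2// -mulr_sumr -mulrDr; congr (_ * (_ + _)).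
    apply: eq_bigr => l _; have [_ ->] := set_row_derivable i (delta_mx 0 j) dVx.
    case: (eqVneq l i) => [->|li].
      by rewrite row_set_row (multilinear0 (linP Ux)).
    by rewrite row_set_row_neq.
  - exact: C1_on_derivable (CV i j) Ux.
  - exact: C1_on_derivable (IHj j).1 Ux.
rewrite !big_split /= addrCA; congr (_ + _).
  have CTx j : C1_on U (fun y => V x i j * P y (Vj j x)) := C1_onM oU (C1_on_cst U _) (CP _).
  transitivity ('D_v (fun y => \sum_j V x i j * P y (Vj j x)) x).
    have [_ ->] := derive_sum_fin (index_enum 'I_k)
      (fun j (_ : xpredT j) => C1_on_derivable (v := v) (CTx j) Ux).
    apply: eq_bigr => j _; rewrite derive_prodr.
    - by rewrite derive_cst mul0r add0r.
    - exact: derivable_cst.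
    - exact: C1_on_derivable (CP _) Ux.
  by apply: near_eq_derive; apply: near_open Ux _ => // y Uy; rewrite [RHS]E.
rewrite [RHS](bigD1 i)//=; congr (_ + _).
  rewrite (multilinear_basis (linP Ux)); apply: eq_bigr => j _.
  by rewrite mxE.
rewrite exchange_big (bigD1 i)//= big1 ?add0r => [|j _]; last by rewrite eqxx mulr0.
apply: eq_bigr => l li; rewrite [RHS]E//; apply: eq_bigr => j _.
have e : set_row (V x) l (row l ('D_v V x)) i j = V x i j.
  by rewrite mxE eq_sym (negbTE li).
by rewrite e (negbTE li) /Vj (@set_rowC _ _ _ (V x) i l) 1?eq_sym.
Qed.

End MultilinearLeibniz.

(** * Lebesgue measure on row vectors *)

Section Borel.
Context {R : realType}.

Lemma borel_open (T : ptopologicalType) (A : set T) : open A -> measurable (A : set (borel T)).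
Proof. by move=> oA; apply: sub_sigma_algebra. Qed.

Lemma borel_closed (T : ptopologicalType) (A : set T) : closed A -> measurable (A : set (borel T)).
Proof.
by move=> cA; rewrite -(setCK A); apply: measurableC; apply: borel_open; exact: closed_openC.
Qed.

Lemma open_continuous_preimage (T U : topologicalType) (D : set T) (f : T -> U) (O : set U) :
  open D -> (forall x, D x -> {for x, continuous f}) -> open O -> open (D `&` f @^-1` O).
Proof.
move=> oD cf oO; rewrite openE => x [Dx fx]; apply: filterI.
  exact: open_nbhs_nbhs.
by apply: (cf x Dx); exact: open_nbhs_nbhs.
Qed.

Lemma borel_continuous (T : ptopologicalType) (D : set T) (f : T -> R) : open D ->
  (forall x, D x -> {for x, continuous f}) -> measurable_fun (D : set (borel T)) (f : borel T -> R).
Proof.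
move=> oD cf; apply: (measurability _ (measurable_realfun.RGenOpens.measurableE R)).
move=> _ [_ [a [b ->] <-]]; apply: borel_open; exact: open_continuous_preimage.
Qed.

Lemma borel_continuous_map (T U : ptopologicalType) (D : set T) (f : T -> U) : open D ->
  (forall x, D x -> {for x, continuous f}) ->
  measurable_fun (D : set (borel T)) (f : borel T -> borel U).
Proof.
move=> oD cf; apply: (@measurability _ _ (borel T) (borel U) D f (@open U) erefl).
move=> _ [B oB <-]; apply: borel_open; exact: open_continuous_preimage.
Qed.

Lemma ballrVE k (z y : 'rV[R]_k) (r : R) : 0 < r ->
  ball z r y <-> forall j, `|z 0 j - y 0 j| < r.
Proof.
move=> r0; split=> [[_ H] j|H]; first exact: (H 0 j).
by split=> // i j; rewrite (ord1 i); exact: H.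
Qed.

Definition rat_row k (q : 'rV[rat]_k) : 'rV[R]_k := \row_j ratr (q 0 j).

Lemma rational_ball k (x : 'rV[R]_k) (O : set 'rV[R]_k) : open O -> O x ->
  exists (q : 'rV[rat]_k) (n : nat), ball (rat_row q) (n.+1%:R^-1) x /\
    ball (rat_row q) (n.+1%:R^-1) `<=` O.
Proof.
move=> oO Ox; have /nbhs_ballP [e /= e0 eO] : nbhs x O by exact: open_nbhs_nbhs.
have e2 : 0 < e / 2 by rewrite divr_gt0.
have [n hn] := ltr_add_invr e2; rewrite add0r in hn.
have n0 : 0 < n.+1%:R^-1 :> R by rewrite invr_gt0.
have Hq j : exists q : rat, `|ratr q - x 0 j| < n.+1%:R^-1.
  have [|q] := @rat_in_itvoo R (x 0 j - n.+1%:R^-1) (x 0 j + n.+1%:R^-1).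
    by rewrite ltrD2l (lt_trans _ n0)// oppr_lt0.
  by rewrite in_itv /= => /andP[H1 H2]; exists q; rewrite ltr_norml ltrBrDr addrC H1 /= ltrBlDr addrC H2.
have [q Hq'] := choice Hq; exists (\row_j q j), n.
have B : ball (rat_row (\row_j q j)) (n.+1%:R^-1) x.
  by apply/ballrVE => // j; rewrite !mxE.
split=> // y By; apply: eO; apply: (@ball_splitr _ _ (rat_row (\row_j q j))).
  exact: le_ball (ltW hn) _ B.
exact: le_ball (ltW hn) _ By.
Qed.

(** An open set is the countable union of the rational balls inside it, and a ball of the maximum
    norm is pulled back coordinate by coordinate. *)
Lemma measurable_fun_rV d (T : measurableType d) (D : set T) k (h : T -> 'rV[R]_k) :
  (forall j, measurable_fun D (fun x => h x 0 j)) ->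
  measurable_fun D (h : T -> borel 'rV[R]_k).
Proof.
move=> mh mD; apply: (@measurability _ _ T (borel 'rV[R]_k) D h (@open 'rV[R]_k) erefl _ mD).
move=> _ [B oB <-].
pose A (n : nat) : set T := if unpickle n is Some qj then
  (if `[< ball (rat_row (qj : 'rV[rat]_k * nat).1) (qj.2.+1%:R^-1) `<=` B >] then
   D `&` h @^-1` (ball (rat_row qj.1) (qj.2.+1%:R^-1)) else set0) else set0.
have -> : D `&` h @^-1` B = \bigcup_n A n.
  apply/seteqP; split=> x /=.
    move=> [Dx Bx]; have [q [n [Bq BO]]] := rational_ball oB Bx.
    exists (pickle (q, n)) => //; rewrite /A pickleK /=.
    by rewrite (asboolT BO).
  move=> [n _]; rewrite /A; case: unpickle => // -[q j] /=.
  by case: asboolP => // BO [Dx /BO].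
apply: bigcupT_measurable => n; rewrite /A; case: unpickle => [[q j]/=|]; last exact: measurable0.
case: asboolP => // _.
have -> : D `&` h @^-1` ball (rat_row q) (j.+1%:R^-1) =
   D `&` \bigcap_(i in [set: 'I_k]) (D `&` (fun x => h x 0 i) @^-1` ball (rat_row q 0 i) (j.+1%:R^-1)).
  apply/seteqP; split=> x /= [Dx Bx]; split => //.
    by move=> i _; split => //; case: Bx => _; exact.
  split=> [|i l]; first by rewrite invr_gt0.
  by rewrite (ord1 i); have [] := Bx l I.
apply: measurableI => //; apply: fin_bigcap_measurable => // i _.
by apply: mh => //; exact: measurable_ball.
Qed.

Lemma measurable_coord k (j : 'I_k) :
  measurable_fun [set: borel 'rV[R]_k] (fun x : borel 'rV[R]_k => (x : 'rV[R]_k) 0 j).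
Proof.
apply: borel_continuous; first exact: openT.
by move=> x _; exact: coord_continuous.
Qed.

(** The concatenation that [integral_rV] performs at each level, as a map on the product space. *)
Definition consr k (p : R * borel 'rV[R]_k) : borel 'rV[R]_k.+1 :=
  row_mx (const_mx p.1 : 'rV[R]_1) (p.2 : 'rV[R]_k).

(** With [t = 0] this is [insert0]; general [i] and [t] parametrise all hyperplanes [x_i = t]. *)
Definition insr k (i : 'I_k.+1) (t : R) (y : 'rV[R]_k) : 'rV[R]_k.+1 :=
  \row_j (if unlift i j is Some j' then y 0 j' else t).

Lemma insr_id k (i : 'I_k.+1) t y : insr i t y 0 i = t.
Proof. by rewrite mxE unlift_none. Qed.

Lemma insr_lift k (i : 'I_k.+1) t y j : insr i t y 0 (lift i j) = y 0 j.
Proof. by rewrite mxE liftK. Qed.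

Lemma consrE k t (y : 'rV[R]_k) : consr (t, y) = insr ord0 t y.
Proof.
apply/rowP => j; rewrite mxE /consr /= /row_mx mxE.
case: unliftP => [l ->|->]; case: fintype.splitP => p /= jp.
- by move: (ltn_ord p); rewrite -jp.
- by congr (y 0 _); apply/val_inj; move: jp => /= [].
- by rewrite mxE.
- by [].
Qed.

Lemma insr_insr k (i : 'I_k.+1) s t (y : 'rV[R]_k) :
  insr (lift ord0 i) t (insr ord0 s y) = insr ord0 s (insr i t y).
Proof.
apply/rowP => j; case: (unliftP ord0 j) => [l ->|->].
  rewrite insr_lift; case: (unliftP i l) => [p ->|->]; last by rewrite !insr_id.
  have -> : lift ord0 (lift i p) = lift (lift ord0 i) (lift ord0 p).
    by apply/val_inj; rewrite /= /bump !leq0n !add1n ltnS addnS.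
  by rewrite !insr_lift.
have e : ord0 = lift (lift ord0 i) (ord0 : 'I_k.+1).
  by apply/val_inj; rewrite /= /bump ltn0.
by rewrite [in LHS]e insr_lift !insr_id.
Qed.

Lemma measurable_insr k i : measurable_fun [set: R * borel 'rV[R]_k]
  (fun p : R * borel 'rV[R]_k => insr i p.1 p.2 : borel 'rV[R]_k.+1).
Proof.
apply: measurable_fun_rV => j; under eq_fun do rewrite mxE.
case: unlift => [l|]; last exact: measurable_fst.
exact: (measurableT_comp (measurable_coord l) measurable_snd).
Qed.

Lemma measurable_consr k : measurable_fun [set: R * borel 'rV[R]_k]
  (@consr k).
Proof.
have -> : @consr k = (fun p => insr ord0 p.1 p.2) by apply/funext => -[u y]; exact: consrE.
exact: measurable_insr.
Qed.

Local Open Scope ereal_scope.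

(** [integral_rV] is a mere iterated integral, and the limit theorems require a measure behind it.
    The volume of balls is carried through the induction because it gives the sigma-finiteness that
    Tonelli uses in the next dimension. *)
Lemma exists_lam k : exists lam : {sigma_finite_measure set (borel 'rV[R]_k) -> \bar R},
  (forall f : borel 'rV[R]_k -> \bar R, measurable_fun [set: borel 'rV[R]_k] f -> (forall x, 0 <= f x) ->
    \int[lam]_x f x = integral_rV f) /\
  (forall (x : 'rV[R]_k) (r : R), (0 < r)%R -> lam (ball x r) = ((r *+ 2) ^+ k)%:E).
Proof.
elim: k => [|k [lam [lamI lamB]]].
  (* In dimension 0, [integral_rV] evaluates at the only point. *)
  exists (@dirac _ (borel 'rV[R]_0) (0%R : 'rV[R]_0) R); split.
    by move=> f mf f0; rewrite integral_dirac// diracT mul1e.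
  move=> x r r0; rewrite expr0 /= /dirac indicE mem_set//.
  by apply/ballrVE => // -[].
pose pm := (@lebesgue_measure R) \x lam.
pose mm : set (borel 'rV[R]_k.+1) -> \bar R :=
  pushforward pm (@consr k).
have mc := @measurable_consr k.
pose mM : {measure set (borel 'rV[R]_k.+1) -> \bar R} :=
  @measure_function_pushforward__canonical__measure_function_Measure _ _ _ _ _ pm _ mc.
have mmI (f : borel 'rV[R]_k.+1 -> \bar R) : measurable_fun [set: borel 'rV[R]_k.+1] f ->
    (forall x, 0 <= f x) -> \int[mm]_x f x = integral_rV f.
  move=> mf f0; rewrite ge0_integral_pushforward// preimage_setT.
  have mfc : measurable_fun [set: R * borel 'rV[R]_k] (f \o @consr k) by exact: measurableT_comp.
  apply: (etrans (@fubini_tonelli1 _ _ _ _ R (@lebesgue_measure R) lam _ mfc (fun x => f0 _))).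
  apply: eq_integral => t _; rewrite /fubini_F lamI//; last by move=> y; exact: f0.
  have mp : measurable_fun [set: borel 'rV[R]_k] (fun y : borel 'rV[R]_k => ((t : R), y)).
    exact: (measurable_fun_pair (measurable_cst _) (@measurable_id _ _ _)).
  exact: (measurableT_comp mfc mp).
have mmB (x : 'rV[R]_k.+1) (r : R) : (0 < r)%R -> mm (ball x r) = ((r *+ 2) ^+ k.+1)%:E.
  move=> r0; 
  have -> : mm (ball x r) = pm (ball (x 0%R ord0) r `*` (ball (col' ord0 x) r : set (borel 'rV[R]_k))).
    rewrite /mm /pushforward; congr (pm _); apply/seteqP; split=> -[t y] /=; rewrite consrE.
      move=> /(ballrVE _ _ r0) H; split; first by have := H ord0; rewrite insr_id.
      by apply/(ballrVE _ _ r0) => j; have := H (lift ord0 j); rewrite insr_lift !mxE.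
    move=> [tB /(ballrVE _ _ r0) yB]; apply/(ballrVE _ _ r0) => j.
    case: (unliftP ord0 j) => [l ->|->]; last by rewrite insr_id.
    by rewrite insr_lift; have := yB l; rewrite !mxE.
  have m1 : measurable (ball (x 0%R ord0) r : set R) by exact: measurable_ball.
  have m2 : measurable (ball (col' ord0 x) r : set (borel 'rV[R]_k)).
    by apply: borel_open; exact: ball_open.
  apply: (etrans (@product_measure1E _ _ _ _ R (@lebesgue_measure R) lam _ _ m1 m2)).
  by rewrite [X in _ * X](lamB _ _ r0) [X in X * _]lebesgue_measure_ball ?ltW// exprS EFinM.
have sf : sigma_finite [set: borel 'rV[R]_k.+1] mM.
  exists (fun n => ball (0%R : 'rV[R]_k.+1) n.+1%:R).
    apply/seteqP; split=> // x _; exists (Num.bound `|x : 'rV[R]_k.+1|) => //.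
    rewrite -ball_normE /ball_ /= sub0r normrN.
    by apply: (lt_trans (archi_boundP (normr_ge0 _))); rewrite ltr_nat.
  move=> n; split; first by apply: borel_open; exact: ball_open.
  by rewrite [X in X < _](mmB 0%R n.+1%:R)// ltry.
pose mS := Measure_isSigmaFinite.Build _ _ _ mM sf.
pose mSF : {sigma_finite_measure set (borel 'rV[R]_k.+1) -> \bar R} := HB.pack (mM : set _ -> _) mM mS.
by exists mSF.
Qed.

Definition lam k := sval (cid (exists_lam k)).

Lemma lamI k (f : borel 'rV[R]_k -> \bar R) : measurable_fun [set: borel 'rV[R]_k] f ->
  (forall x, 0 <= f x) -> \int[lam k]_x f x = integral_rV f.
Proof. by rewrite /lam; case: cid => l /= [H _]; exact: H. Qed.

Lemma lam_ball k (x : 'rV[R]_k) (r : R) : (0 < r)%R ->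
  lam k (ball x r) = ((r *+ 2) ^+ k)%:E.
Proof. by rewrite /lam; case: cid => l /= [_ H]; exact: H. Qed.

Lemma measurable_pairr d1 d2 (T1 : measurableType d1) (T2 : measurableType d2) (x : T1) :
  measurable_fun [set: T2] (fun y : T2 => (x, y)).
Proof. exact: (measurable_fun_pair (measurable_cst _) (@measurable_id _ _ _)). Qed.

Lemma integral_lam0 k (f : borel 'rV[R]_k.+1 -> \bar R) :
  measurable_fun [set: borel 'rV[R]_k.+1] f -> (forall x, 0 <= f x) ->
  \int[lam k.+1]_x f x = \int[@lebesgue_measure R]_t \int[lam k]_y f (insr ord0 t y).
Proof.
move=> mf f0; rewrite lamI//=; apply: eq_integral => t _.
rewrite -lamI//; last first.
  exact: (measurableT_comp mf (measurableT_comp (@measurable_consr k) (@measurable_pairr _ _ R (borel 'rV[R]_k) t))).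
by apply: eq_integral => y _; rewrite -consrE.
Qed.

Lemma measurable_swap_insr k (i : 'I_k.+1) : measurable_fun [set: borel 'rV[R]_k * R]
  (fun p : borel 'rV[R]_k * R => insr i p.2 p.1 : borel 'rV[R]_k.+1).
Proof. exact: (measurableT_comp (measurable_insr i) (@measurable_swap _ _ _ _)). Qed.

(** Tonelli for the first coordinate. For another [i], the first coordinate is peeled off on both
    sides and [insr_insr] commutes the two insertions. *)
Lemma integral_insr k (i : 'I_k.+1) (f : borel 'rV[R]_k.+1 -> \bar R) :
  measurable_fun [set: borel 'rV[R]_k.+1] f -> (forall x, 0 <= f x) ->
  \int[lam k.+1]_x f x = \int[lam k]_y \int[@lebesgue_measure R]_t f (insr i t y).
Proof.
elim: k i f => [|k IH] i f mf f0; case: (unliftP ord0 i) => [i' ->|->]; first by case: i'.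
- rewrite integral_lam0//.
  have mc := measurableT_comp mf (@measurable_insr 0 ord0).
  exact: (@fubini_tonelli _ _ _ (borel 'rV[R]_0) R (@lebesgue_measure R) (lam 0) _ mc (fun x => f0 _)).
- rewrite integral_lam0//.
  have mh : measurable_fun [set: borel 'rV[R]_k.+1]
      (fun w : borel 'rV[R]_k.+1 => \int[@lebesgue_measure R]_t f (insr (lift ord0 i') t w)).
    have mc := measurableT_comp mf (measurable_swap_insr (lift ord0 i')).
    exact: (@measurable_fun_fubini_tonelli_F _ _ _ _ R (@lebesgue_measure R) _ mc (fun x => f0 _)).
  rewrite integral_lam0//; last by move=> w; apply: integral_ge0 => t _; exact: f0.
  apply: eq_integral => s _; rewrite (IH i')//; last first.
    exact: (measurableT_comp mf (measurableT_comp (measurable_insr ord0) (@measurable_pairr _ _ R (borel 'rV[R]_k.+1) s))).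
  apply: eq_integral => y _; apply: eq_integral => t _; by rewrite insr_insr.
- rewrite integral_lam0//.
  have mc := measurableT_comp mf (@measurable_insr k.+1 ord0).
  exact: (@fubini_tonelli _ _ _ (borel 'rV[R]_k.+1) R (@lebesgue_measure R) (lam k.+1) _ mc (fun x => f0 _)).
Qed.

(** The same fact as an equality of measures, so that Fubini applies to signed integrands as
    well. *)
Lemma lamE k (i : 'I_k.+1) (A : set (borel 'rV[R]_k.+1)) : measurable A ->
  lam k.+1 A = pushforward (lam k \x @lebesgue_measure R)
    (fun p : borel 'rV[R]_k * R => insr i p.2 p.1 : borel 'rV[R]_k.+1) A.
Proof.
move=> mA; have mi : measurable_fun [set: borel 'rV[R]_k.+1] (fun x => (\1_A x)%:E : \bar R).
  by apply/measurable_EFinP; exact: measurable_indic.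
have := integral_insr i mi (fun x => _); rewrite integral_indic// setIT => ->; last first.
  by move=> x; rewrite lee_fin.
rewrite /pushforward /product_measure1; apply: eq_integral => y _ /=.
have mx : measurable (xsection ((fun p : borel 'rV[R]_k * R => insr i p.2 p.1 : borel 'rV[R]_k.+1) @^-1` A) y).
  apply: measurable_xsection; rewrite -[X in measurable X]setTI.
  exact: measurable_swap_insr.
have e := integral_indic (@lebesgue_measure R) measurableT mx.
rewrite setIT in e; rewrite -e; apply: eq_integral => s _; congr (_%:E).
rewrite !indicE; congr (_%:R); congr nat_of_bool; apply/idP/idP => /set_mem H; apply/mem_set.
  by apply/mem_set.
exact: set_mem H.
Qed.

End Borel.

Section Lambda.
Context {R : realType}.
Local Notation leb := (@lebesgue_measure R).

Lemma integral_half_line (v dv : R -> R) (B c : R) :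
  (forall t : R, is_derive t 1 v (dv t)) -> continuous dv -> (forall t, B <= `|t| -> v t = 0) ->
  (\int[leb]_t (if t < c then dv t else 0)%:E = (v c)%:E)%E.
Proof.
(* [a] lies to the left of [c] and of the support, so the half-line may be replaced by the interval
   from [a] to [c]. *)
move=> hv cdv v0; pose a : R := Num.min (- `|B| - 1) (c - 1).
have ac : a < c by rewrite /a gt_min orbC ltrBlDr ltrDl ltr01.
have aB : a < - `|B| by rewrite /a gt_min ltrBlDr ltrDl ltr01.
have BB := ler_norm B.
have v0' t : t <= - `|B| -> v t = 0.
  move=> tB; apply: v0; rewrite ler0_norm; first by rewrite (le_trans BB)// lerNr.
  by rewrite (le_trans tB)// oppr_le0.
have dv0 t : t < - `|B| -> dv t = 0.
  move=> ta; have [_ <-] := hv t.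
  rewrite -(derive_cst (0 : R) t 1); apply: near_eq_derive.
  near=> s; apply: v0'; apply: ltW; near: s; exact: lt_nbhsl.
have cv : continuous v.
  move=> t; apply: differentiable_continuous; apply/derivable1_diffP.
  by have [] := hv t.
have mdv : measurable_fun [set: R] dv by exact: continuous_measurable_fun.
rewrite -[RHS]sube0 -[X in (_ - X)%E](_ : (v a)%:E = 0%E); last by rewrite v0'// ltW.
rewrite -(@continuous_FTC2 _ dv v a c ac); first last.
- by move=> t _; rewrite derive1E; have [] := hv t.
- split; first by move=> t _; have [] := hv t.
    exact: cvg_at_right_filter (cv a).
  exact: cvg_at_left_filter (cv c).
- exact: continuous_subspaceT.
rewrite -integral_itv_bndo_bndc; last first.
  by apply/measurable_EFinP; exact: measurable_funTS.
rewrite [RHS]integral_mkcond; apply: eq_integral => t _; rewrite patchE mem_setE in_itv /=.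
case: ltP => tc; last by rewrite andbF.
rewrite andbT; case: leP => // ta; rewrite dv0//.
exact: lt_trans ta aB.
Unshelve. all: by end_near. Qed.

Lemma integral_insr_signed k (i : 'I_k.+1) (f : borel 'rV[R]_k.+1 -> \bar R) :
  (lam k.+1).-integrable [set: borel 'rV[R]_k.+1] f ->
  (\int[lam k.+1]_x f x = \int[lam k]_y \int[leb]_t f (insr i t y))%E.
Proof.
move=> /integrableP[mf intf].
pose q (p : borel 'rV[R]_k * measurableTypeR R) : borel 'rV[R]_k.+1 := insr i p.2 p.1.
have mq : measurable_fun [set: borel 'rV[R]_k * measurableTypeR R] q := measurable_swap_insr i.
have mfq : measurable_fun [set: borel 'rV[R]_k * measurableTypeR R] (f \o q) by exact: measurableT_comp.
pose pm := (lam k \x leb)%E.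
have intfq : (pm).-integrable [set: borel 'rV[R]_k * measurableTypeR R] (f \o q).
  apply/integrableP; split=> //.
  have ma : measurable_fun [set: borel 'rV[R]_k * measurableTypeR R] (fun p => `|(f \o q) p|%E).
    exact: measurableT_comp.
  rewrite (@fubini_tonelli1 _ _ _ _ R (lam k) leb _ ma (fun p => abse_ge0 _)).
  rewrite /fubini_F -(@integral_insr R k i (fun x => `|f x|%E))//.
  exact: measurableT_comp.
have E1 : (\int[lam k.+1]_x f x = \int[pushforward pm q]_x f x)%E.
  by apply: eq_measure_integral => A mA _; exact: lamE.
apply: (etrans E1).
apply: (etrans (@integral_pushforward _ _ _ _ R q mq _ _ f mf intfq measurableT)).
by rewrite -(@integral12_prod_meas1 _ _ _ _ R (lam k) leb _ intfq).
Qed.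

Lemma bounded_support_integrable k (h : 'rV[R]_k -> R) (C B : R) :
  measurable_fun [set: borel 'rV[R]_k] (h : borel 'rV[R]_k -> R) ->
  (forall x, `|h x| <= C) -> (forall x, B <= `|x| -> h x = 0) ->
  (lam k).-integrable [set: borel 'rV[R]_k] (EFin \o h).
Proof.
move=> mh hC h0; pose A : set (borel 'rV[R]_k) := ball (0 : 'rV[R]_k) (`|B| + 1).
have B1 : 0 < `|B| + 1 by rewrite ltr_wpDl.
have mA : measurable A by apply: borel_open; exact: ball_open.
have -> : EFin \o h = (EFin \o h) \_ A.
  apply/funext => x; rewrite patchE; case: ifPn => // /negP xA /=.
  rewrite h0//; rewrite leNgt; apply/negP => xB; apply: xA; apply/mem_set.
  rewrite /A -ball_normE /ball_ /= sub0r normrN; apply: (lt_trans xB).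
  by rewrite (le_lt_trans (ler_norm B))// ltrDl.
have intA : (lam k).-integrable A (EFin \o h); last exact: (integrable_mkcond _ mA).1 intA.
apply: measurable_bounded_integrable => //.
- by rewrite [X in (X < _)%E](lam_ball _ B1) ltry.
- exact: measurable_funTS.
- exists C; split; first exact: num_real.
  by move=> x Cx y _; exact: le_trans (hC y) (ltW Cx).
Qed.

Lemma insr_line k (j : 'I_k.+1) (t : R) (y : 'rV[R]_k) :
  insr j t y = insr j 0 y + t *: delta_mx 0 j.
Proof.
apply/rowP => l; rewrite !mxE; case: unliftP => [l' ->|->].
  by rewrite eqxx [lift j l' == j]eq_sym (negPf (neq_lift _ _)) mulr0 addr0.
by rewrite !eqxx mulr1 add0r.
Qed.

Lemma row_norm_entry k (x : 'rV[R]_k) j : `|x 0 j| <= `|x|.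
Proof.
by have := row_normE x (normr_ge0 x); rewrite lexx => /esym/forallP; exact.
Qed.

Lemma insr_norm k (j : 'I_k.+1) (t : R) (y : 'rV[R]_k) : `|t| <= `|insr j t y|.
Proof. by rewrite -{1}(insr_id j t y); exact: row_norm_entry. Qed.

Lemma borel_continuousT k (h : 'rV[R]_k -> R) : continuous h ->
  measurable_fun [set: borel 'rV[R]_k] (h : borel 'rV[R]_k -> R).
Proof. by move=> ch; apply: borel_continuous => [|x _]; [exact: openT|exact: ch]. Qed.

Lemma bounded_support k (h : 'rV[R]_k -> R) (B : R) : continuous h ->
  (forall x, B <= `|x| -> h x = 0) -> exists C : R, forall x, `|h x| <= C.
Proof.
move=> ch h0; pose K : set 'rV[R]_k := [set x | `|x| <= `|B| + 1].
have B1 : 0 < `|B| + 1 by rewrite ltr_wpDl.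
have cK : compact K.
  apply: bounded_closed_compact.
    exists (`|B| + 1); split; first exact: num_real.
    by move=> M BM x Kx; exact: le_trans Kx (ltW BM).
  by apply: (@preimage_closed _ _ _ [set t | t <= `|B| + 1]); [move=> x _; exact: norm_continuous|exact: closed_le].
have [C [_ HC]] := compact_bounded (continuous_compact (continuous_subspaceT ch) cK).
exists (`|C| + 1) => x; have [xK|xK] := pselect (K x).
  by apply: (HC _ _ (h x)); [rewrite (le_lt_trans (ler_norm C))// ltrDl|exists x].
rewrite h0 ?normr0 ?addr_ge0// leNgt; apply/negP => xB; apply: xK.
by rewrite /K /=; apply: (le_trans (ltW xB)); rewrite (le_trans (ler_norm B))// lerDl.
Qed.

(** The radius grows to [B + 1] so that [v] vanishes on a whole neighbourhood of [x]. *)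
Lemma derive_support k (v : 'rV[R]_k -> R) (B : R) w : (forall x, B <= `|x| -> v x = 0) ->
  forall x, B + 1 <= `|x| -> 'D_w v x = 0.
Proof.
move=> v0 x Bx; rewrite -(derive_cst (0 : R) x w); apply: near_eq_derive.
near=> y; apply: v0; apply: ltW; near: y.
have : B < `|x| by rewrite (lt_le_trans _ Bx)// ltrDl.
by move=> xB; exact: (@norm_continuous _ _ x _ (lt_nbhsr xB)).
Unshelve. all: by end_near. Qed.

Section HalfSpace.
Variables (k : nat) (v : 'rV[R]_k.+1 -> R) (B : R).
Hypotheses (Cv : C1_on [set: 'rV[R]_k.+1] v) (v0 : forall x, B <= `|x| -> v x = 0).

Lemma half_space_integrable (i j : 'I_k.+1) (c : R) :
  (lam k.+1).-integrable [set: borel 'rV[R]_k.+1]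
    (fun x => (if (x : 'rV[R]_k.+1) 0 i < c then 'D_(delta_mx 0 j) v x else 0)%:E).
Proof.
have cD : continuous ('D_(delta_mx 0 j) v) by move=> x; exact: (Cv.2 _ x I).
have [C HC] := bounded_support cD (@derive_support _ _ _ _ v0).
pose h (x : 'rV[R]_k.+1) : R := if x 0 i < c then 'D_(delta_mx 0 j) v x else 0.
apply: (@bounded_support_integrable k.+1 h C (B + 1)).
- apply: measurable_fun_ifT; [|exact: borel_continuousT|exact: measurable_cst].
  exact: (measurable_fun_ltr (measurable_coord i) (measurable_cst c)).
- move=> x; rewrite /h; case: ifP => // _; rewrite normr0.
  exact: le_trans (normr_ge0 _) (HC x).
- by move=> x xB; rewrite /h; case: ifP => // _; exact: derive_support v0 _ xB.
Qed.

Lemma line_integral (j : 'I_k.+1) (c : R) y :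
  (\int[leb]_t (if t < c then 'D_(delta_mx 0 j) v (insr j t y) else 0)%:E =
  (v (insr j c y))%:E)%E.
Proof.
pose w t := v (insr j 0 y + t *: delta_mx 0 j).
have dw (t : R) : is_derive t 1 w ('D_(delta_mx 0 j) v (insr j t y)).
  rewrite insr_line; apply: is_derive_line; apply: diff_derivable; exact: (Cv.1 _ I).
rewrite (@integral_half_line w _ B c dw) /w -?insr_line//.
- have e : (fun t => 'D_(delta_mx 0 j) v (insr j t y)) =
      ('D_(delta_mx 0 j) v) \o (fun t : R => insr j 0 y + t *: delta_mx 0 j).
    by apply/funext => t /=; rewrite -insr_line.
  rewrite e => t; apply: continuous_comp; last exact: (Cv.2 _ _ I).
  by apply: cvgD; [exact: cvg_cst|apply: cvgZr_tmp; exact: cvg_id].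
- by move=> t Bt; rewrite -insr_line v0// (le_trans Bt)// insr_norm.
Qed.

(** The divergence theorem for a half-space, one component at a time. Lines in direction [i] end on
    the face and leave its value there; lines in another direction stay inside or outside, and a
    derivative of bounded support integrates to 0 along them. *)
Lemma half_space_integral (i j : 'I_k.+1) (c : R) :
  (\int[lam k.+1]_x (if (x : 'rV[R]_k.+1) 0 i < c then 'D_(delta_mx 0 j) v x else 0)%:E =
  if j == i then \int[lam k]_y (v (insr i c y))%:E else 0)%E.
Proof.
rewrite (integral_insr_signed j (half_space_integrable i j c)).
have [->|ji] := eqVneq j i.
  by apply: eq_integral => y _; rewrite -line_integral; apply: eq_integral => t _; rewrite insr_id.
apply: integral0_eq => y _.
have [l il] : exists l, i = lift j l.
  by case: (unliftP j i) => [l ->|e]; [exists l|rewrite e eqxx in ji].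
have e t : insr j t y 0 i = y 0 l by rewrite il insr_lift.
have [yc|yc] := boolP (y 0 l < c); last first.
  by apply: integral0_eq => t _; rewrite e (negPf yc).
(* Beyond the support of [v] and of its derivatives, so that cutting the line at [c'] loses nothing
   and [v] vanishes at the cut. *)
pose c' := `|B| + 1 + 1.
have c'1 : B <= `|c'|.
  rewrite ger0_norm ?addr_ge0// /c' -addrA; apply: le_trans (ler_norm B) _.
  by rewrite lerDl addr_ge0.
rewrite -[RHS](_ : (v (insr j c' y))%:E = 0%E); last first.
  by rewrite v0// (le_trans c'1)// insr_norm.
rewrite -line_integral; apply: eq_integral => t _; rewrite e yc; case: ltP => // tc.
rewrite (derive_support _ v0)//; apply: le_trans (insr_norm j t y).
apply: le_trans (ler_norm t); apply: le_trans tc.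
by rewrite /c' lerD2r (le_trans (ler_norm B))// lerDl.
Qed.

End HalfSpace.

End Lambda.

(** * Integration against a measure given by a density in a parametrisation *)

Section Transfer.
Context d1 d2 (T1 : measurableType d1) (T2 : measurableType d2) (R : realType).
Variables (mu : {measure set T1 -> \bar R}) (la : {measure set T2 -> \bar R}).
Variables (E : set T1) (P : set T2) (c : T2 -> T1) (rho : T2 -> R).
Hypotheses (mE : measurable E) (mP : measurable P) (mc : measurable_fun P c).
Hypotheses (cP : forall y, P y -> E (c y)) (mrho : measurable_fun P rho).
Hypothesis rho0 : forall y, P y -> 0 <= rho y.
Hypothesis muE : forall A, measurable A -> A `<=` E ->
  (mu A = \int[la]_(y in P) (\1_A (c y) * rho y)%:E)%E.

Import HBNNSimple.

Let comp_meas (f : T1 -> R) : measurable_fun E f -> measurable_fun P (f \o c).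
Proof.
by move=> mf; apply: (measurable_comp mE) => // _ [y Py <-]; exact: cP.
Qed.

(** Volume and area are specified by their values on sets. Simple functions, then monotone limits,
    then positive and negative parts extend the density formula to integrals. *)
Lemma transfer_nnsfun (h : {nnsfun T1 >-> R}) :
  (\int[mu]_(x in E) (h x)%:E = \int[la]_(y in P) (h (c y) * rho y)%:E)%E.
Proof.
have mh r : measurable (h @^-1` [set r]) by exact: measurable_funPTI.
have m1 r : measurable_fun P (fun y => \1_(h @^-1` [set r]) (c y) : R).
  by apply: (@comp_meas (\1_(h @^-1` [set r]))); exact: measurable_indic.
have m2 r : measurable_fun P (fun y => r * (\1_(h @^-1` [set r]) (c y) * rho y)).
  by apply: measurable_funM => //; exact: measurable_funM.
have g0 r y : P y -> (0 <= (r * (\1_(h @^-1` [set r]) (c y) * rho y))%:E)%E.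
  move=> Py; rewrite lee_fin mulrA; apply: mulr_ge0; last exact: rho0.
  by have := nnfun_muleindic_ge0 h r (c y); rewrite -EFinM lee_fin.
transitivity (\sum_(r \in range h) \int[mu]_(x in E) (r * \1_(h @^-1` [set r]) x)%:E)%E.
  under eq_integral do rewrite fimfunE -fsumEFin//.
  rewrite ge0_integral_fsum//.
    by move=> r; exact/measurable_EFinP/measurable_funM.
  by move=> r x _; rewrite EFinM nnfun_muleindic_ge0.
transitivity (\sum_(r \in range h) \int[la]_(y in P) (r * (\1_(h @^-1` [set r]) (c y) * rho y))%:E)%E.
  apply: eq_fsbigr => r /[!inE] -[x0 _ hr].
  have r0 : 0 <= r by rewrite -hr.
  rewrite integralZl_indic_nnsfun// integral_indic// setIC muE//.
  under [in RHS]eq_integral do rewrite EFinM.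
  rewrite ge0_integralZl//.
  - congr (_ * _)%E; apply: eq_integral => y /[!inE] Py; congr ((_ * _)%:E).
    by rewrite indicI /= [X in X * _]indicE mem_set ?mul1r//; exact: cP.
  - by apply/measurable_EFinP; exact: measurable_funM.
  - by move=> y Py; rewrite lee_fin mulr_ge0// rho0.
rewrite -ge0_integral_fsum//.
- apply: eq_integral => y _; rewrite fsumEFin//; congr (_%:E).
  rewrite {1}(fimfunE h (c y)) mulr_fsuml//.
  by apply: eq_fsbigr => r _; rewrite mulrA.
- by move=> r; apply/measurable_EFinP.
Qed.

Lemma transfer_ge0 (f : T1 -> R) : measurable_fun E f -> (forall x, E x -> 0 <= f x) ->
  (\int[mu]_(x in E) (f x)%:E = \int[la]_(y in P) (f (c y) * rho y)%:E)%E.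
Proof.
move=> mf f0; have mf' : measurable_fun E (EFin \o f) by exact/measurable_EFinP.
pose f_ := nnsfun_approx mE mf'.
have f0' x : E x -> (0 <= (EFin \o f) x)%E by move=> Ex; rewrite lee_fin f0.
transitivity (limn (fun n => \int[mu]_(x in E) (f_ n x)%:E)%E).
  rewrite -monotone_convergence//.
  - apply: eq_integral => y /[!inE] yD; apply/esym/cvg_lim => //.
    exact: (cvg_nnsfun_approx mE mf' f0' yD).
  - by move=> n; exact/measurable_EFinP/measurable_funP.
  - by move=> n y _; rewrite lee_fin.
  - by move=> y _ m n mn; rewrite lee_fin; exact/lefP/nd_nnsfun_approx.
under eq_fun do rewrite transfer_nnsfun.
rewrite -monotone_convergence//.
- apply: eq_integral => y /[!inE] Py; apply/cvg_lim => //=.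
  under eq_fun do rewrite EFinM muleC.
  rewrite mulrC EFinM; apply: cvgeZl => //.
  exact: (cvg_nnsfun_approx mE mf' f0' (cP Py)).
- move=> n; apply/measurable_EFinP; apply: measurable_funM => //.
  by apply: comp_meas; exact: measurable_funTS.
- by move=> n y Py; rewrite lee_fin mulr_ge0// rho0.
- move=> y Py m n mn; rewrite lee_fin ler_wpM2r ?rho0//.
  by have /lefP/(_ (c y)) := nd_nnsfun_approx mE mf' mn.
Qed.

Lemma transfer (f : T1 -> R) : measurable_fun E f ->
  la.-integrable P (fun y => (f (c y) * rho y)%:E) ->
  mu.-integrable E (EFin \o f) /\
  (\int[mu]_(x in E) (f x)%:E = \int[la]_(y in P) (f (c y) * rho y)%:E)%E.
Proof.
move=> mf /integrableP[mfc fin]; split.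
  apply/integrableP; split; first exact/measurable_EFinP.
  have e : (\int[mu]_(x in E) `|(EFin \o f) x| = \int[mu]_(x in E) (`|f x|)%:E)%E by [].
  rewrite e (transfer_ge0 (f := fun x => `|f x|))//; last exact: measurableT_comp.
  rewrite (eq_integral (fun y => `|(f (c y) * rho y)%:E|%E))//.
  by move=> y /[!inE] Py /=; rewrite normrM (ger0_norm (rho0 Py)).
rewrite [LHS]integralE [RHS]integralE; congr (_ - _)%E.
  rewrite (eq_integral (fun x => (Num.max (f x) 0)%:E)).
    rewrite (transfer_ge0 (f := fun x => Num.max (f x) 0)).
    - apply: eq_integral => y /[!inE] Py; rewrite funeposE -EFin_max; congr (_%:E).
      by rewrite maxr_pMl ?mul0r// rho0.
    - exact: measurable_maxr.
    - by move=> x _; rewrite le_max lexx orbT.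
  by move=> x _; rewrite funeposE -EFin_max.
rewrite (eq_integral (fun x => (Num.max (- f x) 0)%:E)).
  rewrite (transfer_ge0 (f := fun x => Num.max (- f x) 0)).
  - apply: eq_integral => y /[!inE] Py; rewrite funenegE -EFinN -EFin_max; congr (_%:E).
    by rewrite maxr_pMl ?mul0r ?mulNr// rho0.
  - by apply: measurable_maxr => //; exact: measurableT_comp.
  - by move=> x _; rewrite le_max lexx orbT.
by move=> x _; rewrite funenegE -EFinN -EFin_max.
Qed.

End Transfer.

(** * Local theory of immersions *)

Section C1_matrix.
Context {R : realType} {a : nat}.
Variables (U : set 'rV[R]_a) (oU : open U).

Definition C1m p q (A : 'rV[R]_a -> 'M[R]_(p, q)) : Prop :=
  forall i j, C1_on U (fun x => A x i j).

Lemma C1m_ext p q (A B : 'rV[R]_a -> 'M[R]_(p, q)) :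
  (forall x, U x -> A x = B x) -> C1m B -> C1m A.
Proof.
by move=> AB CB i j; apply: C1_on_eq (CB i j) => // x; rewrite inE => /AB ->.
Qed.

Lemma C1m_cst p q (A : 'M[R]_(p, q)) : C1m (fun=> A).
Proof. by move=> i j; exact: C1_on_cst. Qed.

Lemma C1mD p q (A B : 'rV[R]_a -> 'M[R]_(p, q)) : C1m A -> C1m B ->
  C1m (fun x => A x + B x).
Proof. by move=> CA CB i j; under eq_fun do rewrite mxE; exact: (C1_onD oU (CA i j) (CB i j)). Qed.

Lemma C1mN p q (A : 'rV[R]_a -> 'M[R]_(p, q)) : C1m A -> C1m (fun x => - A x).
Proof. by move=> CA i j; under eq_fun do rewrite mxE; exact: (C1_onN oU (CA i j)). Qed.

Lemma C1mB p q (A B : 'rV[R]_a -> 'M[R]_(p, q)) : C1m A -> C1m B ->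
  C1m (fun x => A x - B x).
Proof. by move=> CA CB; exact: (C1mD CA (C1mN CB)). Qed.

Lemma C1mZ p q (c : 'rV[R]_a -> R) (A : 'rV[R]_a -> 'M[R]_(p, q)) : C1_on U c ->
  C1m A -> C1m (fun x => c x *: A x).
Proof. by move=> Cc CA i j; under eq_fun do rewrite mxE; exact: (C1_onM oU Cc (CA i j)). Qed.

Lemma C1m_mul p q r (A : 'rV[R]_a -> 'M[R]_(p, q)) (B : 'rV[R]_a -> 'M[R]_(q, r)) :
  C1m A -> C1m B -> C1m (fun x => A x *m B x).
Proof. by move=> CA CB; exact: (C1_on_mulmx oU CA CB). Qed.

Lemma C1m_tr p q (A : 'rV[R]_a -> 'M[R]_(p, q)) : C1m A -> C1m (fun x => (A x)^T).
Proof. by move=> CA i j; under eq_fun do rewrite mxE; exact: CA. Qed.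

Lemma C1m_inv p (A : 'rV[R]_a -> 'M[R]_p) : (forall x, U x -> A x \in unitmx) ->
  C1m A -> C1m (fun x => invmx (A x)).
Proof. by move=> uA CA; exact: C1_on_invmx. Qed.

Lemma C1m_sum p q n (A : 'I_n -> 'rV[R]_a -> 'M[R]_(p, q)) : (forall l, C1m (A l)) ->
  C1m (fun x => \sum_l A l x).
Proof.
move=> CA i j; under eq_fun do rewrite summxE.
exact: (C1_on_sum _ oU (fun l (_ : xpredT l) => CA l i j)).
Qed.

Lemma C1m_set_row p q (A : 'rV[R]_a -> 'M[R]_(p, q)) w i : C1m A -> C1m w ->
  C1m (fun x => set_row (A x) i (w x)).
Proof.
move=> CA Cw l j; under eq_fun do rewrite mxE.
by case: eqP => _; [exact: Cw|exact: CA].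
Qed.

Lemma C1_on_ip k (G : 'rV[R]_a -> 'M[R]_k) X Y : C1m G -> C1m X -> C1m Y ->
  C1_on U (fun x => ip (G x) (X x) (Y x)).
Proof. by move=> CG CX CY; exact: (C1m_mul (C1m_mul CX CG) (C1m_tr CY)). Qed.

Lemma C1m_differentiable p q (A : 'rV[R]_a -> 'M[R]_(p, q)) x : C1m A -> U x ->
  differentiable A x.
Proof. by move=> CA Ux; apply: entry_differentiable => i j; apply: (CA i j).1. Qed.

Lemma smooth_on_C1m p q (A : 'rV[R]_a -> 'M[R]_(p, q)) : smooth_on U A -> C1m A.
Proof. by move=> sA i j; exact: smooth_on_entry. Qed.

End C1_matrix.

Section NormalPart.
Context {R : realType} {m k : nat}.
Variables (J : 'M[R]_(m, k)) (G : 'M[R]_k).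
Hypothesis pg : posdef (J *m G *m J^T).

Definition nrm (w : 'rV[R]_k) := w - w *m G *m J^T *m invmx (J *m G *m J^T) *m J.

Let ug : J *m G *m J^T \in unitmx. Proof. exact: posdef_unit. Qed.

Lemma nrm_normal w : nrm w *m G *m J^T = 0.
Proof.
rewrite /nrm !mulmxBl -[X in _ - X *m _]mulmxA -[X in _ - X]mulmxA.
by rewrite mulmxKV// subrr.
Qed.

Lemma nrm_tangent c : nrm (c *m J) = 0.
Proof. by rewrite /nrm -(mulmxA c J G) -(mulmxA c) mulmxK// subrr. Qed.

Lemma nrm_eq0 w : nrm w = 0 -> w = w *m G *m J^T *m invmx (J *m G *m J^T) *m J.
Proof. by move=> /eqP; rewrite subr_eq0 => /eqP. Qed.

Lemma nrmD w w' : nrm (w + w') = nrm w + nrm w'.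
Proof. by rewrite /nrm !mulmxDl opprD addrACA. Qed.

Lemma nrm_ip w h : G^T = G -> h *m G *m J^T = 0 -> ip G (nrm w) h = ip G w h.
Proof.
move=> GT e; rewrite /nrm ipDl ipNl [X in _ - X](_ : _ = 0) ?subr0//.
rewrite (ipC _ _ GT) /ip trmx_mul !mulmxA.
by rewrite e !mul0mx mxE.
Qed.

End NormalPart.

Section Local.
Context {R : realType} {m k : nat}.
Variables (f : 'rV[R]_m -> 'rV[R]_k) (G : 'rV[R]_k -> 'M[R]_k) (gM : 'rV[R]_m -> 'M[R]_m).

(** [nab], [npart], [sff] and [mc] restate covariant derivative, normal part, second fundamental
    form and mean curvature for functions on open sets of row vectors; [mean_curvE] identifies [mc]
    with [mean_curv] by conversion. *)
Definition nab (W : 'rV[R]_m -> 'rV[R]_k) v x : 'rV[R]_k :=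
  'D_v W x + chr G (f x) ('D_v f x) (W x).

Definition npart x w := nrm ('J f x) (G (f x)) w.

Definition sff x v w := npart x (nab (fun y => 'D_w f y) v x).

Definition mc x : 'rV[R]_k :=
  m%:R^-1 *: \sum_(i < m) \sum_(j < m)
    invmx (gM x) i j *: sff x (delta_mx 0 i) (delta_mx 0 j).

(** What a pair of charts provides, so that the calculus can be done without manifolds. [U] and [V]
    are parameters because they are shrunk to chart overlaps. *)
Record local_immersion (U : set 'rV[R]_m) (V : set 'rV[R]_k) : Prop := LocalImmersion {
  li_oU : open U;
  li_oV : open V;
  li_UV : forall x, U x -> V (f x);
  li_f : smooth_on U f;
  li_G : smooth_on V G;
  li_pos : forall y, V y -> posdef (G y);
  li_g : forall x, U x -> gM x = 'J f x *m G (f x) *m ('J f x)^T;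
  li_free : forall x, U x -> row_free ('J f x)
}.

Variables (U : set 'rV[R]_m) (V : set 'rV[R]_k) (LI : local_immersion U V).

Let oU := li_oU LI.
Let oV := li_oV LI.

Lemma li_diff x : U x -> differentiable f x.
Proof. exact: smooth_on_differentiable (li_f LI). Qed.

Lemma li_diff2 x v : U x -> differentiable ('D_v f) x.
Proof. exact: smooth_on_differentiable (smooth_on_derive v (li_f LI)). Qed.

Lemma li_diffG y : V y -> differentiable G y.
Proof. exact: smooth_on_differentiable (li_G LI). Qed.

Lemma li_posx x : U x -> posdef (G (f x)).
Proof. by move=> Ux; apply: (li_pos LI); exact: (li_UV LI). Qed.

Lemma row_J x i : U x -> row i ('J f x) = 'D_(delta_mx 0 i) f x.
Proof. by move=> Ux; rewrite deriveEjacobian ?rowE//; exact: li_diff. Qed.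

Lemma li_gram x : U x -> posdef ('J f x *m G (f x) *m ('J f x)^T).
Proof. by move=> Ux; apply: posdef_gram; [exact: li_posx|exact: (li_free LI)]. Qed.

Lemma C1m_f : C1m U f. Proof. exact: (smooth_on_C1m oU (li_f LI)). Qed.

Lemma C1m_Df v : C1m U ('D_v f).
Proof. exact: (smooth_on_C1m oU (smooth_on_derive v (li_f LI))). Qed.

Lemma C1m_J : C1m U (fun x => 'J f x).
Proof.
apply: (@C1m_ext _ _ _ oU _ _ _ (fun x => \matrix_(i, j) 'D_(delta_mx 0 i) f x 0 j)).
  by move=> x Ux; apply/matrixP => i j; rewrite [RHS]mxE -row_J// [RHS]mxE.
by move=> i j; under eq_fun do rewrite mxE; exact: C1m_Df.
Qed.

Lemma C1m_comp p q (A : 'rV[R]_k -> 'M[R]_(p, q)) : C1m V A -> C1m U (fun x => A (f x)).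
Proof.
move=> CA i j; apply: (C1_on_comp oU (li_UV LI) _ (CA i j)) => l; exact: C1m_f.
Qed.

Lemma C1m_G : C1m U (fun x => G (f x)).
Proof. exact: C1m_comp (smooth_on_C1m oV (li_G LI)). Qed.

Lemma C1m_nrm (w : 'rV[R]_m -> 'rV[R]_k) : C1m U w -> C1m U (fun x => npart x (w x)).
Proof.
move=> Cw; have CJ := C1m_J; have CG := C1m_G.
have Cg := C1m_mul oU (C1m_mul oU CJ CG) (C1m_tr CJ).
have Ci := C1m_inv oU (fun x (Ux : U x) => posdef_unit (li_gram Ux)) Cg.
exact: (C1mB oU Cw (C1m_mul oU (C1m_mul oU (C1m_mul oU (C1m_mul oU Cw CG) (C1m_tr CJ)) Ci) CJ)).
Qed.

(** Read off from [koszul]. It reduces the regularity of the symbols at varying arguments to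
    constant ones. *)
Lemma chr_bilinear y v w : V y -> chr G y v w =
  \sum_i \sum_j (v 0 i * w 0 j) *: chr G y (delta_mx 0 i) (delta_mx 0 j).
Proof.
move=> Vy; have dG := li_diffG Vy; have pV := li_pos LI.
have K := koszul Vy dG pV.
have L v1 w1 n (c : 'I_n -> R) (u : 'I_n -> 'rV[R]_k) :
    v1 = \sum_i c i *: u i -> chr G y v1 w1 = \sum_i c i *: chr G y (u i) w1.
  move=> ->; apply: (ip_inj Vy pV) => z; rewrite ip_suml K (derive_dir_sum dG).
  have E1 : ip (\sum_i c i *: 'D_(u i) G y) w1 z = \sum_i c i * ip ('D_(u i) G y) w1 z.
    rewrite /ip mulmx_sumr mulmx_suml summxE; apply: eq_bigr => i _.
    by rewrite -scalemxAr -scalemxAl mxE.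
  have E2 A w2 : ip A (\sum_i c i *: u i) w2 = \sum_i c i * ip A (u i) w2.
    by rewrite ip_suml; apply: eq_bigr => i _; rewrite ipZl.
  rewrite E1 !E2 -big_split /= -sumrB mulr_sumr; apply: eq_bigr => i _.
  have alg (x d e c' : R) : 2^-1 * (x * d + x * e - x * c') = x * (2^-1 * (d + e - c')) by ring.
  exact: (etrans (alg _ _ _ _) (esym (etrans (ipZl _ _ _ _) (congr1 _ (K (u i) w1 z))))).
rewrite (L v w _ _ _ (row_sum_delta v)); apply: eq_bigr => i _.
rewrite (chr_sym oV Vy dG pV) (L w _ _ _ _ (row_sum_delta w)) scaler_sumr.
by apply: eq_bigr => j _; rewrite scalerA (chr_sym oV Vy dG pV).
Qed.

Lemma C1m_chr_cst v w : C1m V (fun y => chr G y v w).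
Proof.
have CG v0 : C1m V ('D_v0 G) := smooth_on_C1m oV (smooth_on_derive v0 (li_G LI)).
have CI : C1m V (fun y => invmx (G y)).
  apply: C1m_inv => //; last exact: smooth_on_C1m (li_G LI).
  by move=> y Vy; apply: posdef_unit; exact: (li_pos LI).
have CD v0 w0 z0 : C1_on V (fun y => ip ('D_v0 G y) w0 z0).
  exact: (C1_on_ip oV (CG v0) (C1m_cst V w0) (C1m_cst V z0)).
pose A y : 'rV[R]_k := \row_s (2^-1 * (ip ('D_v G y) w (delta_mx 0 s) +
   ip ('D_w G y) v (delta_mx 0 s) - ip ('D_(delta_mx 0 s) G y) v w)).
have CA : C1m V A.
  move=> i s; under eq_fun do rewrite mxE.
  exact: (C1_onM oV (C1_on_cst V _) (C1_onB oV (C1_onD oV (CD _ _ _) (CD _ _ _)) (CD _ _ _))).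
apply: (@C1m_ext _ _ _ oV _ _ _ (fun y => A y *m invmx (G y))); last exact: C1m_mul.
move=> y Vy; congr (_ *m _); apply/rowP => s; rewrite !mxE.
have D u w1 w2 : 'D_u (fun y => ip (G y) w1 w2 : R^o) y = ip ('D_u G y) w1 w2.
  by apply: derive_ip_cst; apply: diff_derivable; exact: li_diffG.
by rewrite !D.
Qed.

Lemma C1m_chr (v w : 'rV[R]_m -> 'rV[R]_k) : C1m U v -> C1m U w ->
  C1m U (fun x => chr G (f x) (v x) (w x)).
Proof.
move=> Cv Cw; apply: (@C1m_ext _ _ _ oU _ _ _ (fun x =>
  \sum_i \sum_j (v x 0 i * w x 0 j) *: chr G (f x) (delta_mx 0 i) (delta_mx 0 j))).
  by move=> x Ux; rewrite chr_bilinear//; exact: (li_UV LI).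
exact: (C1m_sum oU (fun i => C1m_sum oU (fun j =>
  C1mZ oU (C1_onM oU (Cv 0 i) (Cw 0 j)) (C1m_comp (C1m_chr_cst _ _))))).
Qed.

Lemma C1m_mc : C1m U mc.
Proof.
have Cg : C1m U gM.
  apply: (C1m_ext oU (li_g LI)).
  exact: (C1m_mul oU (C1m_mul oU C1m_J C1m_G) (C1m_tr C1m_J)).
have Ci : C1m U (fun x => invmx (gM x)).
  apply: C1m_inv => // x Ux; rewrite (li_g LI Ux).
  by apply: posdef_unit; exact: li_gram.
have Cs v w : C1m U (fun x => sff x v w).
  apply: C1m_nrm; apply: (C1mD oU); last exact: C1m_chr (C1m_Df _) (C1m_Df _).
  exact: (smooth_on_C1m oU (smooth_on_derive v (smooth_on_derive w (li_f LI)))).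
apply: (C1mZ oU (C1_on_cst U _)).
exact: (C1m_sum oU (fun i => C1m_sum oU (fun j => C1mZ oU (Ci i j) (Cs _ _)))).
Qed.

Lemma mc_normal x : U x -> mc x *m G (f x) *m ('J f x)^T = 0.
Proof.
move=> Ux; rewrite /mc -!scalemxAl !mulmx_suml big1 ?scaler0// => i _.
rewrite !mulmx_suml big1// => j _.
by rewrite -!scalemxAl nrm_normal ?scaler0//; exact: li_gram.
Qed.

Lemma nab_compat (X Y : 'rV[R]_m -> 'rV[R]_k) v x : U x ->
  derivable X x v -> derivable Y x v ->
  'D_v (fun y => ip (G (f y)) (X y) (Y y)) x =
  ip (G (f x)) (nab X v x) (Y x) + ip (G (f x)) (X x) (nab Y v x).
Proof.
move=> Ux dX dY; have Vf := li_UV LI Ux.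
have dGf : derivable (fun y => G (f y)) x v.
  apply: diff_derivable; apply: (@differentiable_comp _ _ _ _ f G); first exact: li_diff.
  exact: li_diffG.
have [_ ->] := derive_ip dGf dX dY.
rewrite (derive_comp v (li_diff Ux) (li_diffG Vf)).
rewrite (chr_compat oV Vf (li_diffG Vf) (li_pos LI)) /nab ipDl ipDr.
by set A := ip _ _ _; set B := ip _ _ _; set C := ip _ _ _; set D := ip _ _ _; ring.
Qed.

(** Combines the symmetry of the Christoffel symbols with that of second derivatives. *)
Lemma nab_sym v w x : U x -> nab ('D_w f) v x = nab ('D_v f) w x.
Proof.
move=> Ux; have Vf := li_UV LI Ux; rewrite /nab.
rewrite (chr_sym oV Vf (li_diffG Vf) (li_pos LI) ('D_v f x)).
suff -> : 'D_v ('D_w f) x = 'D_w ('D_v f) x by [].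
apply/rowP => j.
have E u y : U y -> 'D_u f y 0 j = 'D_u (fun z => f z 0 j) y.
  by move=> Uy; rewrite derive_entry//; apply: diff_derivable; exact: li_diff.
have near_E u u' : 'D_u ('D_u' f) x 0 j = 'D_u ('D_u' (fun z => f z 0 j)) x.
  rewrite (derive_entry _ _ (@diff_derivable _ _ _ _ _ u (li_diff2 u' Ux))).
  by apply: near_eq_derive; apply: near_open Ux _ => // y /E.
have CE u : C1_on U ('D_u (fun z => f z 0 j)).
  by apply: C1_on_eq (C1m_Df u 0 j) => // y; rewrite inE => /E.
apply: etrans (near_E v w) _; apply: etrans _ (esym (near_E w v)).
apply: (derive_comm oU Ux _ (CE w) (CE v)).
by move=> y Uy; apply: differentiable_entry; exact: li_diff.
Qed.

(** Pairing with the normal vector [mc] makes the normal projections invisible, so the trace is that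
    of plain covariant derivatives. *)
Lemma mc_norm x : U x -> m%:R * ip (G (f x)) (mc x) (mc x) =
  \sum_i \sum_j invmx (gM x) i j *
    ip (G (f x)) (nab ('D_(delta_mx 0 j) f) (delta_mx 0 i) x) (mc x).
Proof.
move=> Ux; have [GT _] := li_posx Ux.
have [m0|m0] := eqVneq m 0%N.
  rewrite (_ : m%:R = 0) ?mul0r; last by rewrite m0.
  by rewrite big1// => i _; move: (ltn_ord i); rewrite [X in (_ < X)%N]m0.
rewrite {1}/mc ipZl mulrA divff ?pnatr_eq0// mul1r ip_suml; apply: eq_bigr => i _.
rewrite ip_suml; apply: eq_bigr => j _; rewrite ipZl; congr (_ * _).
by apply: nrm_ip => //; exact: mc_normal.
Qed.

(** If [mc] is parallel, its covariant derivative is tangent, hence orthogonal to [mc]. *)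
Lemma mc_norm_cst x v : U x -> npart x (nab mc v x) = 0 ->
  'D_v (fun y => ip (G (f y)) (mc y) (mc y)) x = 0.
Proof.
move=> Ux H0; have dH : derivable mc x v.
  by apply: diff_derivable; exact: C1m_differentiable C1m_mc Ux.
have [GT _] := li_posx Ux.
rewrite nab_compat// [X in _ + X](ipC _ _ GT) (_ : ip _ _ _ = 0) ?addr0//.
rewrite (nrm_eq0 H0) (ipC _ _ GT) /ip trmx_mul mulmxA mc_normal//.
by rewrite mul0mx mxE.
Qed.

End Local.

(** * The divergence of the flux *)

Section Divergence.
Context {R : realType} {m k : nat}.
Variables (f : 'rV[R]_m -> 'rV[R]_k) (G : 'rV[R]_k -> 'M[R]_k) (gM : 'rV[R]_m -> 'M[R]_m).
Variables (U : set 'rV[R]_m) (V : set 'rV[R]_k) (LI : local_immersion f G gM U V).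
Variable Om : 'rV[R]_k -> 'M[R]_(m, k) -> R.
Hypothesis linO : forall y, V y -> multilinear_rows (Om y).
Hypothesis altO : forall y, V y -> alternating_rows (Om y).
Hypothesis CO : forall W, C1_on V (fun y => Om y W).
Hypothesis parO : forall y v W, V y ->
  'D_v (fun y => Om y W) y = \sum_i Om y (set_row W i (chr G y v (row i W))).

Local Notation H := (mc f G gM).
Local Notation J := (fun x => 'J f x).
Let oU := li_oU LI.

Let linf x (Ux : U x) : multilinear_rows (Om (f x)) := linO (li_UV LI Ux).
Let Cf W : C1_on U (fun x => Om (f x) W).
Proof. by apply: (C1_on_comp oU (li_UV LI) _ (CO W)) => j; exact: C1m_f LI 0 j. Qed.

Lemma form_C1 W : C1m U W -> C1_on U (fun x => Om (f x) (W x)).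
Proof. by move=> CW; have [] := multilinear_leibniz oU linf Cf CW. Qed.

(** Parallelism turns the derivative of the coefficients of the form into exactly the Christoffel
    terms that complete the covariant derivative of each row. *)
Lemma form_nab W v x : C1m U W -> U x ->
  'D_v (fun y => Om (f y) (W y)) x =
  \sum_a Om (f x) (set_row (W x) a
     (row a ('D_v W x) + chr G (f x) ('D_v f x) (row a (W x)))).
Proof.
move=> CW Ux; have [_ ->//] := multilinear_leibniz oU linf Cf CW.
have Vf := li_UV LI Ux.
have -> : 'D_v (fun y => Om (f y) (W x)) x = 'D_('D_v f x) (fun y => Om y (W x)) (f x).
  by apply: (derive_comp v (li_diff LI Ux)); apply: (CO (W x)).1.
rewrite parO// addrC -big_split /=; apply: eq_bigr => a _.
by rewrite (multilinearD (linf Ux)).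
Qed.

Lemma derive_row p q (A : 'rV[R]_m -> 'M[R]_(p, q)) v x i : derivable A x v ->
  row i ('D_v A x) = 'D_v (fun y => row i (A y)) x.
Proof.
move=> dA; apply/rowP => j; rewrite mxE derive_entry// derive_entry.
  by congr ('D_v _ x); apply/funext => y; rewrite mxE.
by apply/derivable_mxP => a b; under eq_fun do rewrite mxE; exact: derivable_entry.
Qed.

Definition flux i x := Om (f x) (set_row ('J f x) i (H x)).

Lemma flux_C1 i : C1_on U (flux i).
Proof. by apply: form_C1; exact: C1m_set_row (C1m_J LI) (C1m_mc LI). Qed.

Lemma divergence_flux x : U x -> (forall v, npart f G x (nab f G H v x) = 0) ->
  \sum_i 'D_(delta_mx 0 i) (flux i) x =
    - (m%:R * ip (G (f x)) (H x) (H x) * Om (f x) ('J f x)).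
Proof.
move=> Ux HP; have Vf := li_UV LI Ux; have [GT pG] := li_posx LI Ux.
pose W i y := set_row ('J f y) i (H y).
have CW i : C1m U (W i) by exact: C1m_set_row (C1m_J LI) (C1m_mc LI).
(* [S i a] is the covariant second derivative of [f]; [T i a] is the term of the i-th divergence
   component in which the row [a] of the Jacobian is differentiated. *)
pose S i a : 'rV[R]_k := nab f G ('D_(delta_mx 0 a) f) (delta_mx 0 i) x.
pose T i a := Om (f x) (set_row (W i x) a (S i a)).
have E i : 'D_(delta_mx 0 i) (flux i) x =
    Om (f x) (set_row ('J f x) i (nab f G H (delta_mx 0 i) x)) +
    \sum_a (if a == i then 0 else T i a).
  rewrite (form_nab _ (CW i) Ux) (bigD1 i)//= [in RHS](bigD1 i)//= eqxx add0r.
  have dW : derivable (W i) x (delta_mx 0 i).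
    by apply: diff_derivable; exact: C1m_differentiable (CW i) Ux.
  have e1 : row i ('D_(delta_mx 0 i) (W i) x) = 'D_(delta_mx 0 i) H x.
    apply: etrans (derive_row i dW) _; apply: near_eq_derive.
    by apply: near_open Ux _ => // y Uy; rewrite row_set_row.
  have e2 a : a != i -> row a ('D_(delta_mx 0 i) (W i) x) =
      'D_(delta_mx 0 i) ('D_(delta_mx 0 a) f) x.
    move=> ai; apply: etrans (derive_row a dW) _; apply: near_eq_derive.
    by apply: near_open Ux _ => // y Uy; rewrite row_set_row_neq// (row_J LI a Uy).
  apply: (f_equal2 +%R); first by rewrite e1 row_set_row set_row_set.
  apply: eq_bigr => a ai; rewrite (negbTE ai) /T (e2 a ai) (row_set_row_neq _ _ ai).
  by rewrite (row_J LI a Ux).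
have Ssym i a : S i a = S a i by exact: (nab_sym LI _ _ Ux).
have antisym i a : (if a == i then 0 else T i a) = - (if i == a then 0 else T a i).
  have [ai|ai] := eqVneq a i; first by rewrite oppr0.
  rewrite /T /W Ssym.
  rewrite (alternating_swap _ _ _ (linf Ux) (altO Vf)) 1?eq_sym//.
  by rewrite set_rowC// eq_sym.
(* Exchanging the slots [i] and [a] reverses the sign of the form but preserves [S], so the double
   sum equals its opposite. *)
have X0 : \sum_i \sum_a (if a == i then 0 else T i a) = 0.
  set X := LHS; have XN : X = - X.
    rewrite {1}/X exchange_big /= /X -sumrN; apply: eq_bigr => i _.
    by rewrite -sumrN; apply: eq_bigr => a _; exact: antisym.
  lra.
under eq_bigr do rewrite E.
rewrite big_split /= X0 addr0.
(* The derivative of the parallel [H] is tangent; in slot [i] only its component along row [i]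
   survives alternation, and the sum becomes the trace of [c]. *)
pose gi := invmx ('J f x *m G (f x) *m ('J f x)^T).
pose c i : 'rV[R]_m := nab f G H (delta_mx 0 i) x *m G (f x) *m ('J f x)^T *m gi.
have Ec i : Om (f x) (set_row ('J f x) i (nab f G H (delta_mx 0 i) x)) = c i 0 i * Om (f x) ('J f x).
  rewrite (nrm_eq0 (HP (delta_mx 0 i))) -/gi -/(c i) (multilinear_mul (linf Ux)).
  rewrite (bigD1 i)//= set_row_id big1 ?addr0// => a ai.
  rewrite (altO Vf (i := i) (j := a)) ?mulr0 1?eq_sym//.
  by rewrite row_set_row row_set_row_neq.
under eq_bigr do rewrite Ec.
rewrite -mulr_suml -mulNr; congr (_ * _); rewrite (mc_norm LI Ux) -sumrN.
rewrite (li_g LI Ux) -/gi.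
have dH v : derivable H x v.
  by apply: diff_derivable; exact: C1m_differentiable (C1m_mc LI) Ux.
transitivity (\sum_i \sum_a - (gi a i * ip (G (f x)) (S i a) (H x))).
  apply: eq_bigr => i _; rewrite mxE; apply: eq_bigr => a _.
  rewrite mulrC -mulrN; congr (_ * _); rewrite -ip_rowr (row_J LI)//.
  (* Differentiating the relation [H] orthogonal to the a-th coordinate vector moves the derivative
     from [H] to that vector. *)
  have := nab_compat LI Ux (dH (delta_mx 0 i))
     (@diff_derivable _ _ _ _ _ (delta_mx 0 i) (li_diff2 LI (delta_mx 0 a) Ux)).
  rewrite (ipC (H x) _ GT) -/(S i a).
  have -> : 'D_(delta_mx 0 i) (fun y => ip (G (f y)) (H y) ('D_(delta_mx 0 a) f y)) x = 0.
    rewrite -(derive_cst (0 : R) x (delta_mx 0 i)); apply: near_eq_derive.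
    apply: near_open Ux _ => // y Uy.
    by rewrite -(row_J LI)// ip_rowr (mc_normal LI)// mxE.
  by move=> /esym/eqP; rewrite addr_eq0 => /eqP.
rewrite exchange_big /=; apply: eq_bigr => a _; rewrite -sumrN; apply: eq_bigr => i _.
by rewrite Ssym.
Qed.

End Divergence.

Section Jacobian.
Context {R : realType} {a b : nat}.
Variables (U : set 'rV[R]_a) (f : 'rV[R]_a -> 'rV[R]_b).
Hypotheses (oU : open U) (sf : smooth_on U f).

Lemma C1m_jacobian : C1m U (fun x => 'J f x).
Proof.
apply: (@C1m_ext _ _ _ oU _ _ _ (fun x => \matrix_(i, j) 'D_(delta_mx 0 i) f x 0 j)).
  move=> x Ux; apply/matrixP => i j; rewrite [RHS]mxE deriveEjacobian ?rowE//.
    by rewrite -rowE [RHS]mxE.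
  exact: smooth_on_differentiable sf Ux.
move=> i j; under eq_fun do rewrite mxE.
have C : C1m U ('D_(delta_mx 0 i) f) := smooth_on_C1m oU (smooth_on_derive _ sf).
exact: C.
Qed.

Lemma derive_derive_comm x v w : U x -> 'D_v ('D_w f) x = 'D_w ('D_v f) x.
Proof.
move=> Ux; have df u y : U y -> derivable f y u.
  by move=> Uy; apply: diff_derivable; exact: smooth_on_differentiable sf Uy.
have ddf u u' y : U y -> derivable ('D_u f) y u'.
  move=> Uy; apply: diff_derivable.
  exact: smooth_on_differentiable (smooth_on_derive u sf) Uy.
apply/rowP => j.
have E u y : U y -> 'D_u f y 0 j = 'D_u (fun z => f z 0 j) y.
  by move=> Uy; rewrite derive_entry//; exact: df.
have near_E u u' : 'D_u ('D_u' f) x 0 j = 'D_u ('D_u' (fun z => f z 0 j)) x.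
  rewrite (derive_entry _ _ (ddf u' u x Ux)).
  by apply: near_eq_derive; apply: near_open Ux _ => // y /E.
have CE u : C1_on U ('D_u (fun z => f z 0 j)).
  apply: C1_on_eq (smooth_on_C1m oU (smooth_on_derive u sf) 0 j) => // y.
  by rewrite inE => /E.
apply: etrans (near_E v w) _; apply: etrans _ (esym (near_E w v)).
apply: (derive_comm oU Ux _ (CE w) (CE v)).
by move=> y Uy; apply: differentiable_entry; exact: smooth_on_differentiable sf Uy.
Qed.

Lemma derive_jacobian x v w : U x -> w *m 'D_v (fun y => 'J f y) x = 'D_v ('D_w f) x.
Proof.
move=> Ux; have dJ : derivable (fun y => 'J f y) x v.
  by apply: diff_derivable; exact: C1m_differentiable C1m_jacobian Ux.
have [_] := derive_mulmx (derivable_cst w x v) dJ.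
rewrite derive_cst mul0mx add0r => <-; apply: near_eq_derive.
apply: near_open Ux _ => // y Uy; rewrite deriveEjacobian//.
exact: smooth_on_differentiable sf Uy.
Qed.

End Jacobian.

Lemma derive_mulmxl {R : realType} (V : normedModType R) p q r (w : 'M[R]_(p, q))
    (A : V -> 'M[R]_(q, r)) x v : derivable A x v ->
  derivable (fun y => w *m A y) x v /\ 'D_v (fun y => w *m A y) x = w *m 'D_v A x.
Proof.
move=> dA; have [d1 ->] := derive_mulmx (derivable_cst w x v) dA.
by split=> //; rewrite derive_cst mul0mx add0r.
Qed.

Lemma ipDm {R : realType} k (A B : 'M[R]_k) v w : ip (A + B) v w = ip A v w + ip B v w.
Proof. by rewrite /ip mulmxDr mulmxDl mxE. Qed.

Lemma invmx_congr {R : realType} k (A S : 'M[R]_k) : A \in unitmx -> S \in unitmx ->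
  invmx (A *m S *m A^T) = invmx A^T *m invmx S *m invmx A.
Proof.
move=> uA uS; have uAT : A^T \in unitmx by rewrite unitmx_tr.
have u : A *m S *m A^T \in unitmx by rewrite !unitmx_mul uA uS uAT.
apply: (can_inj (mulmxK u)); rewrite mulVmx// !mulmxA mulmxKV// mulmxKV//.
by rewrite mulVmx.
Qed.

Lemma nab_near {R : realType} m k (f W W' : 'rV[R]_m -> 'rV[R]_k) G (U : set 'rV[R]_m) v x :
  open U -> U x -> (forall y, U y -> W y = W' y) -> nab f G W v x = nab f G W' v x.
Proof.
move=> oU Ux WW; have e : 'D_v W x = 'D_v W' x.
  by apply: near_eq_derive; exact: near_open oU Ux WW.
by rewrite /nab e (WW x Ux).
Qed.

(** * Independence of the charts *)

Section ChangeTarget.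
Context {R : realType} {m k : nat}.
Variables (f f' : 'rV[R]_m -> 'rV[R]_k) (G G' : 'rV[R]_k -> 'M[R]_k) (gM : 'rV[R]_m -> 'M[R]_m).
Variables (U : set 'rV[R]_m) (V V' : set 'rV[R]_k).
Hypotheses (LI : local_immersion f G gM U V) (LI' : local_immersion f' G' gM U V').
Variable T : 'rV[R]_k -> 'rV[R]_k.
Hypotheses (sT : smooth_on V T) (VT : forall y, V y -> V' (T y)).
Hypothesis (fT : forall x, U x -> f' x = T (f x)).
Hypothesis (GT : forall y, V y -> G y = 'J T y *m G' (T y) *m ('J T y)^T).

Let oU := li_oU LI.
Let oV := li_oV LI.

Lemma change_target_unit y : V y -> 'J T y \in unitmx.
Proof.
move=> Vy; have := posdef_unit (li_pos LI Vy); rewrite GT// !unitmxE !det_mulmx det_tr.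
by rewrite !unitrM => /andP[/andP[]].
Qed.

(** By uniqueness: the symbols pulled back along [T] are symmetric and compatible with [G]. *)
Lemma chr_change y v w : V y ->
  chr G' (T y) (v *m 'J T y) (w *m 'J T y) + w *m 'D_v (fun y => 'J T y) y =
  chr G y v w *m 'J T y.
Proof.
move=> Vy; have uT := change_target_unit Vy; have VTy := VT Vy.
have dT : differentiable T y := smooth_on_differentiable sT Vy.
have dG' := li_diffG LI' VTy; have dG := li_diffG LI Vy.
pose Gam v w := (chr G' (T y) (v *m 'J T y) (w *m 'J T y) +
   w *m 'D_v (fun y => 'J T y) y) *m invmx ('J T y).
have GamE v0 w0 : Gam v0 w0 *m 'J T y = chr G' (T y) (v0 *m 'J T y) (w0 *m 'J T y) +
   w0 *m 'D_v0 (fun y => 'J T y) y by rewrite /Gam mulmxKV.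
rewrite -GamE; congr (_ *m _); apply: (chr_unique Vy dG (li_pos LI)) => [v0 w0|v0 w0 z].
  rewrite /Gam !(derive_jacobian oV sT _ _ Vy) (derive_derive_comm oV sT _ _ Vy).
  by rewrite (chr_sym (li_oV LI') VTy dG' (li_pos LI')).
have dJ : derivable (fun y => 'J T y) y v0.
  by apply: diff_derivable; exact: C1m_differentiable (C1m_jacobian oV sT) Vy.
have dGT : derivable (fun y => G' (T y)) y v0.
  apply: diff_derivable; exact: (@differentiable_comp _ _ _ _ T G').
have [d1 e1] := derive_mulmx dJ dGT.
have [dJt eJt] := derive_trmx dJ.
have [_ e2] := derive_mulmx d1 dJt.
have -> : 'D_v0 G y = 'D_v0 (fun y => 'J T y *m G' (T y) *m ('J T y)^T) y.
  by apply: near_eq_derive; apply: near_open Vy _ => // y' Vy'; exact: GT.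
rewrite e2 e1 eJt (derive_comp v0 dT dG') deriveEjacobian//.
rewrite GT// !ip_mul !GamE.
rewrite ipDl ipDr -!addrA.
have := chr_compat (li_oV LI') VTy dG' (li_pos LI') (v0 *m 'J T y) (w0 *m 'J T y) (z *m 'J T y).
set D := 'D_v0 _ y; set c1 := chr _ _ _ _; set c2 := chr _ _ _ _; set D' := 'D__ G' _.
clearbody D c1 c2 D' => e.
have ee A B : ip (A *m G' (T y) *m B^T) w0 z = ip (G' (T y)) (w0 *m A) (z *m B).
  by rewrite /ip trmx_mul !mulmxA.
have e3 : ip ('J T y *m D' *m ('J T y)^T) w0 z = ip D' (w0 *m 'J T y) (z *m 'J T y).
  exact: ip_mul.
by rewrite mulmxDl !ipDm !ee e3 e; ring.
Qed.

Lemma change_target_D x v : U x -> 'D_v f' x = 'D_v f x *m 'J T (f x).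
Proof.
move=> Ux; have Vf := li_UV LI Ux.
have dT : differentiable T (f x) := smooth_on_differentiable sT Vf.
have -> : 'D_v f' x = 'D_v (T \o f) x.
  by apply: near_eq_derive; apply: near_open Ux _ => // y Uy; exact: fT.
by rewrite (derive_comp v (li_diff LI Ux) dT) deriveEjacobian.
Qed.

Lemma change_target_J x : U x -> 'J f' x = 'J f x *m 'J T (f x).
Proof.
move=> Ux; apply/row_matrixP => i; apply: etrans (row_J LI' i Ux) _.
by rewrite row_mul (row_J LI i Ux); exact: change_target_D.
Qed.

Lemma change_target_nab (W : 'rV[R]_m -> 'rV[R]_k) v x : U x -> derivable W x v ->
  nab f' G' (fun y => W y *m 'J T (f y)) v x = nab f G W v x *m 'J T (f x).
Proof.
move=> Ux dW; have Vf := li_UV LI Ux.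
have dJ : differentiable (fun y => 'J T y) (f x).
  exact: C1m_differentiable (C1m_jacobian oV sT) Vf.
have dJf : derivable (fun y => 'J T (f y)) x v.
  apply: diff_derivable; apply: (@differentiable_comp _ _ _ _ f (fun y => 'J T y)) => //.
  exact: (li_diff LI Ux).
rewrite /nab; have [_ ->] := derive_mulmx dW dJf.
rewrite (derive_comp v (li_diff LI Ux) dJ) change_target_D// fT// -addrA.
by rewrite [X in _ + X]addrC chr_change// mulmxDl.
Qed.

Lemma change_target_nrm x w : U x ->
  npart f' G' x (w *m 'J T (f x)) = npart f G x w *m 'J T (f x).
Proof.
move=> Ux; have Vf := li_UV LI Ux.
rewrite /npart /nrm change_target_J// fT// (GT Vf) mulmxBl !trmx_mul !mulmxA.
by [].
Qed.

Lemma change_target_mc x : U x -> mc f' G' gM x = mc f G gM x *m 'J T (f x).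
Proof.
move=> Ux; rewrite /mc -scalemxAl; congr (_ *: _).
rewrite mulmx_suml; apply: eq_bigr => i _; rewrite mulmx_suml; apply: eq_bigr => j _.
rewrite -scalemxAl; congr (_ *: _); rewrite /sff -change_target_nrm//; congr (npart _ _ _ _).
have dW : derivable ('D_(delta_mx 0 j) f) x (delta_mx 0 i).
  by apply: diff_derivable; exact: (li_diff2 LI _ Ux).
apply: etrans _ (change_target_nab Ux dW).
by apply: nab_near oU Ux _ => y Uy; exact: change_target_D.
Qed.

End ChangeTarget.

Section ChangeSource.
Context {R : realType} {m k : nat}.
Variables (f f' : 'rV[R]_m -> 'rV[R]_k) (G : 'rV[R]_k -> 'M[R]_k) (gM gM' : 'rV[R]_m -> 'M[R]_m).
Variables (U U' : set 'rV[R]_m) (V : set 'rV[R]_k).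
Hypotheses (LI : local_immersion f G gM U V) (LI' : local_immersion f' G gM' U' V).
Variable T : 'rV[R]_m -> 'rV[R]_m.
Hypotheses (sT : smooth_on U' T) (UT : forall x, U' x -> U (T x)).
Hypothesis (fT : forall x, U' x -> f' x = f (T x)).

Let oU' := li_oU LI'.

Lemma change_source_D x v : U' x -> 'D_v f' x = 'D_(v *m 'J T x) f (T x).
Proof.
move=> Ux; have dT : differentiable T x := smooth_on_differentiable sT Ux.
have -> : 'D_v f' x = 'D_v (f \o T) x.
  by apply: near_eq_derive; apply: near_open Ux _ => // y Uy; exact: fT.
by rewrite (derive_comp v dT (li_diff LI (UT Ux))) (deriveEjacobian v dT).
Qed.

Lemma change_source_J x : U' x -> 'J f' x = 'J T x *m 'J f (T x).
Proof.
move=> Ux; apply/row_matrixP => i; rewrite row_mul (row_J LI')// change_source_D//.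
by rewrite -rowE deriveEjacobian//; exact: (li_diff LI (UT Ux)).
Qed.

Lemma change_source_unit x : U' x -> 'J T x \in unitmx.
Proof.
move=> Ux; have := posdef_unit (li_gram LI' Ux).
rewrite change_source_J//; set S := _ *m _ *m _ => uS.
have : \det S \is a GRing.unit by rewrite -unitmxE.
rewrite /S trmx_mul -2!mulmxA det_mulmx unitrM => /andP[+ _].
by rewrite -unitmxE.
Qed.

Lemma sff_linearl x n (c : 'I_n -> R) (u : 'I_n -> 'rV[R]_m) w : U x ->
  sff f G x (\sum_i c i *: u i) w = \sum_i c i *: sff f G x (u i) w.
Proof.
move=> Ux; have Vf := li_UV LI Ux.
have L1 (h : 'rV[R]_m -> 'rV[R]_k) : differentiable h x ->
    'D_(\sum_i c i *: u i) h x = \sum_i c i *: 'D_(u i) h x.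
  move=> dh; rewrite deriveE// linear_sum; apply: eq_bigr => i _.
  by rewrite linearZ /= deriveE.
have L2 (v : 'I_n -> 'rV[R]_k) z :
    chr G (f x) (\sum_i c i *: v i) z = \sum_i c i *: chr G (f x) (v i) z.
  rewrite (chr_bilinear LI _ _ Vf); under [RHS]eq_bigr do rewrite (chr_bilinear LI _ _ Vf) scaler_sumr.
  rewrite [RHS]exchange_big /=; apply: eq_bigr => p _.
  under [RHS]eq_bigr do rewrite scaler_sumr.
  rewrite [RHS]exchange_big /=; apply: eq_bigr => q _.
  rewrite summxE mulr_suml scaler_suml; apply: eq_bigr => i _.
  by rewrite !mxE scalerA mulrA.
have L3 (v : 'I_n -> 'rV[R]_k) : npart f G x (\sum_i c i *: v i) = \sum_i c i *: npart f G x (v i).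
  rewrite /npart /nrm !mulmx_suml -sumrB; apply: eq_bigr => i _.
  by rewrite -!scalemxAl scalerBr.
rewrite /sff -L3 /nab (L1 _ (li_diff2 LI w Ux)) (L1 _ (li_diff LI Ux)) L2 -big_split /=.
by congr (npart _ _ _ _); apply: eq_bigr => i _; rewrite scalerDr.
Qed.

Lemma sff_sym x v w : U x -> sff f G x v w = sff f G x w v.
Proof. by move=> Ux; rewrite /sff (nab_sym LI _ _ Ux). Qed.

Lemma change_source_nrm x w : U' x -> npart f' G x w = npart f G (T x) w.
Proof.
move=> Ux; have uA := change_source_unit Ux.
rewrite /npart /nrm change_source_J// fT//; congr (_ - _).
have uS := posdef_unit (li_gram LI (UT Ux)).
set A := 'J T x in uA *; set J := 'J f (T x) in uS *; set S := J *m _ *m J^T in uS *.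
have -> : A *m J *m G (f (T x)) *m (A *m J)^T = A *m S *m A^T.
  by rewrite /S trmx_mul !mulmxA.
rewrite (invmx_congr uA uS) trmx_mul.
have uAT : A^T \in unitmx by rewrite unitmx_tr.
clearbody S; rewrite !mulmxA mulmxK// mulmxKV//.
Qed.

Lemma change_source_sff x v w : U' x ->
  sff f' G x v w = sff f G (T x) (v *m 'J T x) (w *m 'J T x).
Proof.
move=> Ux; have Ux' := UT Ux; have dT : differentiable T x := smooth_on_differentiable sT Ux.
have dJ : differentiable (fun y => 'J f y) (T x).
  exact: C1m_differentiable (C1m_jacobian (li_oU LI) (li_f LI)) Ux'.
have dJT : derivable (fun y => 'J T y) x v.
  by apply: diff_derivable; exact: C1m_differentiable (C1m_jacobian oU' sT) Ux.
have dJf : derivable (fun y => 'J f (T y)) x v.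
  by apply: diff_derivable; exact: (@differentiable_comp _ _ _ _ T (fun y => 'J f y)).
have [d1 e1] := derive_mulmxl w dJT.
have [_ e2] := derive_mulmx d1 dJf.
have E : 'D_v ('D_w f') x = (w *m 'D_v (fun y => 'J T y) x) *m 'J f (T x) +
    'D_(v *m 'J T x) ('D_(w *m 'J T x) f) (T x).
  rewrite -(derive_jacobian (li_oU LI) (li_f LI) _ _ Ux').
  transitivity ('D_v (fun y => w *m 'J T y *m 'J f (T y)) x).
    apply: near_eq_derive; apply: near_open Ux _ => // y Uy.
    by rewrite change_source_D// deriveEjacobian//; exact: (li_diff LI (UT Uy)).
  have e3 : 'D_v (fun y => 'J f (T y)) x = 'D_(v *m 'J T x) (fun y => 'J f y) (T x).
    by apply: etrans (derive_comp v dT dJ) _; rewrite (deriveEjacobian v dT).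
  apply: etrans e2 _.
  exact: (f_equal2 +%R (congr1 (fun B => B *m 'J f (T x)) e1)
    (congr1 (fun B => w *m 'J T x *m B) e3)).
have ec : chr G (f' x) ('D_v f' x) ('D_w f' x) = chr G (f (T x))
    ('D_(v *m 'J T x) f (T x)) ('D_(w *m 'J T x) f (T x)).
  by rewrite (fT Ux) (change_source_D v Ux) (change_source_D w Ux).
have N : nab f' G ('D_w f') v x = (w *m 'D_v (fun y => 'J T y) x) *m 'J f (T x) +
    nab f G ('D_(w *m 'J T x) f) (v *m 'J T x) (T x).
  by apply: etrans (f_equal2 +%R E ec) _; exact: (esym (addrA _ _ _)).
(* The term with the second derivatives of [T] is tangent, so the normal part drops it. *)
rewrite /sff N (change_source_nrm _ Ux) [LHS]nrmD [X in X + _](_ : _ = 0) ?add0r//.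
by apply: nrm_tangent; exact: (li_gram LI Ux').
Qed.

(** The trace is intrinsic: the Jacobian of [T] acts on both arguments of the second fundamental
    form and is absorbed by the two inverse metrics. *)
Lemma change_source_mc x : U' x -> gM' x = 'J T x *m gM (T x) *m ('J T x)^T ->
  mc f' G gM' x = mc f G gM (T x).
Proof.
move=> Ux eg; have Ux' := UT Ux; have uA := change_source_unit Ux.
rewrite /mc; apply: (congr1 (fun w => m%:R^-1 *: w)); set A := 'J T x in eg uA *.
have ug : gM (T x) \in unitmx by rewrite (li_g LI Ux'); apply: posdef_unit; exact: (li_gram LI Ux').
pose s p q := sff f G (T x) (delta_mx 0 p) (delta_mx 0 q).
have S v w : sff f G (T x) v w = \sum_p \sum_q (v 0 p * w 0 q) *: s p q.
  rewrite {1}(row_sum_delta v) sff_linearl//; apply: eq_bigr => p _.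
  rewrite sff_sym// {1}(row_sum_delta w) sff_linearl// scaler_sumr.
  by apply: eq_bigr => q _; rewrite sff_sym// scalerA.
apply: (@etrans _ _ (\sum_p \sum_q (A^T *m invmx (gM' x) *m A) p q *: s p q)).
  transitivity (\sum_i \sum_j \sum_p \sum_q (invmx (gM' x) i j * (A i p * A j q)) *: s p q).
    apply: eq_bigr => i _; apply: eq_bigr => j _; rewrite change_source_sff// S scaler_sumr.
    apply: eq_bigr => p _; rewrite scaler_sumr; apply: eq_bigr => q _.
    by rewrite scalerA -!rowE !mxE.
  under eq_bigr do rewrite exchange_big /=.
  rewrite exchange_big /=; apply: eq_bigr => p _.
  under eq_bigr do rewrite exchange_big /=.
  rewrite exchange_big /=; apply: eq_bigr => q _.
  rewrite !mxE scaler_suml exchange_big /=; apply: eq_bigr => j _.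
  rewrite !mxE mulr_suml scaler_suml; apply: eq_bigr => i _.
  by rewrite !mxE; congr (_ *: _); ring.
suff -> : A^T *m invmx (gM' x) *m A = invmx (gM (T x)) by [].
have uAT : A^T \in unitmx by rewrite unitmx_tr.
rewrite eg invmx_congr// !mulmxA mulmxV// mul1mx mulmxKV//.
Qed.

End ChangeSource.

(** * Immersions in charts *)

Section ChartTopology.
Context {R : realType} {k : nat} {T : topologicalType}.
Implicit Types (phi : chart R T k).

Lemma chart_image phi (A : set T) : A `<=` cdom phi ->
  cmap phi @` A = (cmap phi @` cdom phi) `&` cinv phi @^-1` A.
Proof.
move=> Ad; apply/seteqP; split=> [_ [p Ap <-]|_ [[p dp <-]]] /=.
  by rewrite cmapK; [split=> //; exists p => //; exact: Ad|exact: Ad].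
by rewrite cmapK// => Ap; exists p.
Qed.

Lemma open_chart_image phi (A : set T) : open A -> A `<=` cdom phi -> open (cmap phi @` A).
Proof.
move=> oA Ad; rewrite (chart_image Ad) openE => x [ix cx]; apply: filterI.
  by apply: open_nbhs_nbhs; split=> //; exact: cimg_open.
by apply: (@cinv_continuous _ _ _ phi x ix); exact: open_nbhs_nbhs.
Qed.

Lemma chart_preimage phi (B : set 'rV[R]_k) : B `<=` cmap phi @` cdom phi ->
  cinv phi @` B = cdom phi `&` cmap phi @^-1` B.
Proof.
move=> Bd; apply/seteqP; split=> [_ [x Bx <-]|p [dp Bp]] /=.
  by have [p dp e] := Bd x Bx; rewrite -e cmapK// e.
by exists (cmap phi p) => //; rewrite cmapK.
Qed.

Lemma cinvK phi x : (cmap phi @` cdom phi) x -> cmap phi (cinv phi x) = x.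
Proof. by move=> [p dp <-]; rewrite cmapK. Qed.

Lemma cinv_dom phi x : (cmap phi @` cdom phi) x -> cdom phi (cinv phi x).
Proof. by move=> [p dp <-]; rewrite cmapK. Qed.

Lemma open_chart_preimage phi (B : set 'rV[R]_k) : open B -> B `<=` cmap phi @` cdom phi ->
  open (cinv phi @` B).
Proof.
move=> oB Bd; rewrite (chart_preimage Bd) openE => p [dp Bp]; apply: filterI.
  by apply: open_nbhs_nbhs; split=> //; exact: cdom_open.
by apply: (@cmap_continuous _ _ _ phi p dp); exact: open_nbhs_nbhs.
Qed.

End ChartTopology.

Lemma smooth_onS (R : realType) a (W : normedModType R) (A B : set 'rV[R]_a) (h : 'rV[R]_a -> W) :
  A `<=` B -> smooth_on B h -> smooth_on A h.
Proof.
move=> AB sB j; move: (sB j); elim: j h {sB} => [|j IH] h /=.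
  by move=> H x /AB/H.
by move=> [H1 H2]; split=> [x /AB/H1//|v]; exact: IH.
Qed.

Lemma li_restrict (R : realType) (m k : nat) (f : 'rV[R]_m -> 'rV[R]_k) G gM U V U' V' :
  local_immersion f G gM U V -> open U' -> open V' -> U' `<=` U -> V' `<=` V ->
  (forall x, U' x -> V' (f x)) -> local_immersion f G gM U' V'.
Proof.
move=> LI oU' oV' UU VV UV; split=> //.
- exact: smooth_onS UU (li_f LI).
- exact: smooth_onS VV (li_G LI).
- by move=> y /VV; exact: li_pos LI y.
- by move=> x /UU; exact: li_g LI x.
- by move=> x /UU; exact: li_free LI x.
Qed.

Section Immersed.
Context {R : realType} {m k : nat} {N : manifold R k} {M : manifold R m}.
Variables (gN : metric N) (g : metric M) (F : M -> N).
Hypotheses (F_imm : immersion F) (g_induced : induced_metric F g gN).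
Implicit Types (phi : chart R M m) (psi : chart R N k).

Definition pdom phi psi : set 'rV[R]_m := cmap phi @` (cdom phi `&` F @^-1` cdom psi).

Lemma local_repE phi psi p : cdom phi p ->
  local_rep F phi psi (cmap phi p) = cmap psi (F p).
Proof. by move=> dp; rewrite /local_rep /= cmapK. Qed.

Lemma metric_posdef (k' : nat) (N' : manifold R k') (gN' : metric N') (psi : chart R N' k') y :
  atlas psi -> (cmap psi @` cdom psi) y -> posdef (gN' psi y).
Proof.
move=> aps [q dq <-]; split=> [|v v0]; first exact: gmx_sym.
exact: gmx_pos.
Qed.

Lemma F_continuous : continuous F. Proof. by have [[]] := F_imm. Qed.

Lemma open_pdom phi psi : open (pdom phi psi).
Proof.
apply: open_chart_image; last by move=> p [].
apply: openI; first exact: cdom_open.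
by apply: open_comp; [move=> p _; exact: F_continuous|exact: cdom_open].
Qed.

Lemma pair_immersion phi psi : atlas phi -> atlas psi ->
  local_immersion (local_rep F phi psi) (gN psi) (g phi) (pdom phi psi) (cmap psi @` cdom psi).
Proof.
move=> aph aps; split.
- exact: open_pdom.
- exact: cimg_open.
- by move=> _ [p [dp dq] <-]; rewrite local_repE//; exists (F p).
- by have [[_ H] _] := F_imm; exact: H.
- exact: gmx_smooth.
- by move=> y; exact: metric_posdef.
- by move=> _ [p [dp dq] <-]; rewrite local_repE//; apply: g_induced.
- by move=> _ [p [dp dq] <-]; have [_] := F_imm; apply.
Qed.

Lemma mean_curvE phi psi x :
  mean_curv F g gN phi psi x = mc (local_rep F phi psi) (gN psi) (g phi) x.
Proof. by []. Qed.

Lemma pdom_charts phi psi p : charts_at F phi psi p -> pdom phi psi (cmap phi p).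
Proof. by move=> [[_ dp] [_ dq]]; exists p. Qed.

Section TwoTargets.
Variables (phi : chart R M m) (psi psi' : chart R N k).
Hypotheses (aph : atlas phi) (aps : atlas psi) (aps' : atlas psi').
Let V := cmap psi @` (cdom psi `&` cdom psi').
Let V' := cmap psi' @` (cdom psi `&` cdom psi').
Let U := cmap phi @` (cdom phi `&` F @^-1` (cdom psi `&` cdom psi')).

Let oU : open U.
Proof.
apply: open_chart_image; last by move=> p [].
apply: openI; first exact: cdom_open.
apply: open_comp; [move=> p _; exact: F_continuous|].
by apply: openI; exact: cdom_open.
Qed.

Let LI : local_immersion (local_rep F phi psi) (gN psi) (g phi) U V.
Proof.
apply: (li_restrict (pair_immersion aph aps) oU).
- by apply: open_chart_image; [apply: openI; exact: cdom_open|move=> q []].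
- by move=> _ [p [dp [dq dq']] <-]; exists p.
- by move=> _ [q [dq dq'] <-]; exists q.
- by move=> _ [p [dp dq] <-]; rewrite local_repE//; exists (F p).
Qed.

Let LI' : local_immersion (local_rep F phi psi') (gN psi') (g phi) U V'.
Proof.
apply: (li_restrict (pair_immersion aph aps') oU).
- by apply: open_chart_image; [apply: openI; exact: cdom_open|move=> q []].
- by move=> _ [p [dp [dq dq']] <-]; exists p.
- by move=> _ [q [dq dq'] <-]; exists q.
- by move=> _ [p [dp dq] <-]; rewrite local_repE//; exists (F p).
Qed.

Let sT : smooth_on V (change psi psi').
Proof. by have [] := atlas_compatible aps aps'. Qed.

Let VT y : V y -> V' (change psi psi' y).
Proof. by move=> [q [dq dq'] <-]; rewrite /change /= cmapK//; exists q. Qed.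

Let fT x : U x -> local_rep F phi psi' x = change psi psi' (local_rep F phi psi x).
Proof. by move=> [p [dp [dq dq']] <-]; rewrite !local_repE// /change /= cmapK. Qed.

Let GT y : V y -> gN psi y =
  'J (change psi psi') y *m gN psi' (change psi psi' y) *m ('J (change psi psi') y)^T.
Proof.
move=> [q [dq dq'] <-]; rewrite [change _ _ _]/change /= cmapK//.
exact: (@gmx_change _ _ _ gN psi psi' q).
Qed.

Lemma target_change p : cdom phi p -> cdom psi (F p) -> cdom psi' (F p) ->
  let x := cmap phi p in let T := 'J (change psi psi') (cmap psi (F p)) in
  [/\ 'J (local_rep F phi psi') x = 'J (local_rep F phi psi) x *m T,
      mean_curv F g gN phi psi' x = mean_curv F g gN phi psi x *m T &
      gN psi (cmap psi (F p)) = T *m gN psi' (cmap psi' (F p)) *m T^T].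
Proof.
move=> dp dq dq' x T; have Ux : U x by exists p.
have e : local_rep F phi psi x = cmap psi (F p) by exact: local_repE.
split.
- by rewrite (change_target_J LI LI' sT fT Ux) e.
- rewrite !mean_curvE.
  have H := change_target_mc LI LI' sT VT fT GT Ux.
  by rewrite e in H.
- by apply: (@gmx_change _ _ _ gN psi psi' (F p)).
Qed.

End TwoTargets.

Section TwoSources.
Variables (phi phi' : chart R M m) (psi : chart R N k).
Hypotheses (aph : atlas phi) (aph' : atlas phi') (aps : atlas psi).
Let V := cmap psi @` cdom psi.
Let U := cmap phi @` ((cdom phi `&` cdom phi') `&` F @^-1` cdom psi).
Let U' := cmap phi' @` ((cdom phi `&` cdom phi') `&` F @^-1` cdom psi).

Let oA : open ((cdom phi `&` cdom phi') `&` F @^-1` cdom psi).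
Proof.
apply: openI; first by apply: openI; exact: cdom_open.
by apply: open_comp; [move=> p _; exact: F_continuous|exact: cdom_open].
Qed.

Let LI : local_immersion (local_rep F phi psi) (gN psi) (g phi) U V.
Proof.
apply: (li_restrict (pair_immersion aph aps)) => //.
- by apply: open_chart_image => // p [[]].
- exact: cimg_open.
- by move=> _ [p [[dp dp'] dq] <-]; exists p.
- by move=> _ [p [[dp dp'] dq] <-]; rewrite local_repE//; exists (F p).
Qed.

Let LI' : local_immersion (local_rep F phi' psi) (gN psi) (g phi') U' V.
Proof.
apply: (li_restrict (pair_immersion aph' aps)) => //.
- by apply: open_chart_image => // p [[]].
- exact: cimg_open.
- by move=> _ [p [[dp dp'] dq] <-]; exists p.
- by move=> _ [p [[dp dp'] dq] <-]; rewrite local_repE//; exists (F p).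
Qed.

Let sT : smooth_on U' (change phi' phi).
Proof.
have [_ H] := atlas_compatible aph aph'; apply: smooth_onS H.
by move=> _ [p [dp dq] <-]; exists p.
Qed.

Let UT x : U' x -> U (change phi' phi x).
Proof. by move=> [p [[dp dp'] dq] <-]; rewrite /change /= cmapK//; exists p. Qed.

Let fT x : U' x -> local_rep F phi' psi x = local_rep F phi psi (change phi' phi x).
Proof.
by move=> [p [[dp dp'] dq] <-]; rewrite [change _ _ _]/change /= cmapK// !local_repE.
Qed.

Lemma source_change p : cdom phi p -> cdom phi' p -> cdom psi (F p) ->
  let T := 'J (change phi' phi) (cmap phi' p) in
  [/\ 'J (local_rep F phi' psi) (cmap phi' p) = T *m 'J (local_rep F phi psi) (cmap phi p),
      mean_curv F g gN phi' psi (cmap phi' p) = mean_curv F g gN phi psi (cmap phi p),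
      g phi' (cmap phi' p) = T *m g phi (cmap phi p) *m T^T &
      T \in unitmx].
Proof.
move=> dp dp' dq T; have Ux : U' (cmap phi' p) by exists p.
have e : change phi' phi (cmap phi' p) = cmap phi p by rewrite /change /= cmapK.
have gT : g phi' (cmap phi' p) = T *m g phi (cmap phi p) *m T^T.
  exact: (@gmx_change _ _ _ g phi' phi p).
split.
- by rewrite (change_source_J LI LI' sT UT fT Ux) e.
- rewrite !mean_curvE.
  have H := change_source_mc LI LI' sT UT fT Ux.
  rewrite e in H.
  exact: (H gT).
- exact: gT.
- exact: (change_source_unit LI LI' sT UT fT Ux).
Qed.

End TwoSources.

End Immersed.

Lemma ratio_scale (K : fieldType) (d S t : K) : d * t != 0 -> d * S / (d * t) = S / t.
Proof. by rewrite mulf_eq0 negb_or => /andP[d0 _]; rewrite -mulf_div divff// mul1r. Qed.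

(** * Angle, flux and length of the mean curvature of a calibrated immersion *)

Section Calibrated.
Context {R : realType} {r k : nat} {N : manifold R k} {M : manifold R r.+1}.
Variables (gN : metric N) (g : metric M) (F : M -> N).
Hypotheses (F_imm : immersion F) (g_induced : induced_metric F g gN).
Variables (Om : dform N r.+1) (Om_comass : comass_one gN Om) (Om_par : parallel_form gN Om).
Implicit Types (phi : chart R M r.+1) (psi : chart R N k).

Lemma mean_curv_normE phi psi p : mean_curv_norm F g gN phi psi p =
  Num.sqrt (ip (gN psi (local_rep F phi psi (cmap phi p)))
    (mean_curv F g gN phi psi (cmap phi p)) (mean_curv F g gN phi psi (cmap phi p))).
Proof. by []. Qed.

Lemma form_multilinear psi y : atlas psi -> (cmap psi @` cdom psi) y ->
  multilinear_rows (Om psi y).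
Proof.
move=> aps [q dq <-] V i b c w w'.
apply: (@fval_multilinear _ _ _ _ Om psi q _ _ _ i) => //.
- by rewrite !row_set_row.
- by rewrite !row'_set_row.
- by rewrite !row'_set_row.
Qed.

Lemma form_alternating psi y : atlas psi -> (cmap psi @` cdom psi) y ->
  alternating_rows (Om psi y).
Proof. by move=> aps [q dq <-] V i j; exact: (@fval_alternating _ _ _ _ Om psi q V i j). Qed.

Lemma form_C1_on psi W : atlas psi -> C1_on (cmap psi @` cdom psi) (fun y => Om psi y W).
Proof. by move=> aps; apply: smooth_on_C1; exact: (fval_smooth Om W aps). Qed.

Lemma form_parallel psi y v W : atlas psi -> (cmap psi @` cdom psi) y ->
  'D_v (fun y => Om psi y W) y =
  \sum_i Om psi y (set_row W i (chr (gN psi) y v (row i W))).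
Proof.
move=> aps [q dq <-]; apply/eqP; rewrite -subr_eq0; apply/eqP.
exact: (Om_par (phi := psi) (p := q) v W (conj aps dq)).
Qed.

(** The form on the coordinate frame of [phi]: up to sign, cos theta times the volume density. *)
Definition tangent_form phi psi x := Om psi (local_rep F phi psi x) ('J (local_rep F phi psi) x).

Definition fluxc phi psi i x := flux (local_rep F phi psi) (gN psi) (g phi) (Om psi) i x.

Lemma fluxcE phi psi i x : fluxc phi psi i x =
  Om psi (local_rep F phi psi x) (set_row ('J (local_rep F phi psi) x) i (mean_curv F g gN phi psi x)).
Proof. by []. Qed.

Lemma tangent_formE phi psi p : cdom phi p -> tangent_form phi psi (cmap phi p) =
  Om psi (cmap psi (F p)) ('J (local_rep F phi psi) (cmap phi p)).
Proof. by move=> dp; rewrite /tangent_form local_repE. Qed.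

Opaque mean_curv mean_curv_norm.

Lemma fluxc_C1 phi psi i : atlas phi -> atlas psi -> C1_on (pdom F phi psi) (fluxc phi psi i).
Proof.
move=> aph aps; apply: (flux_C1 (pair_immersion F_imm g_induced aph aps)).
- by move=> y; exact: form_multilinear.
- by move=> W; exact: form_C1_on.
Qed.

Lemma tangent_form_C1 phi psi : atlas phi -> atlas psi ->
  C1_on (pdom F phi psi) (tangent_form phi psi).
Proof.
move=> aph aps; have LI := pair_immersion F_imm g_induced aph aps.
apply: (form_C1 LI _ _ (C1m_J LI)).
- by move=> y; exact: form_multilinear.
- by move=> W; exact: form_C1_on.
Qed.

Lemma target_form phi psi psi' p : charts_at F phi psi p -> charts_at F phi psi' p ->
  tangent_form phi psi' (cmap phi p) = tangent_form phi psi (cmap phi p) /\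
  forall i, fluxc phi psi' i (cmap phi p) = fluxc phi psi i (cmap phi p).
Proof.
move=> [[aph dp] [aps dq]] [_ [aps' dq']].
have [eJ eH _] := target_change F_imm g_induced aph aps aps' dp dq dq'.
have ch V := @fval_change _ _ _ _ Om psi psi' (F p) V (conj aps dq) (conj aps' dq').
split=> [|i]; first by rewrite /tangent_form eJ !local_repE// -ch.
by rewrite !fluxcE eJ eH -set_row_mulr !local_repE// -ch.
Qed.

(** Single flux components mix under a change of chart; contracted with a covector, which transforms
    by the same Jacobian, they only scale by its determinant. *)
Lemma source_form phi phi' psi p : charts_at F phi psi p -> charts_at F phi' psi p ->
  tangent_form phi' psi (cmap phi' p) =
    \det ('J (change phi' phi) (cmap phi' p)) * tangent_form phi psi (cmap phi p) /\
  forall u : 'cV[R]_r.+1,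
    \sum_i ('J (change phi' phi) (cmap phi' p) *m u) i 0 * fluxc phi' psi i (cmap phi' p) =
    \det ('J (change phi' phi) (cmap phi' p)) * \sum_i u i 0 * fluxc phi psi i (cmap phi p).
Proof.
move=> [[aph dp] [aps dq]] [[aph' dp'] _].
have [eJ eH _ _] := source_change F_imm g_induced aph aph' aps dp dp' dq.
have Vq : (cmap psi @` cdom psi) (cmap psi (F p)) by exists (F p).
have lin := form_multilinear aps Vq; have alt := form_alternating aps Vq.
split=> [|u].
  apply: etrans (tangent_formE psi dp') _.
  apply: etrans (congr1 (Om psi (cmap psi (F p))) eJ) _.
  apply: etrans (alternating_mulmx lin alt _ _) _.
  exact: (congr1 _ (esym (tangent_formE psi dp))).
have E1 i : fluxc phi psi i (cmap phi p) = Om psi (cmap psi (F p))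
    (set_row ('J (local_rep F phi psi) (cmap phi p)) i (mean_curv F g gN phi psi (cmap phi p))).
  rewrite fluxcE; exact: (congr1 (fun y => Om psi y _) (local_repE F psi dp)).
have E2 i : fluxc phi' psi i (cmap phi' p) = Om psi (cmap psi (F p))
    (set_row ('J (change phi' phi) (cmap phi' p) *m 'J (local_rep F phi psi) (cmap phi p)) i
      (mean_curv F g gN phi psi (cmap phi p))).
  rewrite fluxcE eJ eH; exact: (congr1 (fun y => Om psi y _) (local_repE F psi dp')).
apply: etrans (eq_bigr _ (fun i _ => congr1 _ (E2 i))) _.
apply: etrans (alternating_density lin alt _ _ _ _) _.
exact: (congr1 _ (esym (eq_bigr _ (fun i _ => congr1 _ (E1 i))))).
Qed.

Opaque tangent_form fluxc.

Lemma metric_gram phi psi p : charts_at F phi psi p -> 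
  posdef (g phi (cmap phi p)).
Proof. by move=> [[aph dp] _]; apply: (metric_posdef g aph); exists p. Qed.

Variables (O : orientation M) (theta : M -> R).
Hypothesis (r_gt0 : (0 < r)%N) (theta_angle : omega_angle F g O Om theta).
Hypothesis cos_gt0 : forall p, 0 < cos (theta p).

Lemma direct_cos phi psi p : direct O phi -> charts_at F phi psi p ->
  cos (theta p) = `|tangent_form phi psi (cmap phi p)| / Num.sqrt (\det (g phi (cmap phi p))).
Proof.
move=> dph ch; have pg := metric_gram ch.
have [L eL] := cholesky pg; set G := g phi _ in pg eL *.
have dG := posdef_det_gt0 pg.
have dL : \det L != 0.
  by apply/eqP => dL; move: dG; rewrite eL det_mulmx dL mul0r ltxx.
have uL : L \in unitmx by rewrite unitmxE unitfE.
(* [invmx L] makes the coordinate frame orthonormal; when [\det L] is negative, exchanging two rows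
   makes the result direct. This is where dimension at least two enters. *)
pose P : 'M[R]_r.+1 := if 0 < \det L then 1%:M else perm_mx (tperm ord0 (Ordinal (r_gt0 : (1 < r.+1)%N))).
have PP : P *m P^T = 1%:M.
  rewrite /P; case: ifP => _; first by rewrite trmx1 mulmx1.
  by rewrite tr_perm_mx -perm_mxM mulgV perm_mx1.
pose X := P *m invmx L.
have dX : \det X = `|\det L|^-1.
  rewrite /X det_mulmx det_inv /P; case: ltrP => dL0; first by rewrite det1 mul1r gtr0_norm.
  by rewrite det_perm odd_tperm /= expr1 mulN1r ler0_norm// invrN.
have oX : Defs.orthonormal G X.
  rewrite /Defs.orthonormal eL /X trmx_mul trmx_inv !mulmxA.
  by rewrite -(mulmxA P) mulVmx// mulmx1 -(mulmxA P) mulmxV ?unitmx_tr// mulmx1.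
have X0 : 0 < \det X by rewrite dX invr_gt0 normr_gt0.
have [_ /(_ phi psi X dph ch oX X0) ec] := theta_angle p.
have [[_ dp] [aps dq]] := ch.
have Vq : (cmap psi @` cdom psi) (cmap psi (F p)) by exists (F p).
rewrite (alternating_mulmx (form_multilinear aps Vq) (form_alternating aps Vq)) in ec.
have -> : Num.sqrt (\det G) = `|\det L|.
  by rewrite eL det_mulmx det_tr -expr2 sqrtr_sqr.
have c0 := cos_gt0 p; rewrite -[LHS]gtr0_norm// ec normrM dX normrV ?unitfE ?normr_eq0//.
by rewrite normr_id mulrC tangent_formE.
Qed.

(** The absolute value is insensitive to orientation, so the formula extends from direct charts to
    all charts. *)
Lemma cosE phi psi p : charts_at F phi psi p ->
  cos (theta p) = `|tangent_form phi psi (cmap phi p)| / Num.sqrt (\det (g phi (cmap phi p))).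
Proof.
move=> ch; have [phi0 [dph dp0]] := direct_cover O p.
have aph0 := direct_atlas dph.
have [[aph dp] [aps dq]] := ch.
have ch0 : charts_at F phi0 psi p by [].
rewrite (direct_cos dph ch0).
have [-> _] := source_form ch0 ch.
have [_ _ -> uT] := source_change F_imm g_induced aph0 aph aps dp0 dp dq.
have T0 : `|\det ('J (change phi phi0) (cmap phi p))| != 0.
  by rewrite normr_eq0; move: uT; rewrite unitmxE unitfE.
rewrite !det_mulmx det_tr mulrAC -expr2 sqrtrM ?sqr_ge0// sqrtr_sqr normrM.
by rewrite -mulf_div divff// mul1r.
Qed.

Lemma tangent_form_neq0 phi psi p : charts_at F phi psi p ->
  tangent_form phi psi (cmap phi p) != 0.
Proof.
move=> ch; apply/eqP => e; have := cos_gt0 p; rewrite (cosE ch) e.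
by rewrite normr0 mul0r ltxx.
Qed.

Lemma sin_ge0 p : 0 <= sin (theta p).
Proof. by apply: sin_ge0_pi; have [] := theta_angle p. Qed.

(** By [cosE], the last factor in [first_cousin] is the square of sin theta. *)
Lemma fluxc_bound phi psi i p : charts_at F phi psi p ->
  `|fluxc phi psi i (cmap phi p)| <= mean_curv_norm F g gN phi psi p * sin (theta p) *
     Num.sqrt (\det (row' i (col' i (g phi (cmap phi p))))).
Proof.
move=> ch; have [[aph dp] [aps dq]] := ch; have Ux := pdom_charts ch.
have LI := pair_immersion F_imm g_induced aph aps.
have Vq : (cmap psi @` cdom psi) (local_rep F phi psi (cmap phi p)) := li_UV LI Ux.
have pg := li_gram LI Ux.
have lin := form_multilinear aps Vq; have alt := form_alternating aps Vq.
have com V : Defs.orthonormal (gN psi (local_rep F phi psi (cmap phi p))) V ->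
    `|Om psi (local_rep F phi psi (cmap phi p)) V| <= 1.
  by rewrite local_repE//; have [H _] := Om_comass (conj aps dq); exact: H.
have H := first_cousin i (li_posx LI Ux) pg (mc_normal LI Ux) lin alt com (tangent_form_neq0 ch).
rewrite -(li_g LI Ux) in H pg.
have p' := posdef_det_gt0 (posdef_row' i pg).
have d0 := posdef_det_gt0 pg.
have h0 := ip_ge0 (mean_curv F g gN phi psi (cmap phi p)) (li_posx LI Ux).
have s0 := sin_ge0 p.
rewrite -[leRHS]ger0_norm; last by rewrite !mulr_ge0// sqrtr_ge0.
rewrite -ler_sqr ?nnegrE// !real_normK ?num_real//.
apply: le_trans H _; rewrite !exprMn sqr_sqrtr// sqr_sqrtr; last exact: ltW.
rewrite sin2cos2 (cosE ch) expr_div_n real_normK ?num_real// sqr_sqrtr; last exact: ltW.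
by rewrite mulrAC.
Qed.

Hypothesis H_parallel : parallel_mean_curv F g gN.

Lemma fluxc_divergence phi psi p : charts_at F phi psi p ->
  \sum_i 'D_(delta_mx 0 i) (fluxc phi psi i) (cmap phi p) =
  - (r.+1%:R * mean_curv_norm F g gN phi psi p ^+ 2 * tangent_form phi psi (cmap phi p)).
Proof.
move=> ch; have [[aph dp] [aps dq]] := ch; have Ux := pdom_charts ch.
have LI := pair_immersion F_imm g_induced aph aps.
rewrite mean_curv_normE sqr_sqrtr; last exact: (ip_ge0 _ (li_posx LI Ux)).
apply: (divergence_flux LI) => //.
- by move=> y; exact: form_multilinear.
- by move=> y; exact: form_alternating.
- by move=> W; exact: form_C1_on.
- by move=> y v W; exact: form_parallel.
- by move=> v; exact: H_parallel.
Qed.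

Lemma norm_target phi psi psi' p : charts_at F phi psi p -> charts_at F phi psi' p ->
  mean_curv_norm F g gN phi psi' p = mean_curv_norm F g gN phi psi p.
Proof.
move=> [[aph dp] [aps dq]] [_ [aps' dq']].
have [_ eH eG] := target_change F_imm g_induced aph aps aps' dp dq dq'.
by rewrite !mean_curv_normE eH !local_repE// eG ip_mul.
Qed.

Lemma norm_source phi phi' psi p : charts_at F phi psi p -> charts_at F phi' psi p ->
  mean_curv_norm F g gN phi' psi p = mean_curv_norm F g gN phi psi p.
Proof.
move=> [[aph dp] [aps dq]] [[aph' dp'] _].
have [_ eH _ _] := source_change F_imm g_induced aph aph' aps dp dp' dq.
by rewrite !mean_curv_normE eH !local_repE.
Qed.

Lemma norm_chart phi phi' psi psi' p : charts_at F phi psi p -> charts_at F phi' psi' p ->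
  mean_curv_norm F g gN phi' psi' p = mean_curv_norm F g gN phi psi p.
Proof.
move=> [h1 h2] [h3 h4]; exact: (etrans (norm_target (conj h3 h2) (conj h3 h4)) (norm_source (conj h1 h2) (conj h3 h2))).
Qed.

Lemma norm_local phi psi p : charts_at F phi psi p ->
  \forall q \near p, charts_at F phi psi q /\
    mean_curv_norm F g gN phi psi q = mean_curv_norm F g gN phi psi p.
Proof.
move=> ch; have [[aph dp] [aps dq]] := ch; have Ux := pdom_charts ch.
have LI := pair_immersion F_imm g_induced aph aps.
have oU := open_pdom F_imm (phi := phi) (psi := psi).
have /nbhs_ballP [e /= e0 eU] : nbhs (cmap phi p) (pdom F phi psi) by exact: open_nbhs_nbhs.
pose h x := ip (gN psi (local_rep F phi psi x)) (mean_curv F g gN phi psi x) (mean_curv F g gN phi psi x).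
have Ch : C1_on (pdom F phi psi) h.
  exact: (C1_on_ip oU (C1m_G LI) (C1m_mc LI) (C1m_mc LI)).
have cst y : ball (cmap phi p) e y -> h y = h (cmap phi p).
  apply: cst_on_ball => z; first by move=> /eU; exact: Ch.1.
  move=> v /eU Uz; apply: (mc_norm_cst LI Uz).
  by have [q [dq' dFq] e'] := Uz; rewrite -e'; apply: (H_parallel v).
have nb : nbhs p (cmap phi @^-1` ball (cmap phi p) e).
  by apply: (@cmap_continuous _ _ _ phi p dp); exact: nbhsx_ballx.
have nd : nbhs p (cdom phi) by apply: open_nbhs_nbhs; split=> //; exact: cdom_open.
have nF : nbhs p (F @^-1` cdom psi).
  by apply: (F_continuous F_imm); apply: open_nbhs_nbhs; split=> //; exact: cdom_open.
apply: filterS (filterI nb (filterI nd nF)) => q [/= bq [dq' dFq]].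
split; first exact: (conj (conj aph dq') (conj aps dFq)).
by rewrite !mean_curv_normE; exact: (congr1 Num.sqrt (cst _ bq)).
Qed.

(** The length depends on the charts in name only: a choice of charts at each point turns it into a
    function, which is locally constant, hence constant. *)
Lemma norm_constant : connected [set: M] -> exists2 h : R, 0 <= h &
  forall phi psi p, charts_at F phi psi p -> mean_curv_norm F g gN phi psi p = h.
Proof.
move=> M_conn.
have ex p : exists c : chart R M r.+1 * chart R N k, charts_at F c.1 c.2 p.
  have [phi [aph dp]] := atlas_cover p; have [psi [aps dq]] := atlas_cover (F p).
  by exists (phi, psi).
have [c Hc] := choice ex.
pose h p := mean_curv_norm F g gN (c p).1 (c p).2 p.
have hE phi psi p : charts_at F phi psi p -> mean_curv_norm F g gN phi psi p = h p.
  by move=> ch; exact: norm_chart.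
have hl p : \forall q \near p, h q = h p.
  apply: filterS (norm_local (Hc p)) => q [chq e].
  exact: (etrans (esym (hE _ _ _ chq)) e).
have oh (P : R -> Prop) : open [set p | P (h p)].
  by rewrite openE => p Pp; apply: filterS (hl p) => q /= ->.
pose p0 : M := point.
have : [set p | h p = h p0] = [set: M].
  apply: M_conn; first by exists p0.
    by exists [set p | h p = h p0]; [exact: (oh (fun t => t = h p0))|rewrite setTI].
  exists [set p | h p = h p0]; last by rewrite setTI.
  rewrite -(setCK [set p | h p = h p0]); apply: open_closedC.
  exact: (oh (fun t => t <> h p0)).
move=> e; exists (h p0) => [|phi psi p ch]; first exact: sqrtr_ge0.
rewrite (hE _ _ _ ch); have : [set: M] p by [].
by rewrite -e.
Qed.

Lemma norm0_mean_curv phi psi p : charts_at F phi psi p ->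
  mean_curv_norm F g gN phi psi p = 0 -> mean_curv F g gN phi psi (cmap phi p) = 0.
Proof.
move=> ch; have [[aph dp] [aps dq]] := ch; have Ux := pdom_charts ch.
have LI := pair_immersion F_imm g_induced aph aps.
have p0 := li_posx LI Ux.
move=> /eqP; rewrite mean_curv_normE sqrtr_eq0 => le0; apply: (ip_eq0 p0).
by apply/eqP; rewrite eq_le le0 ip_ge0.
Qed.

(** The flux vanishes identically, hence so does its divergence, a nonzero multiple of the squared
    length. This settles the case tau = 1 of the Cheeger estimate. *)
Lemma cos1_norm0 phi psi p : (forall q, cos (theta q) = 1) -> charts_at F phi psi p ->
  mean_curv_norm F g gN phi psi p = 0.
Proof.
move=> c1 ch; have [[aph dp] [aps dq]] := ch.
have oU := open_pdom F_imm (phi := phi) (psi := psi); have Ux := pdom_charts ch.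
have := fluxc_divergence ch; rewrite big1.
  move=> /esym/eqP; rewrite oppr_eq0 !mulf_eq0 (negPf (tangent_form_neq0 ch)) orbF.
  by rewrite pnatr_eq0 /= orbb => /eqP.
move=> i _; rewrite -(derive_cst (0 : R) (cmap phi p) (delta_mx 0 i)); apply: near_eq_derive.
apply: near_open Ux _ => // _ [q [dq' dFq] <-].
have chq : charts_at F phi psi q by [].
have s0 : sin (theta q) = 0.
  by apply/eqP; rewrite -sqrf_eq0 sin2cos2 c1 expr1n subrr.
by apply/eqP; rewrite -normr_le0 (le_trans (fluxc_bound i chq))// s0 mulr0 mul0r.
Qed.

Definition chart_grad (chi : M -> R) phi (p : M) : 'cV[R]_r.+1 :=
  \col_j 'D_(delta_mx 0 j) (chi \o cinv phi) (cmap phi p).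

Lemma chart_grad_change chi phi phi' p : chart_around phi p -> chart_around phi' p ->
  differentiable (chi \o cinv phi) (cmap phi p) ->
  chart_grad chi phi' p = 'J (change phi' phi) (cmap phi' p) *m chart_grad chi phi p.
Proof.
move=> [aph dp] [aph' dp'] dchi.
have [_ sT] := atlas_compatible aph aph'.
have Ux : (cmap phi' @` (cdom phi `&` cdom phi')) (cmap phi' p) by exists p.
have oU : open (cmap phi' @` (cdom phi `&` cdom phi')).
  by apply: open_chart_image; [apply: openI; exact: cdom_open|move=> q []].
have e : change phi' phi (cmap phi' p) = cmap phi p by rewrite /change /= cmapK.
have dT := smooth_on_differentiable sT Ux.
apply/colP => j; rewrite !mxE.
have -> : 'D_(delta_mx 0 j) (chi \o cinv phi') (cmap phi' p) =
    'D_(delta_mx 0 j) ((chi \o cinv phi) \o change phi' phi) (cmap phi' p).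
  apply: near_eq_derive; apply: near_open Ux _ => // _ [q [dq dq'] <-].
  by rewrite /change /= cmapK// cmapK.
rewrite (derive_comp _ dT) ?e//.
rewrite (derive_basis _ dchi); apply: eq_bigr => l _; rewrite !mxE; congr (_ * _).
have -> : 'D_(delta_mx 0 j) (change phi' phi) (cmap phi' p) = row j ('J (change phi' phi) (cmap phi' p)).
  by rewrite deriveEjacobian ?rowE.
by rewrite !mxE.
Qed.

(** The derivative of [chi] along the vector field whose components are the flux divided by the
    tangent form. *)
Definition flux_ratio chi phi psi p :=
  (\sum_i chart_grad chi phi p i 0 * fluxc phi psi i (cmap phi p)) /
    tangent_form phi psi (cmap phi p).

Lemma flux_ratio_chart chi phi psi phi' psi' p :
  charts_at F phi psi p -> charts_at F phi' psi' p ->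
  differentiable (chi \o cinv phi) (cmap phi p) ->
  flux_ratio chi phi' psi' p = flux_ratio chi phi psi p.
Proof.
move=> ch ch' dchi; have [h1 h2] := ch; have [h3 h4] := ch'.
have ch1 : charts_at F phi' psi p by [].
have [e1 e2] := target_form ch1 ch'; have [e3 e4] := source_form ch ch1.
have t0 := tangent_form_neq0 ch1; rewrite e3 in t0.
have E := etrans (eq_bigr _ (fun i _ => congr1 _ (e2 i))) (e4 (chart_grad chi phi p)).
rewrite /flux_ratio (chart_grad_change h1 h3 dchi).
apply: etrans (f_equal2 (fun a b => a / b) E (etrans e1 e3)) _.
exact: (ratio_scale _ t0).
Qed.

End Calibrated.

(** * Cut-off functions *)

Lemma telescope_prod (K : comNzRingType) (b : nat -> K) n :
  \sum_(0 <= a < n) b a * \prod_(0 <= c < a) (1 - b c) = 1 - \prod_(0 <= a < n) (1 - b a).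
Proof.
elim: n => [|n IH]; first by rewrite !big_geq// subrr.
by rewrite !big_nat_recr//= IH; ring.
Qed.

Section Boundary.
Context {R : realType} {m : nat} {M : manifold R m}.
Variables (D : set M).
Implicit Types (phi : chart R M m) (i : 'I_m).

Lemma boundary_chart_in phi i x : boundary_chart D phi i -> (cmap phi @` cdom phi) x ->
  D (cinv phi x) <-> x 0 i < 0.
Proof.
move=> [aph e] ix; split=> [Dx|x0].
  have : (cmap phi @` (cdom phi `&` D)) x.
    by exists (cinv phi x); [split=> //; exact: cinv_dom|exact: cinvK].
  by rewrite e => -[].
have : [set x | (cmap phi @` cdom phi) x /\ x 0 i < 0] x by [].
by rewrite -e => -[p [dp Dp] <-]; rewrite cmapK.
Qed.

Lemma boundary_chart_bd phi i x : boundary_chart D phi i -> (cmap phi @` cdom phi) x ->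
  x 0 i = 0 -> bd D (cinv phi x).
Proof.
move=> bc ix xi; split; last by rewrite (boundary_chart_in bc ix) xi ltxx.
move=> A /= Ax.
have nx : nbhs x (cinv phi @^-1` A) by exact: (@cinv_continuous _ _ _ phi x ix).
have ni : nbhs x (cmap phi @` cdom phi) by apply: open_nbhs_nbhs; split=> //; exact: cimg_open.
have [e /= e0 eB] := (nbhs_ballP x _).1 (filterI nx ni).
(* From the hyperplane [x_i = 0], a small step against coordinate [i] enters [D]. *)
pose y := x - (e / 2) *: delta_mx 0 i.
have By : ball x e y.
  rewrite -ball_normE /ball_ /= /y opprB addrCA subrr addr0 normrZ.
  rewrite gtr0_norm ?divr_gt0//; apply: (@le_lt_trans _ _ (e / 2)).
    have nd : `|delta_mx 0 i : 'rV[R]_m| <= 1.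
      rewrite (row_normE _ ler01); apply/forallP => j.
      by rewrite mxE eqxx /=; case: eqP => _; rewrite ?normr1 ?normr0 ?ler01.
    by rewrite -[leRHS]mulr1; apply: ler_wpM2l nd; rewrite ltW ?divr_gt0.
  by rewrite ltr_pdivrMr// ltr_pMr// ltr1n.
have [Ay iy] := eB _ By; exists (cinv phi y); split=> //.
apply/(boundary_chart_in bc iy).
by rewrite !mxE xi !eqxx mulr1 sub0r oppr_lt0 divr_gt0.
Qed.

End Boundary.

Section Cutoff.
Context {R : realType} {m : nat} {M : manifold R m}.
Variables (phi : chart R M m) (x0 : 'rV[R]_m) (e : R).
Hypotheses (aph : atlas phi) (e0 : 0 < e).
Hypothesis dom : ball x0 (3 * e) `<=` cmap phi @` cdom phi.

(** Three radii cooperate: the cut-off is 1 within [e], supported within [2 * e], and the chart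
    contains the ball of radius [3 * e]. *)
Definition cutoff (p : M) : R :=
  if `[< cdom phi p >] then box_bump x0 e (cmap phi p) else 0.

Lemma cutoff_ge0 p : 0 <= cutoff p.
Proof. by rewrite /cutoff; case: ifP => // _; exact: bump_ge0. Qed.

Lemma cutoff_le1 p : cutoff p <= 1.
Proof. by rewrite /cutoff; case: ifP => // _; exact: bump_le1. Qed.

Lemma cutoff_chart x : (cmap phi @` cdom phi) x -> cutoff (cinv phi x) = box_bump x0 e x.
Proof. by move=> ix; rewrite /cutoff asboolT ?cinvK//; exact: cinv_dom. Qed.

Definition inner : set M := cinv phi @` ball x0 e.
Definition outer : set M := cinv phi @` ball x0 (3 * e).
Let K : set M := cinv phi @` [set x | `|x - x0| <= 2 * e].

Lemma ball_norm (z : 'rV[R]_m) (d : R) x : ball z d x <-> `|x - z| < d.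
Proof. by rewrite -ball_normE /ball_ /= distrC. Qed.

Lemma closed_ball_dom : [set x | `|x - x0| <= 2 * e] `<=` cmap phi @` cdom phi.
Proof.
move=> x /= xK; apply: dom; apply/ball_norm; apply: (le_lt_trans xK).
by rewrite ltr_pM2r// ltr_nat.
Qed.

Lemma inner_dom : ball x0 e `<=` cmap phi @` cdom phi.
Proof.
move=> x /ball_norm xe; apply: dom; apply/ball_norm; apply: (lt_trans xe).
by rewrite ltr_pMl// ltr1n.
Qed.

Lemma open_inner : open inner.
Proof. by apply: open_chart_preimage; [exact: ball_open|exact: inner_dom]. Qed.

Lemma open_outer : open outer.
Proof. by apply: open_chart_preimage; [exact: ball_open|exact: dom]. Qed.

Lemma cutoff_inner p : inner p -> cutoff p = 1.
Proof.
move=> [x xe <-]; rewrite cutoff_chart; last exact: inner_dom.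
by apply: bump_eq1 => //; apply: ltW; exact/ball_norm.
Qed.

Lemma compact_rV_ball (z : 'rV[R]_m) (d : R) : compact [set x | `|x - z| <= d].
Proof.
apply: bounded_closed_compact.
  exists (`|z| + d); split; first exact: num_real.
  move=> C BC x /= Kx; apply: le_trans (ltW BC).
  by rewrite -(subrKC z x); apply: le_trans (ler_normD _ _) _; rewrite lerD2l.
apply: (@preimage_closed _ _ (fun x : 'rV[R]_m => `|x - z|) [set t : R | t <= d]); last exact: closed_le.
move=> x _; apply: (@continuous_comp _ _ _ (fun x : 'rV[R]_m => x - z) (fun y => `|y|)).
  by apply: (@continuousB _ _ _ id (cst z)); [exact: cvg_id|exact: cst_continuous].
exact: norm_continuous.
Qed.

(** The Hausdorff property enters here: the support must be closed in [M], not only in the chart,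
    for the extension by zero to be C^1. *)
Let closedK : closed K.
Proof.
apply: compact_closed; first exact: manifold_hausdorff.
apply: continuous_compact; last exact: compact_rV_ball.
apply: continuous_in_subspaceT => x /set_mem /closed_ball_dom ix.
exact: (@cinv_continuous _ _ _ phi x ix).
Qed.

Lemma cutoff_eq0 p : ~ K p -> cutoff p = 0.
Proof.
move=> nK; rewrite /cutoff; case: asboolP => // dp; apply: bump_eq0 => //.
rewrite leNgt; apply/negP => lt; apply: nK; exists (cmap phi p); last exact: cmapK.
exact: ltW.
Qed.

Lemma cutoff_near0 p : ~ outer p -> \forall q \near p, cutoff q = 0.
Proof.
move=> no; have nK : ~ K p.
  move=> [x /= xK ex]; apply: no; exists x => //; apply/ball_norm.
  by apply: (le_lt_trans xK); rewrite ltr_pM2r// ltr_nat.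
have : nbhs p (~` K) by apply: open_nbhs_nbhs; split=> //; exact: closed_openC.
by apply: filterS => q; exact: cutoff_eq0.
Qed.

Lemma cutoff_C1 phi' : atlas phi' -> C1_on (cmap phi' @` cdom phi') (cutoff \o cinv phi').
Proof.
move=> aph'; have oI := @cimg_open _ _ _ phi'; apply: C1_on_near => // x ix.
have [dp|ndp] := pselect (cdom phi (cinv phi' x)).
  have oA : open (cmap phi' @` (cdom phi `&` cdom phi')).
    by apply: open_chart_image; [apply: openI; exact: cdom_open|move=> q []].
  have xA : (cmap phi' @` (cdom phi `&` cdom phi')) x.
    by exists (cinv phi' x); [split=> //; exact: cinv_dom|exact: cinvK].
  exists (fun y => box_bump x0 e (change phi' phi y)), (cmap phi' @` (cdom phi `&` cdom phi')).
  split=> //.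
    have [_ sT] := atlas_compatible aph aph'.
    apply: (C1_on_comp oA _ _ (C1_on_bump x0 e (@openT 'rV[R]_m))) => // j.
    exact: (smooth_on_entry 0 j oA sT).
  apply: near_open xA _ => // _ [q [dq dq'] <-].
  by rewrite /change /= cmapK// /cutoff asboolT.
exists (cst 0), [set: 'rV[R]_m]; split=> //; [exact: openT|exact: C1_on_cst|].
have nK : ~ K (cinv phi' x).
  by move=> [y /closed_ball_dom iy e']; apply: ndp; rewrite -e'; exact: cinv_dom.
have nb : nbhs (cinv phi' x) (~` K).
  by apply: open_nbhs_nbhs; split=> //; exact: closed_openC.
have H : nbhs x (cinv phi' @^-1` (~` K)) := @cinv_continuous _ _ _ phi' x ix _ nb.
by apply: (filterS _ H) => y /= ny; rewrite cutoff_eq0.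
Qed.

End Cutoff.

(** * Boxes adapted to the domain *)

Section Boxes.
Context {R : realType} {r k : nat} {N : manifold R k} {M : manifold R r.+1}.
Variables (F : M -> N) (Om : dform N r.+1) (D : set M).

(* Near a box, D is the half-space x_i < c of a chart.  Away from the boundary
   of D, c is so large that the face x_i = c avoids the support of the cut-off
   of the box, and the face contributes nothing.  The sign bs makes Omega(J)
   positive on the box. *)
Record flow_box := FlowBox {
  bphi : chart R M r.+1;
  bpsi : chart R N k;
  bi : 'I_r.+1;
  bc : R;
  bs : R;
  bx : 'rV[R]_r.+1;
  be : R;
  b_aph : atlas bphi;
  b_aps : atlas bpsi;
  be_gt0 : 0 < be;
  b_dom : ball bx (3 * be) `<=` pdom F bphi bpsi;
  b_sgn : `|bs| = 1;
  b_pos : forall x, ball bx (3 * be) x -> 0 < bs * tangent_form F Om bphi bpsi x;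
  b_half : forall x, ball bx (3 * be) x -> (D (cinv bphi x) <-> x 0 bi < bc);
  b_kind : (bc = 0 /\ boundary_chart D bphi bi) \/ bx 0 bi + 2 * be <= bc
}.

Lemma pdom_img phi psi : pdom F phi psi `<=` cmap phi @` cdom phi.
Proof. by move=> _ [p [dp _] <-]; exists p. Qed.

Lemma box_dom B : ball (bx B) (3 * be B) `<=` cmap (bphi B) @` cdom (bphi B).
Proof. by move=> x /(@b_dom B) /pdom_img. Qed.

Definition bcut B := cutoff (bphi B) (bx B) (be B).
Definition bin B := inner (bphi B) (bx B) (be B).
Definition bout B := outer (bphi B) (bx B) (be B).

Variables (gN : metric N) (g : metric M).
Hypotheses (F_imm : immersion F) (g_induced : induced_metric F g gN).
Hypothesis tf0 : forall phi psi p, charts_at F phi psi p ->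
  tangent_form F Om phi psi (cmap phi p) != 0.
Hypothesis D_cpt : compact_domain D.

Lemma exists_box q : closure D q -> exists B : flow_box, bin B q.
Proof.
move=> cq; have [oD _ _ bdD] := D_cpt.
have [psi [aps dFq]] := atlas_cover (F q).
have [phi [i [[aph dq] kind]]] : exists phi i, chart_around phi q /\
    ((D q) \/ boundary_chart D phi i).
  have [Dq|nDq] := pselect (D q).
    by have [phi cp] := atlas_cover q; exists phi, ord0; split=> //; left.
  have [phi [i [dp bc]]] := bdD q (conj cq nDq).
  by exists phi, i; split; [split=> //; case: bc|right].
have ch : charts_at F phi psi q by [].
pose x := cmap phi q; pose s := Num.sg (tangent_form F Om phi psi x).
have Ux : pdom F phi psi x := pdom_charts ch.
have oU : open (pdom F phi psi) := open_pdom F_imm (phi := phi) (psi := psi).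
have ix : (cmap phi @` cdom phi) x := pdom_img Ux.
have n1 : nbhs x (pdom F phi psi) by exact: open_nbhs_nbhs.
have n2 : nbhs x [set y | 0 < s * tangent_form F Om phi psi y].
  have Ct := tangent_form_C1 F_imm g_induced Om aph aps.
  have cs : {for x, continuous (fun y => s * tangent_form F Om phi psi y)}.
    exact: (C1_on_continuous (C1_onM oU (C1_on_cst _ s) Ct) Ux).
  apply: (cs [set t | 0 < t]); apply: (open_nbhs_nbhs (conj (@open_gt _ 0) _)).
  by rewrite /= /s -normrEsg normr_gt0; exact: tf0.
have [Dq|bc] := kind.
- have n3 : nbhs x (cinv phi @^-1` D).
    apply: (@cinv_continuous _ _ _ phi x ix); rewrite /x cmapK//.
    exact: open_nbhs_nbhs.
  have [d /= d0 dB] := (nbhs_ballP x _).1 (filterI n1 (filterI n2 n3)).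
  have d3 : 3 * (d / 3) = d by rewrite mulrC divfK.
  have d30 : 0 < d / 3 by rewrite divr_gt0.
  (* The ball of radius [d] lies in [D] and also below this face, so the half-space condition holds
     trivially there; [2 * (d / 3) <= d] keeps the face off the support. *)
  unshelve eexists (@FlowBox phi psi i (x 0 i + d) s x (d / 3) aph aps d30 _ _ _ _ _).
  + by rewrite d3 => y /dB [].
  + by rewrite /s; apply/eqP; rewrite normr_sg (tf0 ch).
  + by rewrite d3 => y /dB [_ []].
  + rewrite d3 => y By; split=> [_|_]; last by have [_ []] := dB _ By.
    have := (ballrVE _ _ d0).1 By i; rewrite distrC => /ltr_normlW.
    by rewrite ltrBlDr addrC.
  + by right; rewrite lerD2l -{2}d3 ler_pM2r// ler_nat.
  by exists x; [exact: ballxx|rewrite /x /= cmapK].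
- have [d /= d0 dB] := (nbhs_ballP x _).1 (filterI n1 n2).
  have d3 : 3 * (d / 3) = d by rewrite mulrC divfK.
  have d30 : 0 < d / 3 by rewrite divr_gt0.
  unshelve eexists (@FlowBox phi psi i 0 s x (d / 3) aph aps d30 _ _ _ _ _).
  + by rewrite d3 => y /dB [].
  + by rewrite /s; apply/eqP; rewrite normr_sg (tf0 ch).
  + by rewrite d3 => y /dB [].
  + by rewrite d3 => y /dB [/pdom_img iy _]; exact: boundary_chart_in.
  + by left.
  by exists x; [exact: ballxx|rewrite /x /= cmapK].
Qed.

Lemma exists_boxes : exists (B : nat -> flow_box) (n : nat),
  forall p, closure D p -> exists2 a, (a < n)%N & bin (B a) p.
Proof.
have [oD [q0 Dq0] cD _] := D_cpt.
have [B0 _] := exists_box (subset_closure Dq0).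
have ex q : exists B : flow_box, closure D q -> bin B q.
  have [cq|ncq] := pselect (closure D q); last by exists B0.
  by have [B] := exists_box cq; exists B.
have [f Hf] := choice ex.
move: cD; rewrite compact_cover => /(_ M (closure D) (fun q => bin (f q))).
case.
- move=> q _; apply: open_inner; [exact: be_gt0|exact: box_dom].
- by move=> q cq; exists q => //; exact: Hf.
move=> A _ cov; pose s := finmap.enum_fset A.
(* The finite subcover is listed as a sequence because the partition of unity depends on an order of
   the boxes. *)
exists (fun a => f (nth q0 s a)), (size s) => p /cov [q qA fq].
by exists (index q s); rewrite ?index_mem// nth_index.
Qed.

End Boxes.

Section ZeroExtension.
Context {R : realType} {a : nat}.
Variables (x0 : 'rV[R]_a) (e : R) (q : 'rV[R]_a -> R).
Hypothesis e0 : 0 < e.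
Hypothesis q0 : forall x, `|x - x0| < 3 * e -> 2 * e <= `|x - x0| -> q x = 0.

(** [q] is a chart expression without meaning outside the ball of radius [3 * e]. As it vanishes
    between [2 * e] and [3 * e], replacing it by 0 outside preserves its regularity. *)
Definition zext x := if `|x - x0| < 3 * e then q x else 0.

Lemma zext_eq0 x : 2 * e <= `|x - x0| -> zext x = 0.
Proof. by rewrite /zext; case: ifP => // xe; exact: q0. Qed.

Lemma zext_support x : `|x0| + 2 * e <= `|x| -> zext x = 0.
Proof.
by move=> xb; apply: zext_eq0; have := lerB_dist x x0; apply: le_trans; rewrite lerBrDl.
Qed.

Lemma dist_continuous : continuous (fun x : 'rV[R]_a => `|x - x0|).
Proof.
move=> x; apply: (@continuous_comp _ _ _ (fun x : 'rV[R]_a => x - x0) (fun y => `|y|)).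
  by apply: (@continuousB _ _ _ id (cst x0)); [exact: cvg_id|exact: cst_continuous].
exact: norm_continuous.
Qed.

Lemma zext_near_in x : `|x - x0| < 3 * e -> \forall y \near x, zext y = q y.
Proof.
move=> xe; have H : nbhs x [set y | `|y - x0| < 3 * e].
  by apply: (@dist_continuous x [set t | t < 3 * e]); exact: lt_nbhsl.
by apply: filterS H => y /= ye; rewrite /zext ye.
Qed.

Lemma zext_near_out x : ~~ (`|x - x0| < 3 * e) -> \forall y \near x, zext y = 0.
Proof.
rewrite -leNgt => xe; have H : nbhs x [set y | 2 * e < `|y - x0|].
  apply: (@dist_continuous x [set t | 2 * e < t]); apply: lt_nbhsr.
  by apply: lt_le_trans xe; rewrite ltr_pM2r// ltr_nat.
by apply: filterS H => y /= ye; rewrite zext_eq0// ltW.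
Qed.

Lemma zext_continuous : (forall x, `|x - x0| < 3 * e -> {for x, continuous q}) ->
  continuous zext.
Proof.
move=> cq x; have [xe|xe] := boolP (`|x - x0| < 3 * e).
  exact: near_eq_continuous (zext_near_in xe) (cq x xe).
exact: (near_eq_continuous (zext_near_out xe) (@cst_continuous _ _ (0 : R) x)).
Qed.

Lemma zext_C1 : C1_on (ball x0 (3 * e)) q -> C1_on [set: 'rV[R]_a] zext.
Proof.
move=> Cq; apply: C1_on_near; first exact: openT.
move=> x _; have [xe|xe] := boolP (`|x - x0| < 3 * e).
  exists q, (ball x0 (3 * e)); split=> //; [exact: ball_open|exact/ball_norm|exact: zext_near_in].
exists (cst 0), [set: 'rV[R]_a]; split=> //; [exact: openT|exact: C1_on_cst|exact: zext_near_out].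
Qed.

Lemma zext_integrable : (forall x, `|x - x0| < 3 * e -> {for x, continuous q}) ->
  (lam a).-integrable [set: borel 'rV[R]_a] (fun x => (zext x)%:E).
Proof.
move=> cq; have cz := zext_continuous cq.
have [C HC] := bounded_support cz zext_support.
exact: (bounded_support_integrable (borel_continuousT cz) HC zext_support).
Qed.

End ZeroExtension.

Section VolumeTransfer.
Context {R : realType} {m : nat} {M : manifold R m} (g : metric M).
Variables (phi : chart R M m) (aph : atlas phi).

Lemma metric_C1 i j : C1_on (cmap phi @` cdom phi) (fun x => g phi x i j).
Proof. exact: (smooth_on_entry i j (@cimg_open _ _ _ phi) (gmx_smooth g aph)). Qed.

Lemma sqrt_det_continuous x : (cmap phi @` cdom phi) x ->
  {for x, continuous (fun y => Num.sqrt (\det (g phi y)))}.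
Proof.
move=> ix; have C := C1_on_det (@cimg_open _ _ _ phi) metric_C1.
apply: (@continuous_comp _ _ _ (fun y => \det (g phi y)) Num.sqrt).
  exact: (C1_on_continuous C ix).
exact: sqrt_continuous.
Qed.

Lemma metric_det_gt0 x : (cmap phi @` cdom phi) x -> 0 < \det (g phi x).
Proof. by move=> ix; apply: posdef_det_gt0; exact: (metric_posdef g aph). Qed.

Variables (mu : {measure set (borel M) -> \bar R}) (mu_vol : riemannian_measure g mu).
Variables (P : set 'rV[R]_m) (oP : open P) (Pd : P `<=` cmap phi @` cdom phi).
Let E : set M := cinv phi @` P.
Let rho y := Num.sqrt (\det (g phi y)).

Let oE : open E. Proof. exact: open_chart_preimage. Qed.
Let mE : measurable (E : set (borel M)). Proof. exact: borel_open. Qed.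
Let mP : measurable (P : set (borel 'rV[R]_m)). Proof. exact: borel_open. Qed.
Let mci : measurable_fun (P : set (borel 'rV[R]_m)) (cinv phi : borel _ -> borel M).
Proof. by apply: borel_continuous_map => // x Px; apply: cinv_continuous; exact: Pd. Qed.
Let mrho : measurable_fun (P : set (borel 'rV[R]_m)) (rho : borel _ -> R).
Proof. by apply: borel_continuous => // x Px; apply: sqrt_det_continuous; exact: Pd. Qed.
Let cPE y : P y -> E (cinv phi y). Proof. by move=> Py; exists y. Qed.
Let rho0 y : P y -> 0 <= rho y. Proof. by move=> _; exact: sqrtr_ge0. Qed.

(** Puts the definition of the Riemannian measure in the form that the transfer lemmas take: an
    integral over the open set [P] against [lam]. *)
Let muE (A : set (borel M)) : measurable A -> A `<=` E ->
  (mu A = \int[lam m]_(y in P) (\1_A (cinv phi y) * rho y)%:E)%E.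
Proof.
move=> mA AE; have Ad : A `<=` cdom phi.
  by move=> p /AE [x /Pd ix <-]; exact: cinv_dom.
rewrite (mu_vol aph mA Ad).
have e : (fun x => (\1_(cmap phi @` A) x * Num.sqrt (\det (g phi x)))%:E) =
    ((fun y => (\1_A (cinv phi y) * rho y)%:E) \_ P).
  apply/funext => x; rewrite patchE; case: ifPn => [/set_mem Px|/negP nPx].
    rewrite /rho !indicE; congr ((_%:R * _)%:E); congr nat_of_bool.
    apply/idP/idP => /set_mem H; apply/mem_set.
      by have [p Ap <-] := H; rewrite cmapK//; exact: Ad.
    by exists (cinv phi x) => //; rewrite cinvK//; exact: Pd.
  rewrite indicE memNset ?mul0r// => -[p Ap px]; apply: nPx; apply/mem_set.
  by have [y Py yp] := AE _ Ap; rewrite -px -yp cinvK//; exact: Pd.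
have mG : measurable_fun (P : set (borel 'rV[R]_m))
    (fun y : borel 'rV[R]_m => (\1_A (cinv phi y) * rho y)%:E).
  apply/measurable_EFinP; apply: measurable_funM => //.
  have mA1 : measurable_fun (E : set (borel M)) (\1_A : borel M -> R).
    exact: measurable_indic.
  by apply: (measurable_comp mE _ mA1 mci) => _ [y Py <-]; exact: cPE.
rewrite e -lamI; first by rewrite [RHS]integral_mkcond.
  exact: (measurable_restrictT _ mP).1.
move=> x; rewrite patchE; case: ifP => // _; rewrite lee_fin mulr_ge0//.
exact: sqrtr_ge0.
Qed.

Lemma vol_ge0 (f : M -> R) : measurable_fun (E : set (borel M)) (f : borel M -> R) ->
  (forall p, E p -> 0 <= f p) ->
  (\int[mu]_(x in E) (f x)%:E = \int[lam m]_(y in P) (f (cinv phi y) * rho y)%:E)%E.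
Proof. by move=> mf f0; exact: (transfer_ge0 mE mP mci cPE mrho rho0 muE). Qed.

Lemma vol_transfer (f : M -> R) : measurable_fun (E : set (borel M)) (f : borel M -> R) ->
  (lam m).-integrable P (fun y => (f (cinv phi y) * rho y)%:E) ->
  mu.-integrable E (EFin \o f) /\
  (\int[mu]_(x in E) (f x)%:E = \int[lam m]_(y in P) (f (cinv phi y) * rho y)%:E)%E.
Proof. by move=> mf fi; exact: (transfer mE mP mci cPE mrho rho0 muE). Qed.

End VolumeTransfer.

Lemma continuous_insr (R : realType) r (i : 'I_r.+1) (t : R) : continuous (@insr R r i t).
Proof.
move=> y; apply: entry_continuous => l j; rewrite (ord1 l).
apply: (@near_eq_continuous _ _ _ (fun y : 'rV[R]_r => if unlift i j is Some j' then y 0 j' else t)).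
  by apply: (near_open (@openT 'rV[R]_r) I) => z _; rewrite mxE.
by case: unliftP => [j' _|_]; [exact: coord_continuous|exact: cst_continuous].
Qed.

Section FaceDensity.
Context {R : realType} {r : nat} {M : manifold R r.+1} (g : metric M).
Variables (phi : chart R M r.+1) (aph : atlas phi) (i : 'I_r.+1).

Definition face_density (x : 'rV[R]_r.+1) := Num.sqrt (\det (row' i (col' i (g phi x)))).

Lemma face_density_continuous x : (cmap phi @` cdom phi) x -> {for x, continuous face_density}.
Proof.
move=> ix; have C : C1_on (cmap phi @` cdom phi) (fun x => \det (row' i (col' i (g phi x)))).
  apply: (C1_on_det (@cimg_open _ _ _ phi)) => a b.
  by under eq_fun do rewrite !mxE; exact: metric_C1.
apply: (@continuous_comp _ _ _ (fun y => \det (row' i (col' i (g phi y)))) Num.sqrt).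
  exact: (C1_on_continuous C ix).
exact: sqrt_continuous.
Qed.

End FaceDensity.

Section AreaTransfer.
Context {R : realType} {r : nat} {M : manifold R r.+1} (g : metric M).
Variables (D : set M) (oD : open D) (phi : chart R M r.+1) (i : 'I_r.+1).
Hypothesis bcD : boundary_chart D phi i.
Let aph : atlas phi. Proof. by case: bcD. Qed.

Variables (sigma : {measure set (borel M) -> \bar R}) (bm : boundary_measure g D sigma).
Variables (B : set 'rV[R]_r.+1) (oB : open B) (Bd : B `<=` cmap phi @` cdom phi).
Let E : set M := bd D `&` cinv phi @` B.
Let P : set 'rV[R]_r := [set y | B (insr i 0 y)].
Let c y := cinv phi (insr i 0 y).
Let rho y := face_density g phi i (insr i 0 y).

Let oP : open P.
Proof. by apply: open_comp => // y _; exact: continuous_insr. Qed.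
Let mE : measurable (E : set (borel M)).
Proof.
apply: measurableI; last by apply: borel_open; exact: open_chart_preimage.
by apply: borel_closed; apply: closedI; [exact: closed_closure|exact: open_closedC].
Qed.
Let mP : measurable (P : set (borel 'rV[R]_r)). Proof. exact: borel_open. Qed.
Let mci : measurable_fun (P : set (borel 'rV[R]_r)) (c : borel _ -> borel M).
Proof.
apply: borel_continuous_map => // x Px; apply: continuous_comp; first exact: continuous_insr.
by apply: cinv_continuous; exact: Bd.
Qed.
Let mrho : measurable_fun (P : set (borel 'rV[R]_r)) (rho : borel _ -> R).
Proof.
apply: borel_continuous => // x Px; apply: continuous_comp; first exact: continuous_insr.
by apply: face_density_continuous; [exact: aph|exact: Bd].
Qed.
Let cPE y : P y -> E (c y).
Proof.
move=> Py; split; last by exists (insr i 0 y).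
by apply: (boundary_chart_bd bcD); [exact: Bd|rewrite insr_id].
Qed.
Let rho0 y : P y -> 0 <= rho y. Proof. by move=> _; exact: sqrtr_ge0. Qed.

Let sigmaE (A : set (borel M)) : measurable A -> A `<=` E ->
  (sigma A = \int[lam r]_(y in P) (\1_A (c y) * rho y)%:E)%E.
Proof.
move=> mA AE; have Ad : A `<=` cdom phi `&` bd D.
  by move=> p /AE [bp [x /Bd ix e]]; split=> //; rewrite -e; exact: cinv_dom.
rewrite (bm.2 _ _ _ bcD mA Ad).
have e : (fun y : 'rV[R]_r => (\1_(cmap phi @` A) (insert0 i y) *
       Num.sqrt (\det (row' i (col' i (g phi (insert0 i y))))))%:E) =
    ((fun y => (\1_A (c y) * rho y)%:E) \_ P).
  apply/funext => y; rewrite patchE -[insert0 i y]/(insr i 0 y).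
  case: ifPn => [/set_mem Px|/negP nPx].
    rewrite /rho /c !indicE; congr ((_%:R * _)%:E); congr nat_of_bool.
    apply/idP/idP => /set_mem H; apply/mem_set.
      by have [p Ap <-] := H; rewrite cmapK//; exact: (Ad _ Ap).1.
    by exists (cinv phi (insr i 0 y)) => //; rewrite cinvK//; exact: Bd.
  rewrite indicE memNset ?mul0r// => -[p Ap px]; apply: nPx; apply/mem_set.
  by have [_ [z Bz zp]] := AE _ Ap; rewrite /P /= -px -zp cinvK//; exact: Bd.
have mG : measurable_fun (P : set (borel 'rV[R]_r))
    (fun y : borel 'rV[R]_r => (\1_A (c y) * rho y)%:E).
  apply/measurable_EFinP; apply: measurable_funM => //.
  have mA1 : measurable_fun (E : set (borel M)) (\1_A : borel M -> R).
    exact: measurable_indic.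
  by apply: (measurable_comp mE _ mA1 mci) => _ [y Py <-]; exact: cPE.
rewrite [LHS]/= e -lamI; first by rewrite [RHS]integral_mkcond.
  exact: (measurable_restrictT _ mP).1.
move=> x; rewrite patchE; case: ifP => // _; rewrite lee_fin mulr_ge0//.
exact: sqrtr_ge0.
Qed.

Lemma area_ge0 (f : M -> R) : measurable_fun (E : set (borel M)) (f : borel M -> R) ->
  (forall p, E p -> 0 <= f p) ->
  (\int[sigma]_(x in E) (f x)%:E = \int[lam r]_(y in P) (f (c y) * rho y)%:E)%E.
Proof. by move=> mf f0; exact: (transfer_ge0 mE mP mci cPE mrho rho0 sigmaE). Qed.

End AreaTransfer.

Lemma box_algebra (K : fieldType) (s t d rt x c : K) : t != 0 ->
  s * t / d * (x * c - rt / t) = - s * (rt - x * (c * t)) / d.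
Proof.
move=> t0; have -> : s * t / d * (x * c - rt / t) = s / d * (t * (x * c) - t * (rt / t)) by ring.
by rewrite [t * (rt / t)]mulrC divfK//; ring.
Qed.

(** * The partition of unity and the localised flux *)

Section Partition.
Context {R : realType} {r k : nat} {N : manifold R k} {M : manifold R r.+1}.
Variables (F : M -> N) (Om : dform N r.+1) (D : set M).
Variables (B : nat -> flow_box F Om D) (n : nat).
Hypothesis cov : forall p, closure D p -> exists2 a, (a < n)%N & bin (B a) p.

(** The sum telescopes to one minus the product of all [1 - bcut], which is 1 wherever some cut-off
    equals 1; no division by a sum is involved. *)
Definition chi a p := bcut (B a) p * \prod_(0 <= c < a) (1 - bcut (B c) p).

Lemma chi_ge0 a p : 0 <= chi a p.
Proof.
apply: mulr_ge0; first exact: cutoff_ge0.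
by apply: prodr_ge0 => c _; rewrite subr_ge0 cutoff_le1.
Qed.

Lemma bcut_C1 b phi : atlas phi -> C1_on (cmap phi @` cdom phi) (bcut (B b) \o cinv phi).
Proof.
exact: (cutoff_C1 (b_aph (B b)) (be_gt0 (B b)) (@box_dom _ _ _ _ _ _ _ _ (B b))).
Qed.

Lemma chi_C1 a phi : atlas phi -> C1_on (cmap phi @` cdom phi) (chi a \o cinv phi).
Proof.
move=> aph; have oI := @cimg_open _ _ _ phi.
have C c := bcut_C1 c aph.
apply: (C1_onM oI (C a)).
exact: (C1_on_prod _ oI (fun c (_ : xpredT c) => C1_onB oI (C1_on_cst _ 1) (C c))).
Qed.

Lemma chi_near0 a p : ~ bout (B a) p -> \forall q \near p, chi a q = 0.
Proof.
move=> nb.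
have := cutoff_near0 (be_gt0 (B a)) (@box_dom _ _ _ _ _ _ _ _ (B a)) nb.
by apply: filterS => q e; rewrite /chi /bcut e mul0r.
Qed.

Lemma chi_ball0 a x : `|x - bx (B a)| < 3 * be (B a) -> 2 * be (B a) <= `|x - bx (B a)| ->
  chi a (cinv (bphi (B a)) x) = 0.
Proof.
move=> h1 h2; rewrite /chi /bcut cutoff_chart ?bump_eq0 ?mul0r//; first exact: be_gt0.
by apply: (box_dom (B := B a)); exact/ball_norm.
Qed.

(** Stated near [p] and not only at [p], because the gradient of the sum has to vanish too. The
    product in the telescoping formula contains a zero factor. *)
Lemma chi_sum p : closure D p -> \forall q \near p, \sum_(0 <= a < n) chi a q = 1.
Proof.
move=> /cov [a an ba]; have oi : open (bin (B a)).
  exact: (open_inner (be_gt0 (B a)) (@box_dom _ _ _ _ _ _ _ _ (B a))).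
have : nbhs p (bin (B a)) by exact: open_nbhs_nbhs.
apply: filterS => q bq; rewrite /chi telescope_prod.
rewrite (@big_cat_nat _ _ _ a.+1) //= big_nat_recr//=.
by rewrite {2}/bcut (cutoff_inner (be_gt0 (B a)) (@box_dom _ _ _ _ _ _ _ _ (B a)) bq)
  subrr mulr0 mul0r subr0.
Qed.

Variables (gN : metric N) (g : metric M).
Hypotheses (F_imm : immersion F) (g_induced : induced_metric F g gN).
Hypotheses (Om_comass : comass_one gN Om) (Om_par : parallel_form gN Om).
Variables (O : orientation M) (theta : M -> R).
Hypothesis (r_gt0 : (0 < r)%N) (theta_angle : omega_angle F g O Om theta).
Hypothesis cos_gt0 : forall p, 0 < cos (theta p).
Hypothesis H_parallel : parallel_mean_curv F g gN.
Variable h : R.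
Hypothesis hE : forall phi psi p, charts_at F phi psi p -> mean_curv_norm F g gN phi psi p = h.

Local Notation tf := (tangent_form F Om).
Local Notation flx := (fluxc gN g F Om).

Definition qfun a j x := chi a (cinv (bphi (B a)) x) * flx (bphi (B a)) (bpsi (B a)) j x.
Definition fld a j := zext (bx (B a)) (be (B a)) (qfun a j).

Lemma qfun_C1 a j : C1_on (ball (bx (B a)) (3 * be (B a))) (qfun a j).
Proof.
have oB := @ball_open _ _ (bx (B a)) (3 * be (B a)).
apply: (C1_onM oB).
  exact: (C1_onS (@box_dom _ _ _ _ _ _ _ _ (B a)) (chi_C1 a (b_aph (B a)))).
exact: (C1_onS (@b_dom _ _ _ _ _ _ _ _ (B a))
  (fluxc_C1 F_imm g_induced Om j (b_aph (B a)) (b_aps (B a)))).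
Qed.

Lemma qfun_ball0 a j x : `|x - bx (B a)| < 3 * be (B a) ->
  2 * be (B a) <= `|x - bx (B a)| -> qfun a j x = 0.
Proof. by move=> h1 h2; rewrite /qfun chi_ball0// mul0r. Qed.

Lemma fld_C1 a j : C1_on [set: 'rV[R]_r.+1] (fld a j).
Proof. exact: (zext_C1 (be_gt0 (B a)) (@qfun_ball0 a j) (@qfun_C1 a j)). Qed.

(* Minus the divergence of the vector field with density chi_a u, in the
   orientation where Omega(J) > 0. *)
Definition kap a p : R := if `[< bout (B a) p >] then
  - bs (B a) * (\sum_j 'D_(delta_mx 0 j) (fld a j) (cmap (bphi (B a)) p)) /
    Num.sqrt (\det (g (bphi (B a)) (cmap (bphi (B a)) p))) else 0.

Lemma box_charts a x : ball (bx (B a)) (3 * be (B a)) x ->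
  charts_at F (bphi (B a)) (bpsi (B a)) (cinv (bphi (B a)) x).
Proof.
move=> bx; have [p [dp dq] <-] := b_dom bx; rewrite cmapK//.
by split; split=> //; [exact: b_aph|exact: b_aps].
Qed.

Lemma fld_divergence a x : ball (bx (B a)) (3 * be (B a)) x ->
  let p := cinv (bphi (B a)) x in
  \sum_j 'D_(delta_mx 0 j) (fld a j) x =
  \sum_j chart_grad (chi a) (bphi (B a)) p j 0 * flx (bphi (B a)) (bpsi (B a)) j x
  - chi a p * (r.+1%:R * h ^+ 2 * tf (bphi (B a)) (bpsi (B a)) x).
Proof.
move=> bx p; have ch := box_charts bx.
have ex : cmap (bphi (B a)) p = x by apply: cinvK; exact: box_dom.
have ix := box_dom bx.
have := fluxc_divergence F_imm g_induced Om_par H_parallel ch.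
rewrite (hE ch) -/p ex => dv.
have E j : 'D_(delta_mx 0 j) (fld a j) x =
    chart_grad (chi a) (bphi (B a)) p j 0 * flx (bphi (B a)) (bpsi (B a)) j x +
    chi a p * 'D_(delta_mx 0 j) (flx (bphi (B a)) (bpsi (B a)) j) x.
  rewrite mxE ex.
  have -> : 'D_(delta_mx 0 j) (fld a j) x = 'D_(delta_mx 0 j) (qfun a j) x.
    apply: near_eq_derive; apply: zext_near_in; exact/ball_norm.
  apply: derive_prod2; apply: diff_derivable.
    exact: ((chi_C1 a (b_aph (B a))).1 x ix).
  exact: ((fluxc_C1 F_imm g_induced Om j (b_aph (B a)) (b_aps (B a))).1 x (b_dom bx)).
apply: etrans (eq_bigr _ (fun j _ => E j)) _.
rewrite big_split /= -mulr_sumr; congr (_ + _).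
by apply: etrans (congr1 _ dv) _; rewrite mulrN.
Qed.

(** [kap] is defined in the charts of its own box; this expression is valid in any charts, so that
    the contributions of different boxes can be added at a point. *)
Lemma kapE a phi psi p : charts_at F phi psi p ->
  kap a p = cos (theta p) * (chi a p * (r.+1%:R * h ^+ 2)
     - flux_ratio gN g F Om (chi a) phi psi p).
Proof.
move=> ch0; have [bp|nbp] := pselect (bout (B a) p); last first.
  rewrite /kap asboolF//.
  (* Outside the box [chi a] vanishes near [p], and its gradient with it, so both sides are 0. *)
  have c0 := chi_near0 nbp; have [[aph dp] _] := ch0.
  have ix : (cmap phi @` cdom phi) (cmap phi p) by exists p.
  have H : \forall x \near cmap phi p, (chi a \o cinv phi) x = 0.
    apply: (@cinv_continuous _ _ _ phi _ ix [set q | chi a q = 0]).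
    by rewrite cmapK.
  have -> : flux_ratio gN g F Om (chi a) phi psi p = 0.
    rewrite /flux_ratio big1 ?mul0r// => i _; rewrite mxE.
    have -> : 'D_(delta_mx 0 i) (chi a \o cinv phi) (cmap phi p) = 0.
      by apply: etrans (near_eq_derive _ H) _; exact: derive_cst.
    by rewrite mul0r.
  by rewrite (nbhs_singleton c0) mul0r subr0 mulr0.
rewrite /kap asboolT//; move: bp => [x Bx ex].
have ch : charts_at F (bphi (B a)) (bpsi (B a)) p by rewrite -ex; exact: box_charts.
have cx : cmap (bphi (B a)) p = x by rewrite -ex; apply: cinvK; exact: box_dom.
have dchi : differentiable (chi a \o cinv phi) (cmap phi p).
  have [[aph dp] _] := ch0; apply: (chi_C1 a aph).1; by exists p.
rewrite -(flux_ratio_chart F_imm g_induced r_gt0 theta_angle cos_gt0 ch0 ch dchi).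
rewrite (cosE F_imm g_induced r_gt0 theta_angle cos_gt0 ch) /flux_ratio.
have t0 := tangent_form_neq0 F_imm g_induced r_gt0 theta_angle cos_gt0 ch.
rewrite cx in t0 *.
rewrite (fld_divergence Bx) ex.
have -> : `|tf (bphi (B a)) (bpsi (B a)) x| = bs (B a) * tf (bphi (B a)) (bpsi (B a)) x.
  by rewrite -[RHS]gtr0_norm ?normrM ?b_sgn ?mul1r//; exact: b_pos.
by rewrite (box_algebra _ _ _ _ _ t0).
Qed.

(** The gradients of the [chi a] add up to that of the constant 1, so the flux ratios cancel. *)
Lemma kap_sum p : D p -> \sum_(0 <= a < n) kap a p = cos (theta p) * (r.+1%:R * h ^+ 2).
Proof.
move=> Dp; have [phi [aph dp]] := atlas_cover p; have [psi [aps dq]] := atlas_cover (F p).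
have ch : charts_at F phi psi p by [].
have near1 := chi_sum (subset_closure Dp).
apply: etrans (eq_bigr _ (fun a _ => kapE a ch)) _.
rewrite -mulr_sumr; congr (_ * _); rewrite sumrB -mulr_suml (nbhs_singleton near1) mul1r.
rewrite [X in _ - X](_ : _ = 0) ?subr0//.
rewrite /flux_ratio -mulr_suml exchange_big /= big1 ?mul0r// => i _.
rewrite -mulr_suml [X in X * _](_ : _ = 0) ?mul0r//.
have ix : (cmap phi @` cdom phi) (cmap phi p) by exists p.
have dC a : derivable (chi a \o cinv phi) (cmap phi p) (delta_mx 0 i).
  by apply: diff_derivable; exact: ((chi_C1 a aph).1 _ ix).
have [_ e] := @derive_sum_seq _ _ _ (index_iota 0 n) xpredT _ _ _ (fun a _ => dC a).
have H : \forall x \near cmap phi p, \sum_(0 <= a < n) (chi a \o cinv phi) x = 1.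
  apply: (@cinv_continuous _ _ _ phi _ ix [set q | \sum_(0 <= a < n) chi a q = 1]).
  by rewrite cmapK.
have g1 a : chart_grad (chi a) phi p i 0 = 'D_(delta_mx 0 i) (chi a \o cinv phi) (cmap phi p).
  by rewrite mxE.
apply: etrans (eq_bigr _ (fun a _ => g1 a)) (etrans (esym e) _).
by apply: etrans (near_eq_derive _ H) _; exact: derive_cst.
Qed.

End Partition.

(** * The divergence theorem on a compact domain *)

Section Restriction.
Context d (T : measurableType d) (R : realType) (mu : {measure set T -> \bar R}).
Variables (D E : set T) (mD : measurable D) (mE : measurable E) (ED : E `<=` D).

Lemma integral_restriction (f : T -> \bar R) : (forall x, D x -> ~ E x -> f x = 0%E) ->
  (\int[mu]_(x in D) f x = \int[mu]_(x in E) f x)%E.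
Proof.
move=> f0; rewrite -[in RHS](setIidr ED) integral_mkcondr; apply: eq_integral => x /[!inE] Dx.
rewrite patchE; case: ifPn => // /negP nE; apply: f0 => // Ex; apply: nE; exact/mem_set.
Qed.

Lemma integrable_restriction (f : T -> \bar R) : (forall x, D x -> ~ E x -> f x = 0%E) ->
  mu.-integrable E f -> mu.-integrable D f.
Proof.
move=> f0 fE; have := (@integrable_restrict _ _ _ mu _ mE _ mD f).1; rewrite (setIidr ED) => /(_ fE).
apply: eq_integrable => // x /[!inE] Dx.
rewrite patchE; case: ifPn => // /negP nE; apply/esym/f0 => // Ex; apply: nE; exact/mem_set.
Qed.

End Restriction.

Section Pieces.
Context {R : realType} {r k : nat} {N : manifold R k} {M : manifold R r.+1}.
Variables (F : M -> N) (Om : dform N r.+1) (D : set M) (oD : open D).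
Variables (B : nat -> flow_box F Om D) (n : nat).
Hypothesis cov : forall p, closure D p -> exists2 a, (a < n)%N & bin (B a) p.
Variables (gN : metric N) (g : metric M).
Hypotheses (F_imm : immersion F) (g_induced : induced_metric F g gN).

Definition hbox a : set 'rV[R]_r.+1 :=
  ball (bx (B a)) (3 * be (B a)) `&` [set x | x 0 (bi (B a)) < bc (B a)].

Lemma open_hbox a : open (hbox a).
Proof.
apply: openI; first exact: ball_open.
apply: (@open_comp _ _ (fun x : 'rV[R]_r.+1 => x 0 (bi (B a))) [set t | t < bc (B a)]).
  by move=> x _; exact: coord_continuous.
exact: open_lt.
Qed.

Lemma hbox_dom a : hbox a `<=` cmap (bphi (B a)) @` cdom (bphi (B a)).
Proof. by move=> x [xb _]; exact: box_dom. Qed.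

Definition hset a : set M := cinv (bphi (B a)) @` hbox a.

Lemma hset_D a : hset a `<=` D.
Proof. by move=> _ [x [xb xc] <-]; apply/(b_half xb). Qed.

Lemma D_hset a p : D p -> bout (B a) p -> hset a p.
Proof. by move=> Dp [x xb e]; exists x => //; split=> //; apply/(b_half xb); rewrite e. Qed.

Lemma open_hset a : open (hset a).
Proof. by apply: open_chart_preimage; [exact: open_hbox|exact: hbox_dom]. Qed.

Let mD : measurable (D : set (borel M)). Proof. exact: borel_open. Qed.
Let mH a : measurable (hset a : set (borel M)). Proof. exact: (borel_open (open_hset a)). Qed.
Let mB a : measurable (hbox a : set (borel 'rV[R]_r.+1)).
Proof. by apply: borel_open; exact: open_hbox. Qed.

Lemma chi_continuous a : continuous (chi B a).
Proof.
move=> p; have [phi [aph dp]] := atlas_cover p.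
have ix : (cmap phi @` cdom phi) (cmap phi p) by exists p.
have c1 := C1_on_continuous (chi_C1 B a aph) ix.
apply: (@near_eq_continuous _ _ _ ((chi B a \o cinv phi) \o cmap phi)).
  have : nbhs p (cdom phi) by apply: open_nbhs_nbhs; split=> //; exact: cdom_open.
  by apply: filterS => q dq /=; rewrite cmapK.
by apply: continuous_comp; [exact: cmap_continuous|exact: c1].
Qed.

Lemma chi_out0 a p : ~ bout (B a) p -> chi B a p = 0.
Proof. by move=> nb; exact: (nbhs_singleton (chi_near0 nb)). Qed.

Section Volume.
Variables (mu : {measure set (borel M) -> \bar R}) (mu_vol : riemannian_measure g mu).

(** Inside the box [D] is the half ball [hbox a], so an integrand supported in the box becomes one
    on row vectors, extended by 0; integrability is brought back from there. *)
Lemma piece_integral a (f : M -> R) (q : 'rV[R]_r.+1 -> R) :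
  (forall p, ~ bout (B a) p -> f p = 0) ->
  {in (hset a : set M), continuous f} ->
  (forall y, hbox a y -> f (cinv (bphi (B a)) y) * Num.sqrt (\det (g (bphi (B a)) y)) = q y) ->
  (lam r.+1).-integrable [set: borel 'rV[R]_r.+1] (fun y => ((if y \in hbox a then q y else 0)%:E)) ->
  mu.-integrable (D : set (borel M)) (fun p => (f p)%:E) /\
  (\int[mu]_(p in D) (f p)%:E = \int[lam r.+1]_y (if y \in hbox a then q y else 0)%:E)%E.
Proof.
move=> f0 cf fq qi.
have mf : measurable_fun (hset a : set (borel M)) (f : borel M -> R).
  apply: borel_continuous; first exact: open_hset.
  by move=> p ph; apply: cf; exact/mem_set.
have q' : (lam r.+1).-integrable (hbox a : set (borel 'rV[R]_r.+1))
    (fun y => (f (cinv (bphi (B a)) y) * Num.sqrt (\det (g (bphi (B a)) y)))%:E).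
  apply: (@eq_integrable _ _ _ _ _ (mB a) (fun y => ((if y \in hbox a then q y else 0)%:E))).
    by move=> y yh; rewrite yh fq//; exact/set_mem.
  exact: (integrableS measurableT (mB a) (@subsetT _ _) qi).
have V := fun oP => vol_transfer (b_aph (B a)) mu_vol oP (@hbox_dom a) mf q'.
have [|fi fe] := V _; first exact: open_hbox.
have f0' p : D p -> ~ hset a p -> (f p)%:E = 0%E.
  by move=> Dp nh; rewrite f0// => /(D_hset Dp).
split; first exact: (integrable_restriction mD (mH a) (@hset_D a) f0' fi).
apply: etrans (integral_restriction mu (@hset_D a) f0') (etrans fe _).
rewrite integral_mkcond; apply: eq_integral => y _; rewrite patchE.
by case: ifPn => // /set_mem yh; rewrite fq.
Qed.

Lemma chi_integrable a : mu.-integrable (D : set (borel M)) (fun p => (chi B a p)%:E).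
Proof.
pose q y := chi B a (cinv (bphi (B a)) y) * Num.sqrt (\det (g (bphi (B a)) y)).
have cq y : `|y - bx (B a)| < 3 * be (B a) -> {for y, continuous q}.
  move=> /ball_norm /(@box_dom _ _ _ _ _ _ _ _ (B a)) iy; apply: continuousM.
    exact: (C1_on_continuous (chi_C1 B a (b_aph (B a))) iy).
  exact: (sqrt_det_continuous (b_aph (B a)) iy).
have q0 y : `|y - bx (B a)| < 3 * be (B a) -> 2 * be (B a) <= `|y - bx (B a)| -> q y = 0.
  by move=> h1 h2; rewrite /q chi_ball0// mul0r.
have zi := zext_integrable (be_gt0 (B a)) q0 cq.
apply: (proj1 (piece_integral (q := q) _ _ _ _)).
- exact: chi_out0.
- by move=> p _; exact: chi_continuous.
- by [].
have e : (fun y : borel 'rV[R]_r.+1 => ((if y \in hbox a then q y else 0)%:E : \bar R)) =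
    (fun y => (zext (bx (B a)) (be (B a)) q y)%:E) \_ (hbox a : set (borel 'rV[R]_r.+1)).
  apply/funext => y; rewrite patchE; case: ifPn => // /set_mem -[/ball_norm yb _].
  by rewrite /zext yb.
rewrite e; apply: (integrable_mkcond _ (mB a)).1.
exact: (integrableS measurableT (mB a) (@subsetT _ _) zi).
Qed.

Lemma chi_sumE p : closure D p -> \sum_(0 <= a < n) chi B a p = 1.
Proof. by move=> cp; exact: (nbhs_singleton (chi_sum cov cp)). Qed.

(** On [D] the constant 1 is a finite sum of the integrable functions [chi a]. *)
Lemma volume_fin : (mu D < +oo)%E.
Proof.
have i1 : mu.-integrable (D : set (borel M)) (fun p => (\sum_(0 <= a < n) (chi B a p)%:E)%E).
  by apply: integrable_sum => // a _; exact: chi_integrable.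
have i2 : mu.-integrable (D : set (borel M)) (cst 1%E).
  apply: eq_integrable i1 => // p /set_mem Dp.
  by rewrite sumEFin chi_sumE//; exact: subset_closure.
have [_] := integrableP _ _ _ i2; apply: le_lt_trans.
rewrite (eq_integral (cst 1%E)); last by move=> p _; rewrite /= normr1.
by rewrite integral_cst// mul1e.
Qed.

Lemma volume_gt0 : D !=set0 -> (0 < mu D)%E.
Proof.
move=> [p Dp]; have [a an bp] := cov (subset_closure Dp).
have bo : bout (B a) p.
  move: bp => [x xb e]; exists x => //; apply/ball_norm; apply: lt_trans ((ball_norm _ _ _).1 xb) _.
  by rewrite ltr_pMl ?ltr1n//; exact: be_gt0.
have [x xh xp] := D_hset Dp bo.
have ix := hbox_dom xh.
have s0 : 0 < Num.sqrt (\det (g (bphi (B a)) x)).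
  by rewrite sqrtr_gt0; apply: metric_det_gt0 => //; exact: b_aph.
set s := Num.sqrt _ in s0.
(* On a small ball the volume density stays above half its value [s] at the centre. *)
have n1 : nbhs x [set y | s / 2 < Num.sqrt (\det (g (bphi (B a)) y))].
  apply: (@sqrt_det_continuous _ _ _ g _ (b_aph (B a)) x ix [set t | s / 2 < t]).
  by apply: lt_nbhsr; rewrite ltr_pdivrMr// ltr_pMr// ltr1n.
have n2 : nbhs x (hbox a) by apply: open_nbhs_nbhs; split=> //; exact: open_hbox.
have [e /= e0 eB] := (nbhs_ballP x _).1 (filterI n1 n2).
pose P := ball x e.
have Pd : P `<=` cmap (bphi (B a)) @` cdom (bphi (B a)).
  by move=> y /eB [_ /hbox_dom].
have oP : open P by exact: ball_open.
have mP : measurable (P : set (borel 'rV[R]_r.+1)) by exact: borel_open.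
have oE := open_chart_preimage oP Pd.
have ED : cinv (bphi (B a)) @` P `<=` D.
  by move=> _ [y /eB [_ yh] <-]; apply: (@hset_D a); exists y.
have mE : measurable (cinv (bphi (B a)) @` P : set (borel M)) by exact: borel_open.
apply: (@lt_le_trans _ _ (mu (cinv (bphi (B a)) @` P))); last first.
  by apply: le_measure => //; exact/mem_set.
have := vol_ge0 (b_aph (B a)) mu_vol oP Pd (f := cst 1) (measurable_cst _) (fun _ _ => ler01).
rewrite (_ : (fun x : M => (cst 1 x)%:E) = cst 1%E)// integral_cst// mul1e => ->.
apply: (@lt_le_trans _ _ (\int[lam r.+1]_(y in P) (s / 2)%:E)%E).
  rewrite integral_cst// [X in (_ < _ * X)%E](lam_ball _ e0) -EFinM lte_fin.
  by rewrite mulr_gt0 ?exprn_gt0 ?divr_gt0// pmulrn_lgt0.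
apply: ge0_le_integral => //.
- by move=> y _; rewrite lee_fin divr_ge0// ltW.
- apply/measurable_EFinP; apply: measurable_funM; first exact: measurable_cst.
  apply: borel_continuous => // y Py.
  by apply: sqrt_det_continuous; [exact: b_aph|exact: Pd].
- by move=> y /eB [/= ys _]; rewrite lee_fin mul1r ltW.
Qed.

(** The divergence theorem in one box: the volume density cancels the denominator of [kap], and
    among the components of the field only the one normal to the face contributes. *)
Lemma kap_integral a :
  mu.-integrable (D : set (borel M)) (fun p => (kap B gN g a p)%:E) /\
  (\int[mu]_(p in D) (kap B gN g a p)%:E =
   (- bs (B a))%:E * \int[lam r]_y (fld B gN g a (bi (B a)) (insr (bi (B a)) (bc (B a)) y))%:E)%E.
Proof.
pose v j := fld B gN g a j; pose i := bi (B a); pose c := bc (B a).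
have Cv j : C1_on [set: 'rV[R]_r.+1] (v j) := fld_C1 B F_imm g_induced a j.
have v0 j x : `|bx (B a)| + 2 * be (B a) <= `|x| -> v j x = 0.
  by apply: zext_support => y; exact: qfun_ball0.
pose G j (x : borel 'rV[R]_r.+1) : R := if (x : 'rV[R]_r.+1) 0 i < c then 'D_(delta_mx 0 j) (v j) x else 0.
have Gi j : (lam r.+1).-integrable [set: borel 'rV[R]_r.+1] (fun x => (G j x)%:E).
  exact: (half_space_integrable (Cv j) (v0 j)).
pose q y := - bs (B a) * \sum_j 'D_(delta_mx 0 j) (v j) y.
(* Outside the ball the derivatives of the zero extension vanish, so of the two conditions in [hbox]
   only the half-space matters. *)
have eq_q : (fun y : borel 'rV[R]_r.+1 => (if y \in hbox a then q y else 0)%:E : \bar R) =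
   (fun y => ((- bs (B a))%:E * (\sum_j (G j y)%:E))%E).
  apply/funext => y; rewrite sumEFin -EFinM; congr (_%:E).
  case: ifPn => [/set_mem [yb yc]|/negP nh].
    by rewrite /q; congr (_ * _); apply: eq_bigr => j _; rewrite /G yc.
  rewrite big1 ?mulr0// => j _; rewrite /G; case: ifPn => // yc.
  have nb : ~~ (`|y - bx (B a)| < 3 * be (B a)).
    by apply/negP => yb; apply: nh; apply/mem_set; split=> //; exact/ball_norm.
  apply: etrans (near_eq_derive _ (zext_near_out (be_gt0 (B a)) (@qfun_ball0 _ _ _ _ _ _ _ _ B gN g a j) nb)) _.
  exact: derive_cst.
have sGi : (lam r.+1).-integrable [set: borel 'rV[R]_r.+1] (fun y => (\sum_j (G j y)%:E)%E).
  by apply: integrable_sum => // j _; exact: Gi.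
have qi : (lam r.+1).-integrable [set: borel 'rV[R]_r.+1]
    (fun y => ((if y \in hbox a then q y else 0)%:E)).
  by rewrite eq_q; exact: (integrableZl measurableT).
have k1 p : ~ bout (B a) p -> kap B gN g a p = 0 by move=> nb; rewrite /kap asboolF.
have k2 : {in (hset a : set M), continuous (kap B gN g a)}.
  move=> p ph; have [x xh ex] := set_mem ph.
  have ix := hbox_dom xh.
  have cp : cmap (bphi (B a)) p = x by rewrite -ex cinvK.
  have dp : cdom (bphi (B a)) p by rewrite -ex; exact: cinv_dom.
  have cc : {for p, continuous (cmap (bphi (B a)))} by exact: cmap_continuous.
  apply: (@near_eq_continuous _ _ _ ((fun x => q x / Num.sqrt (\det (g (bphi (B a)) x))) \o cmap (bphi (B a)))).
    have : nbhs p (bout (B a)).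
      apply: open_nbhs_nbhs; split; last by exists x => //; case: xh.
      exact: (open_outer (@box_dom _ _ _ _ _ _ _ _ (B a))).
    by apply: filterS => p' bp'; rewrite /kap asboolT.
  apply: continuous_comp; first exact: cc.
  rewrite cp; apply: continuousM; last first.
    apply: continuousV; last exact: (sqrt_det_continuous (b_aph (B a)) ix).
    by rewrite gt_eqF// sqrtr_gt0; apply: metric_det_gt0 => //; exact: b_aph.
  apply: continuousM; first exact: cst_continuous.
  by apply: continuous_sumr => j _; exact: ((Cv j).2 _ x I).
have k3 y : hbox a y ->
    kap B gN g a (cinv (bphi (B a)) y) * Num.sqrt (\det (g (bphi (B a)) y)) = q y.
  move=> yh; have yb := yh.1; rewrite /kap asboolT; last by exists y.
  rewrite cinvK; last exact: hbox_dom.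
  rewrite divfK// gt_eqF// sqrtr_gt0; apply: metric_det_gt0; first exact: b_aph.
  exact: hbox_dom.
have [ki ke] := piece_integral k1 k2 k3 qi.
split=> //; apply: etrans ke _; rewrite eq_q integralZl//; congr (_ * _)%E.
rewrite integral_sum//.
rewrite (eq_bigr (fun j => if j == i then (\int[lam r]_y (v j (insr i c y))%:E)%E else 0%E)).
  by rewrite -big_mkcond big_pred1_eq.
by move=> j _; exact: (half_space_integral (Cv j) (v0 j)).
Qed.

End Volume.

End Pieces.

Section Slice.
Context {R : realType} {r : nat}.

Lemma insr_norm_ge (i : 'I_r.+1) (t : R) (y : 'rV[R]_r) : `|y| <= `|insr i t y|.
Proof.
rewrite row_normE//; apply/forallP => j; rewrite -(insr_lift i t y j).
exact: row_norm_entry.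
Qed.

Lemma slice_integrable (v : 'rV[R]_r.+1 -> R) (b c : R) (i : 'I_r.+1) : continuous v ->
  (forall x, b <= `|x| -> v x = 0) ->
  (lam r).-integrable [set: borel 'rV[R]_r] (fun y => (v (insr i c y))%:E).
Proof.
move=> cv v0; have [C HC] := bounded_support cv v0.
apply: (@bounded_support_integrable _ _ (fun y => v (insr i c y)) C b).
- apply: borel_continuousT => y; apply: continuous_comp; last exact: cv.
  exact: continuous_insr.
- by move=> y; exact: HC.
- by move=> y yb; apply: v0; apply: (le_trans yb); exact: insr_norm_ge.
Qed.

End Slice.

(** * Face integrals and the area of the boundary *)

Section BoundaryTerms.
Context {R : realType} {r k : nat} {N : manifold R k} {M : manifold R r.+1}.
Variables (F : M -> N) (Om : dform N r.+1) (D : set M) (oD : open D).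
Variables (B : nat -> flow_box F Om D) (n : nat).
Hypothesis cov : forall p, closure D p -> exists2 a, (a < n)%N & bin (B a) p.
Variables (g : metric M).

Definition wfun a x := chi B a (cinv (bphi (B a)) x) * face_density g (bphi (B a)) (bi (B a)) x.

Definition wslice a y := zext (bx (B a)) (be (B a)) (wfun a) (insr (bi (B a)) (bc (B a)) y).

Lemma wfun_ball0 a x : `|x - bx (B a)| < 3 * be (B a) ->
  2 * be (B a) <= `|x - bx (B a)| -> wfun a x = 0.
Proof. by move=> h1 h2; rewrite /wfun chi_ball0// mul0r. Qed.

Lemma wslice_ge0 a y : 0 <= wslice a y.
Proof.
rewrite /wslice /zext; case: ifP => // _; apply: mulr_ge0; first exact: chi_ge0.
exact: sqrtr_ge0.
Qed.

Lemma wzext_continuous a : continuous (zext (bx (B a)) (be (B a)) (wfun a)).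
Proof.
apply: (zext_continuous (be_gt0 (B a)) (@wfun_ball0 a)) => x.
move=> /ball_norm /(@box_dom _ _ _ _ _ _ _ _ (B a)) ix; apply: continuousM.
  exact: (C1_on_continuous (chi_C1 B a (b_aph (B a))) ix).
by apply: face_density_continuous ix; exact: b_aph.
Qed.

Lemma wslice_integrable a :
  (lam r).-integrable [set: borel 'rV[R]_r] (fun y => (wslice a y)%:E).
Proof. exact: (slice_integrable _ _ (@wzext_continuous a) (zext_support (@wfun_ball0 a))). Qed.

Lemma interior_face a y : bx (B a) 0 (bi (B a)) + 2 * be (B a) <= bc (B a) ->
  2 * be (B a) <= `|insr (bi (B a)) (bc (B a)) y - bx (B a)|.
Proof.
move=> H; have := row_norm_entry (insr (bi (B a)) (bc (B a)) y - bx (B a)) (bi (B a)).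
apply: le_trans; rewrite mxE insr_id mxE.
by apply: le_trans (ler_norm _); rewrite lerBrDl.
Qed.

Section Area.
Variables (sigma : {measure set (borel M) -> \bar R}) (bm : boundary_measure g D sigma).

Let mbd : measurable (bd D : set (borel M)).
Proof.
by apply: borel_closed; apply: closedI; [exact: closed_closure|exact: open_closedC].
Qed.

Let mchi a (A : set M) : measurable (A : set (borel M)) ->
  measurable_fun (A : set (borel M)) (chi B a : borel M -> R).
Proof.
move=> mA; apply: (@measurable_funS _ _ _ _ [set: borel M]) => //.
by apply: borel_continuous => [|p _]; [exact: openT|exact: chi_continuous].
Qed.

Lemma chi_area a : (\int[sigma]_(p in bd D) (chi B a p)%:E = \int[lam r]_y (wslice a y)%:E)%E.
Proof.
have out p : ~ bout (B a) p -> (chi B a p)%:E = 0%E by move=> nb; rewrite chi_out0.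
have [[c0 bcD]|kind] := b_kind (B a); last first.
  (* Interior box: both sides are 0, since boundary points inside its ball lie on or beyond the
     face, where the cut-off has already vanished. *)
  rewrite !integral0_eq// => [y _|p bp].
    by rewrite /wslice (zext_eq0 (@wfun_ball0 a))//; exact: interior_face.
  have [bo|nbo] := pselect (bout (B a) p); last exact: out.
  move: bo => [x xb ex]; rewrite -ex chi_ball0//; first exact/ball_norm.
  have nD : ~ D p by case: bp.
  have xc : bc (B a) <= x 0 (bi (B a)).
    by rewrite leNgt; apply/negP => xc; apply: nD; rewrite -ex; apply/(b_half xb).
  have := row_norm_entry (x - bx (B a)) (bi (B a)); apply: le_trans.
  rewrite mxE mxE; apply: le_trans (ler_norm _); rewrite lerBrDl.
  exact: le_trans kind xc.
have Bd : ball (bx (B a)) (3 * be (B a)) `<=` cmap (bphi (B a)) @` cdom (bphi (B a)).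
  exact: box_dom.
have oB : open (ball (bx (B a)) (3 * be (B a))) by exact: ball_open.
pose E : set M := bd D `&` cinv (bphi (B a)) @` ball (bx (B a)) (3 * be (B a)).
have mE : measurable (E : set (borel M)).
  by apply: measurableI => //; apply: borel_open; exact: open_chart_preimage.
have A := fun oB => area_ge0 oD bcD bm oB Bd (mchi a mE) (fun p _ => chi_ge0 B a p).
have ED : E `<=` bd D by move=> p [].
have f0 p : bd D p -> ~ E p -> (chi B a p)%:E = 0%E.
  by move=> bp nE; apply: out => bo; apply: nE.
apply: etrans (integral_restriction sigma ED f0) _.
apply: etrans (A _) _; first exact: ball_open.
rewrite integral_mkcond; apply: eq_integral => y _; rewrite patchE /wslice /zext c0.
have -> : (`|insr (bi (B a)) 0 y - bx (B a)| < 3 * be (B a)) =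
    (y \in [set y | ball (bx (B a)) (3 * be (B a)) (insr (bi (B a)) 0 y)]).
  apply/idP/idP => [H|/set_mem H]; last exact/ball_norm.
  by apply/mem_set; exact/ball_norm.
by case: ifP.
Qed.

(** The right-hand side does not mention [sigma]: the face integrals alone determine the area. *)
Lemma area_sum : sigma (bd D) = (\sum_(0 <= a < n) \int[lam r]_y (wslice a y)%:E)%E.
Proof.
rewrite -[LHS]mul1e -integral_cst//.
rewrite (eq_integral (fun p : borel M => (\sum_(0 <= a < n) (chi B a p)%:E)%E)); last first.
  by move=> p /set_mem [cp _]; rewrite sumEFin (chi_sumE cov cp).
rewrite ge0_integral_sum//.
- by apply: eq_bigr => a _; exact: chi_area.
- by move=> a; apply/measurable_EFinP; exact: mchi.
- by move=> a p _; rewrite lee_fin chi_ge0.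
Qed.

End Area.

Variables (gN : metric N).
Hypotheses (F_imm : immersion F) (g_induced : induced_metric F g gN).
Hypotheses (Om_comass : comass_one gN Om).
Variables (O : orientation M) (theta : M -> R).
Hypothesis (r_gt0 : (0 < r)%N) (theta_angle : omega_angle F g O Om theta).
Hypothesis cos_gt0 : forall p, 0 < cos (theta p).
Variable h : R.
Hypothesis h0 : 0 <= h.
Hypothesis hE : forall phi psi p, charts_at F phi psi p -> mean_curv_norm F g gN phi psi p = h.
Variable S : R.
Hypothesis (sinS : forall q, bd D q -> sin (theta q) <= S).

(** On a boundary face, absolute values absorb the sign of the box before [fluxc_bound] is applied
    at a point of [bd D]; an interior face contributes 0. *)
Lemma face_flux_le a y :
  - bs (B a) * fld B gN g a (bi (B a)) (insr (bi (B a)) (bc (B a)) y) <= h * S * wslice a y.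
Proof.
set z := insr _ _ y; have [zb|zb] := boolP (`|z - bx (B a)| < 3 * be (B a)); last first.
  by rewrite /wslice -/z /fld /zext (negPf zb) !mulr0.
have [[c0 bcD]|kind] := b_kind (B a); last first.
  have H := interior_face y kind.
  by rewrite /wslice /fld (zext_eq0 (@wfun_ball0 a) H) (zext_eq0 (@qfun_ball0 _ _ _ _ _ _ _ _ B gN g a _) H) !mulr0.
have bz : ball (bx (B a)) (3 * be (B a)) z by exact/ball_norm.
have bdz : bd D (cinv (bphi (B a)) z).
  by apply: (boundary_chart_bd bcD); [exact: box_dom|rewrite insr_id].
rewrite /wslice -/z /fld /zext zb /qfun /wfun.
apply: le_trans (ler_norm _) _; rewrite normrM normrN b_sgn mul1r normrM.
rewrite (ger0_norm (chi_ge0 _ _ _)) mulrCA; apply: ler_wpM2l; first exact: chi_ge0.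
have ch := box_charts bz.
have := fluxc_bound F_imm g_induced Om_comass r_gt0 theta_angle cos_gt0 (bi (B a)) ch.
rewrite (hE ch) cinvK; last exact: box_dom.
move=> H; apply: (le_trans H); apply: ler_wpM2r; first exact: sqrtr_ge0.
by apply: ler_wpM2l => //; exact: sinS.
Qed.

Lemma face_integral_le a :
  ((- bs (B a))%:E * \int[lam r]_y (fld B gN g a (bi (B a)) (insr (bi (B a)) (bc (B a)) y))%:E <=
   (h * S)%:E * \int[lam r]_y (wslice a y)%:E)%E.
Proof.
have Cv := fld_C1 B F_imm g_induced a (bi (B a)).
have cv : continuous (fld B gN g a (bi (B a))) by move=> x; exact: (C1_on_continuous Cv I).
have fi := slice_integrable (bc (B a)) (bi (B a)) cv
  (zext_support (@qfun_ball0 _ _ _ _ _ _ _ _ B gN g a (bi (B a)))).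
have wi := wslice_integrable a.
rewrite -!integralZl//; apply: le_integral => //.
- exact: (integrableZl measurableT).
- exact: (integrableZl measurableT).
- by move=> y _; rewrite -!EFinM lee_fin; exact: face_flux_le.
Qed.

End BoundaryTerms.

(** * The estimate on a compact domain *)

Section DomainBound.
Context {R : realType} {r k : nat} {N : manifold R k} {M : manifold R r.+1}.
Variables (F : M -> N) (Om : dform N r.+1).
Variables (gN : metric N) (g : metric M).
Hypotheses (F_imm : immersion F) (g_induced : induced_metric F g gN).
Hypotheses (Om_comass : comass_one gN Om) (Om_par : parallel_form gN Om).
Variables (O : orientation M) (theta : M -> R).
Hypothesis (r_gt0 : (0 < r)%N) (theta_angle : omega_angle F g O Om theta).
Hypothesis cos_gt0 : forall p, 0 < cos (theta p).
Hypothesis H_parallel : parallel_mean_curv F g gN.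
Variable h : R.
Hypothesis h0 : 0 <= h.
Hypothesis hE : forall phi psi p, charts_at F phi psi p -> mean_curv_norm F g gN phi psi p = h.
Variables (mu : {measure set (borel M) -> \bar R}) (mu_vol : riemannian_measure g mu).
Variables (D : set M) (D_cpt : compact_domain D).

(** [T] is the area built from face integrals, because (2) supplies no boundary measure. [S] and [c]
    are arbitrary bounds so that all three parts of the theorem can use the estimate. *)
Lemma domain_bound : [/\ (0 < mu D)%E, (mu D < +oo)%E & exists T : R, [/\ 0 <= T,
  (forall sigma, boundary_measure g D sigma -> sigma (bd D) = T%:E) &
  forall S c, 0 <= S -> (forall q, bd D q -> sin (theta q) <= S) ->
    0 <= c -> (forall q, D q -> c <= cos (theta q)) ->
    r.+1%:R * h ^+ 2 * c * fine (mu D) <= h * S * T]].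
Proof.
have [oD D0 _ _] := D_cpt.
have tf0 phi psi p := @tangent_form_neq0 _ _ _ _ _ _ _ _ F_imm g_induced _ _ _ r_gt0 theta_angle cos_gt0 phi psi p.
have [B [n cov]] := exists_boxes F_imm g_induced tf0 D_cpt.
have V0 := volume_gt0 oD cov mu_vol D0; have V1 := volume_fin oD cov mu_vol.
split=> //; pose T a := fine (\int[lam r]_y (wslice B g a y)%:E)%E.
have TE a : (\int[lam r]_y (wslice B g a y)%:E = (T a)%:E)%E.
  rewrite /T fineK//; exact: (integrable_fin_num measurableT (wslice_integrable B g a)).
have T0 a : 0 <= T a.
  by rewrite -lee_fin -TE; apply: integral_ge0 => y _; rewrite lee_fin wslice_ge0.
exists (\sum_(0 <= a < n) T a); split=> [|sigma bm|S c S0 sinS c0 cosc].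
- exact: sumr_ge0.
- rewrite (area_sum oD cov bm) -sumEFin; apply: eq_bigr => a _; exact: TE.
have mD : measurable (D : set (borel M)) by exact: borel_open.
have ki a := kap_integral oD B F_imm g_induced mu_vol a.
have sk : mu.-integrable (D : set (borel M)) (fun p => (\sum_(0 <= a < n) (kap B gN g a p)%:E)%E).
  by apply: integrable_sum => // a _; exact: (ki a).1.
have le1 : ((r.+1%:R * h ^+ 2 * c)%:E * mu D <=
    \int[mu]_(p in D) (\sum_(0 <= a < n) (kap B gN g a p)%:E))%E.
  rewrite -integral_cst//; apply: le_integral => //.
    apply: (eq_integrable _ (EFin \o (cst (r.+1%:R * h ^+ 2 * c)))) => //.
    apply: measurable_bounded_integrable => //.
    exists `|r.+1%:R * h ^+ 2 * c|; split; first exact: num_real.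
    by move=> x xb y _; exact: ltW.
  move=> p /set_mem Dp; rewrite sumEFin lee_fin.
  rewrite (kap_sum cov F_imm g_induced Om_par r_gt0 theta_angle cos_gt0 H_parallel hE Dp).
  rewrite mulrC; apply: ler_wpM2r; first by rewrite mulr_ge0 ?exprn_ge0.
  exact: cosc.
have le2 : (\int[mu]_(p in D) (\sum_(0 <= a < n) (kap B gN g a p)%:E) <=
    (h * S * \sum_(0 <= a < n) T a)%:E)%E.
  rewrite integral_sum//; last by move=> a; exact: (ki a).1.
  rewrite mulr_sumr -sumEFin; apply: lee_sum => a _; rewrite (ki a).2.
  rewrite EFinM -TE.
  exact: (face_integral_le B F_imm g_induced Om_comass r_gt0 theta_angle cos_gt0 h0 hE sinS a).
have := le_trans le1 le2.
rewrite -{1}(@fineK _ (mu D)) ?ge0_fin_numE//.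
Qed.

(** [theta] comes without any regularity; [cosE] exhibits its cosine as a continuous expression in
    charts. *)
Lemma cos_continuous_angle : continuous (fun p => cos (theta p)).
Proof.
move=> p; have [phi [aph dp]] := atlas_cover p; have [psi [aps dq]] := atlas_cover (F p).
have ch : charts_at F phi psi p by [].
have Ux := pdom_charts ch.
have ix : (cmap phi @` cdom phi) (cmap phi p) by exists p.
pose cc x := `|tangent_form F Om phi psi x| / Num.sqrt (\det (g phi x)).
apply: (@near_eq_continuous _ _ _ (cc \o cmap phi)).
  have nd : nbhs p (cdom phi) by apply: open_nbhs_nbhs; split=> //; exact: cdom_open.
  have nF : nbhs p (F @^-1` cdom psi).
    by apply: (F_continuous F_imm); apply: open_nbhs_nbhs; split=> //; exact: cdom_open.
  apply: filterS (filterI nd nF) => q [dq' dFq].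
  exact: (cosE F_imm g_induced r_gt0 theta_angle cos_gt0 (conj (conj aph dq') (conj aps dFq))).
apply: continuous_comp; first exact: cmap_continuous.
apply: continuousM.
  apply: continuous_comp; last exact: norm_continuous.
  exact: (C1_on_continuous (tangent_form_C1 F_imm g_induced Om aph aps) Ux).
apply: continuousV; last exact: sqrt_det_continuous.
by rewrite gt_eqF// sqrtr_gt0; exact: metric_det_gt0.
Qed.

(** The minimum is attained on the compact closure, where the cosine is still positive; this keeps
    the infimum over [D] in the theorem away from 0. *)
Lemma cos_lower_bound : exists2 c, 0 < c & forall q, D q -> c <= cos (theta q).
Proof.
have [_ [q0 Dq0] cD _] := D_cpt.
have ne : closure D !=set0 by exists q0; exact: subset_closure.
have [q _ Hm] := compact_EVT_min ne cD (continuous_subspaceT cos_continuous_angle).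
by exists (cos (theta q)) => // p Dp; apply: Hm; apply/mem_set; exact: subset_closure.
Qed.

End DomainBound.

(** One factor [h] is divided out when [h] is positive; for [h = 0] the right-hand side is
    nonnegative. *)
Lemma quotient_bound {K : realFieldType} (m h S c V T : K) : 0 < m -> 0 <= h -> 0 <= S ->
  0 < c -> 0 < V -> 0 <= T -> m * h ^+ 2 * c * V <= h * S * T ->
  h <= m^-1 * (S / c) * (T / V).
Proof.
move=> m0 h0 S0 c0 V0 T0 H.
have [->|hn] := eqVneq h 0.
  by rewrite !mulr_ge0 ?invr_ge0// ltW.
have hp : 0 < h by rewrite lt_neqAle eq_sym hn.
have H' : m * h * c * V <= S * T.
  rewrite -(ler_pM2l hp); apply: le_trans (_ : _ <= m * h ^+ 2 * c * V) _.
    by rewrite le_eqVlt; apply/orP; left; apply/eqP; ring.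
  by apply: le_trans H _; rewrite mulrA.
have -> : m^-1 * (S / c) * (T / V) = S * T / (m * c * V).
  by field; rewrite !gt_eqF.
rewrite ler_pdivlMr; last by rewrite !mulr_gt0.
by apply: le_trans H'; rewrite le_eqVlt; apply/orP; left; apply/eqP; ring.
Qed.

Theorem theorem1p3 (R : realType) (m n : nat) (m_ge2 : (2 <= m)%N)
  (N : manifold R (m + n)) (gN : metric N)
  (Om : dform N m) (Om_calib : calibration gN Om)
  (Om_parallel : parallel_form gN Om)
  (M : manifold R m) (O : orientation M) (M_conn : connected [set: M])
  (F : M -> N) (F_imm : immersion F)
  (g : metric M) (g_induced : induced_metric F g gN)
  (mu : {measure set (borel M) -> \bar R}) (mu_vol : riemannian_measure g mu)
  (H_parallel : parallel_mean_curv F g gN)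
  (theta : M -> R) (theta_angle : omega_angle F g O Om theta)
  (cos_gt0 : forall p, 0 < cos (theta p)) :
  (forall (D : set M) (sigma : {measure set (borel M) -> \bar R}),
     compact_domain D -> boundary_measure g D sigma ->
     forall phi psi p, charts_at F phi psi p ->
       mean_curv_norm F g gN phi psi p <=
         m%:R^-1 *
         (sup [set sin (theta q) | q in bd D] /
          inf [set cos (theta q) | q in D]) *
         (fine (sigma (bd D)) / fine (mu D))) /\
  (forall tau : R, 0 < tau -> (forall p, tau <= cos (theta p)) ->
     (forall phi psi p, charts_at F phi psi p ->
        ((mean_curv_norm F g gN phi psi p)%:E <=
         (m%:R^-1 * (Num.sqrt (1 - tau ^+ 2) / tau))%:E * cheeger g mu)%E) /\
     (cheeger g mu = 0%E -> minimal F g gN)) /\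
  ((exists D : set M, compact_domain D /\
      forall q, bd D q -> cos (theta q) = 1) -> minimal F g gN).
Proof.
case: m m_ge2 N gN Om Om_calib Om_parallel M O M_conn F F_imm g g_induced mu mu_vol
  H_parallel theta theta_angle cos_gt0 => [//|r] r_gt0 N gN Om [_ Om_comass] Om_par M O M_conn F
  F_imm g g_induced mu mu_vol H_parallel theta theta_angle cos_gt0.
(* With [m = r.+1], the hypothesis [2 <= m] is this one by conversion. *)
have {}r_gt0 : (0 < r)%N by [].
have [h h0 hE] := norm_constant F_imm g_induced H_parallel M_conn.
have bound D (Dc : compact_domain D) := domain_bound F_imm g_induced Om_comass Om_par r_gt0
  theta_angle cos_gt0 H_parallel h0 hE mu_vol Dc.
have low D (Dc : compact_domain D) := cos_lower_bound F_imm g_induced r_gt0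
  theta_angle cos_gt0 Dc.
have m0 : 0 < r.+1%:R :> R by rewrite ltr0n.
have sin0 p : 0 <= sin (theta p) by exact: (sin_ge0 theta_angle p).
have h0_minimal : h = 0 -> minimal F g gN.
  move=> hz phi psi p ch; apply: (norm0_mean_curv F_imm g_induced ch).
  by rewrite (hE _ _ _ ch).
have sin_tau tau p : 0 < tau -> tau <= cos (theta p) -> sin (theta p) <= Num.sqrt (1 - tau ^+ 2).
  move=> t0 tc; rewrite -[leLHS]ger0_norm// -sqrtr_sqr ler_wsqrtr// sin2cos2 lerB//.
  by rewrite ler_sqr ?nnegrE// ltW.
have domain D (sigma : {measure set (borel M) -> \bar R}) S c : compact_domain D ->
    boundary_measure g D sigma -> 0 <= S -> (forall q, bd D q -> sin (theta q) <= S) ->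
    0 < c -> (forall q, D q -> c <= cos (theta q)) ->
    h <= r.+1%:R^-1 * (S / c) * (fine (sigma (bd D)) / fine (mu D)).
  move=> Dc bm S0 sS c0 cc; have [V0 V1 [T [T0 Tsig H]]] := bound D Dc.
  rewrite (Tsig _ bm) /=; apply: quotient_bound => //.
    by rewrite fine_gt0// V0.
  by apply: H => //; exact: ltW.
split; [|split].
- move=> D sigma Dc bm phi psi p ch; rewrite (hE _ _ _ ch).
  have [c c0 cc] := low D Dc; have [_ [q0 Dq0] _ _] := Dc.
  have has_inf : has_inf [set cos (theta q) | q in D].
    by split; [exists (cos (theta q0)); exists q0|exists 0 => _ [q _ <-]; exact: ltW].
  apply: domain => //.
  (* The boundary may be empty, as for [D = M] closed; [sup] of the empty set is then 0, an
     admissible [S]. *)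
  + have [[q bq]|ne] := pselect (bd D !=set0); last first.
      rewrite (_ : [set sin (theta q) | q in bd D] = set0) ?sup0//.
      by apply/seteqP; split=> // x [q bq _]; case: ne; exists q.
    apply: le_trans (sin0 q) _; apply: ub_le_sup; last by exists q.
    by exists 1 => _ [z _ <-]; exact: sin_le1.
  + move=> q bq; apply: ub_le_sup; last by exists q.
    by exists 1 => _ [z _ <-]; exact: sin_le1.
  + apply: lt_le_trans c0 _; apply: lb_le_inf; first by case: has_inf.
    by move=> _ [q Dq <-]; exact: cc.
  + by move=> q Dq; apply: ge_inf; [case: has_inf|exists q].
- move=> tau t0 tc; set C := _ * (_ / tau).
  have C0 : 0 <= C.
    by rewrite /C !mulr_ge0 ?invr_ge0 ?sqrtr_ge0// ltW.
  have hC : (h%:E <= C%:E * cheeger g mu)%E.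
    (* The comparison with the infimum divides by [C]. If [C = 0], then sin theta vanishes
       everywhere and [h = 0] follows without any domain. *)
    have [Cz|Cn] := eqVneq C 0.
      have sz : Num.sqrt (1 - tau ^+ 2) = 0.
        apply/eqP; move/eqP: Cz; rewrite /C !mulf_eq0 !invr_eq0 pnatr_eq0 /=.
        by rewrite (gt_eqF t0) orbF.
      have c1 q : cos (theta q) = 1.
        have s1 : sin (theta q) = 0.
          by apply/eqP; rewrite eq_le sin0 andbT -sz; apply: sin_tau.
        have := cos2Dsin2 (theta q); rewrite s1 expr0n addr0 => /eqP.
        rewrite sqrf_eq1 => /orP[/eqP//|/eqP e].
        by have := cos_gt0 q; rewrite e ltr0N1.
      have p : M := point.
      have [phi ap] := atlas_cover p; have [psi aq] := atlas_cover (F p).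
      have ch : charts_at F phi psi p by [].
      have hz := cos1_norm0 F_imm g_induced Om_comass Om_par r_gt0 theta_angle cos_gt0
        H_parallel c1 ch.
      by rewrite -(hE _ _ _ ch) hz Cz mul0e.
    have Cp : 0 < C by rewrite lt_neqAle eq_sym Cn.
    (* After division by [C] the claim is a lower bound for an infimum, to be checked on each
       domain. *)
    rewrite muleC -lee_pdivrMr// -EFinM; apply: le_ereal_inf_tmp => _ [D [sigma [Dc bm ->]]].
    rewrite lee_fin ler_pdivrMr// mulrC.
    by apply: domain => // q _; exact: sin_tau.
  split=> [phi psi p ch|ch0]; first by rewrite (hE _ _ _ ch).
  apply: h0_minimal; apply/eqP; rewrite eq_le h0 andbT.
  by move: hC; rewrite ch0 mule0 lee_fin.
- move=> [D [Dc c1]]; apply: h0_minimal; have [c c0 cc] := low D Dc.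
  have [V0 V1 [T [T0 _ H]]] := bound D Dc.
  (* So [S = 0] is admissible and the estimate forces [h ^+ 2] times positive factors to be at most
     0. *)
  have s0 q : bd D q -> sin (theta q) <= 0.
    move=> bq; have := cos2Dsin2 (theta q); rewrite c1// expr1n -[X in _ = X]addr0.
    by move=> /addrI/eqP; rewrite sqrf_eq0 => /eqP ->.
  have := H 0 c (lexx 0) s0 (ltW c0) cc; rewrite mulr0 mul0r => le0.
  have V0' : 0 < fine (mu D) by rewrite fine_gt0// V0.
  apply/eqP; rewrite -sqrf_eq0 eq_le sqr_ge0 andbT.
  move: le0; rewrite pmulr_lle0// pmulr_lle0// pmulr_rle0//.
Qed.
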